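(* For $\tau\in\mathbb{H}$ let $f(z;\tau)$ be the function defined in the context, and for $k=0,1,2,\dots$ let $a_k(\tau)$ be defined by the power series expansion at $z=0$ $$f(z;\tau)=\sum_{k=0}^\infty a_k(\tau)\,z^k.$$ For each $k\ge0$, $a_k$ is a holomorphic function on $\mathbb{H}$ and defines a modular form of weight $k$ for the congruence subgroup $\Gamma(4)$ in the sense that $$a_k(\gamma\cdot\tau)=j(\gamma,\tau)^k\,a_k(\tau)\qquad\forall\,\gamma\in\Gamma(4).$$ Moreover $a_k(\tau)$ is meromorphic at the cusps of $X(4)$ for every $k$.
   Context: $\mathbb{H}$ is the upper half plane, $\Lambda_\tau=\mathbb{Z}+\mathbb{Z}\tau$, $\gamma\cdot\tau=\frac{a\tau+b}{c\tau+d}$ and $j(\gamma,\tau)=c\tau+d$ for $\gamma=\begin{pmatrix}a&b\\c&d\end{pmatrix}$; $\Gamma(4)=\{\gamma\in\mathrm{SL}_2(\mathbb{Z}):\gamma\equiv\mathrm{I}_2\bmod4\}$ and $X(4)$ is the compactified modular curve $\Gamma(4)\backslash(\mathbb{H}\sqcup\mathbb{P}^1(\mathbb{Q}))$. $f(z;\tau)$ is the meromorphic function of $z\in\mathbb{C}$ $$f(z;\tau)=\frac{\wp(\frac\tau4)-\wp(\frac14+\frac\tau2)}{\wp(\frac\tau4)-\wp(\frac14)}\cdot\frac{\wp(\frac z2)-\wp(\frac14)}{\wp(\frac z2)-\wp(\frac14+\frac\tau2)},\qquad\wp=\wp(\cdot;\Lambda_\tau),$$ which is holomorphic near $z=0$;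 it is a developing map of the unique solution of $\triangle u+e^u=4\pi\delta_0$ on $\mathbb{C}/\Lambda_\tau$, i.e. $u=\log\frac{8|f'|^2}{(1+|f|^2)^2}$. *)

(* Defs.v *)
From Stdlib Require Export Reals ZArith List ClassicalEpsilon.
From Coquelicot Require Export Coquelicot.

Open Scope C_scope.

Definition IZC (n : Z) : C := RtoC (IZR n).

Definition Cexp (z : C) : C :=
  ((exp (Re z) * cos (Im z))%R, (exp (Re z) * sin (Im z))%R).

(** The upper half plane, as a predicate on [C]. *)
Definition UHP (tau : C) : Prop := (0 < Im tau)%R.

Definition holomorphic_on_UHP (g : C -> C) : Prop :=
  forall tau, UHP tau -> ex_derive (K := C_AbsRing) (V := C_NormedModule) g tau.

(** Unconditional (order-independent) sum of [g] over a set [A] of complex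
    numbers: the limit of the finite sums along the directed family of finite
    subsets of [A], each represented by a duplicate-free list. *)
Definition finite_sum (g : C -> C) (F : list C) : C :=
  fold_right Cplus 0 (map g F).

Definition is_set_sum (A : C -> Prop) (g : C -> C) (l : C) : Prop :=
  forall eps : R, (0 < eps)%R ->
  exists F0 : list C, List.Forall A F0 /\
    forall F : list C, NoDup F -> List.Forall A F -> incl F0 F ->
      (Cmod (finite_sum g F - l) < eps)%R.

(** [epsilon] selects the value of the sum, which is unique when it exists. *)
Definition set_sum (A : C -> Prop) (g : C -> C) : C :=
  epsilon (inhabits (RtoC 0)) (is_set_sum A g).

Definition lattice (tau : C) (w : C) : Prop :=
  exists m n : Z, w = IZC m + IZC n * tau.

(** Weierstrass' function of the lattice [L], meaningful for [z] outside [L]. *)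
Definition wp (L : C -> Prop) (z : C) : C :=
  / z ^ 2 + set_sum (fun w => L w /\ w <> 0) (fun w => / (z - w) ^ 2 - / w ^ 2).

Definition f (z tau : C) : C :=
  let P := wp (lattice tau) in
  (P (tau / 4) - P (1 / 4 + tau / 2)) / (P (tau / 4) - P (1 / 4))
  * ((P (z / 2) - P (1 / 4)) / (P (z / 2) - P (1 / 4 + tau / 2))).

(** [g] has a removable singularity at 0 and [sum_k a_k z^k] is its expansion
    there.  The point 0 is excluded because functions given by formulas such as
    [f] take a junk value where the formula is undefined ([wp] has a pole at 0);
    the value of the meromorphic function at 0 is then [a 0]. *)
Definition power_series_at_0 (g : C -> C) (a : nat -> C) : Prop :=
  exists r : R, (0 < r)%R /\
    forall z : C, (0 < Cmod z < r)%R ->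
      is_pseries (K := C_AbsRing) (V := C_NormedModule) a z (g z).

Definition meromorphic_at_0 (F : C -> C) : Prop :=
  exists (N : nat) (c : nat -> C), power_series_at_0 (fun q => q ^ N * F q) c.

Record SL2Z := mkSL2Z {
  ma : Z; mb : Z; mc : Z; md : Z;
  SL2Z_det : (ma * md - mb * mc = 1)%Z
}.

Definition Gamma4 (g : SL2Z) : Prop :=
  (4 | ma g - 1)%Z /\ (4 | mb g)%Z /\ (4 | mc g)%Z /\ (4 | md g - 1)%Z.

Definition jfac (g : SL2Z) (tau : C) : C := IZC (mc g) * tau + IZC (md g).

Definition act (g : SL2Z) (tau : C) : C :=
  (IZC (ma g) * tau + IZC (mb g)) / jfac g tau.

Definition slash (k : nat) (h : C -> C) (g : SL2Z) (tau : C) : C :=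
  h (act g tau) / jfac g tau ^ k.

(** Every cusp of X(4) is the class of [g oo] for some [g] in SL2(Z), and all of
    them have width 4 and are regular (Gamma(4) is normal in SL2(Z) and does not
    contain -T^n), so [q = exp (2 pi i tau / 4)], read through [g], is a local
    parameter there. *)
Definition meromorphic_at_cusps_X4 (k : nat) (h : C -> C) : Prop :=
  forall g : SL2Z, exists F : C -> C,
    meromorphic_at_0 F /\
    forall tau, UHP tau ->
      slash k h g tau = F (Cexp (2 * RtoC PI * Ci * tau / 4)).

(* Main.v *)
Require Import Defs.
From Stdlib Require Import Lra Lia Psatz Permutation FunctionalExtensionality.
Set Bullet Behavior "Strict Subproofs".

(** Summing the Weierstrass series along rows and using
    [sum_n 1/(z+n)^2 = pi^2/sin^2(pi z)] shows that [wp] differs by a constant from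
    [W(z) = sum_n pi^2/sin^2(pi(z + n tau))].  From this form one reads off that [W] is
    doubly periodic, and that its values at 4-torsion points, as well as the Taylor
    coefficients at 0 of [W(z) - pi^2/sin^2(pi z)], are power series in
    [q = exp(2 pi i tau/4)] convergent for [|q| < 1].

    If [e1, e2, e3] are the values of [W] at the three torsion points, then with
    [s(z) = sin^2(pi z/2)/pi^2] and [H] the regular part of [W],
    [f = (e1-e3)/(e1-e2) * (1 + s(z)(H(z/2)-e2)) / (1 + s(z)(H(z/2)-e3))], so each [a_k] is a
    quotient of two power series in [q] with denominator [e1 - e2].  Composing with
    [gamma] in SL2(Z) only replaces the torsion points by other ones, because
    [wp(z; gamma tau) = j^2 wp(j z; tau)]; for [gamma] in Gamma(4) the points do not
    change modulo the lattice.

    The denominator does not vanish: if [W(tau/4) = W(1/4) = A], the product of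
    [W(z + j/4) - A] over [j] mod 4 is an entire elliptic function with a zero, hence 0. *)

(** * Unconditional sums *)

(** Two demands fix the shape of the argument. At each cusp a single function of q must serve all of
    the upper half plane, so the coefficients are built as quotients of power series on the whole
    disc |q| < 1, chosen before tau; holomorphy in tau and meromorphy at q = 0 are two readings of
    such a quotient. And the Weierstrass series is an unordered sum, so summing it by rows requires
    a Fubini theorem for absolutely summable families. Analyticity always means a convergent power
    series: products, reciprocals and compositions with exponentials act on coefficients, the
    maximum principle compares leading terms, and Liouville's theorem is used for functions all of
    whose values occur on one compact rectangle. The classical reason for e1 <> e2 is that wp takes
    each value exactly twice, a count of zeros. The product over the shifts by 1/4 replaces that
    count: it moves the zeros at 1/4 and -1/4 onto the double pole. The argument is made for tau/4
    and 1/4 only, and reaches the other torsion points by being applied at gamma tau. *)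

Definition edec {I : Type} (x y : I) : {x = y} + {x <> y} :=
  excluded_middle_informative (x = y).

Definition lsum {I : Type} (g : I -> C) (F : list I) : C :=
  fold_right Cplus 0 (map g F).

Definition rsum {I : Type} (a : I -> R) (F : list I) : R :=
  fold_right Rplus 0%R (map a F).

Lemma lsum_nil {I} (g : I -> C) : lsum g nil = 0.
Proof. reflexivity. Qed.

Lemma rsum_nil {I} (a : I -> R) : rsum a nil = 0%R.
Proof. reflexivity. Qed.

Lemma lsum_cons {I} (g : I -> C) x F : lsum g (x :: F) = g x + lsum g F.
Proof. reflexivity. Qed.

Lemma rsum_cons {I} (a : I -> R) x F : rsum a (x :: F) = (a x + rsum a F)%R.
Proof. reflexivity. Qed.

Lemma lsum_app {I} (g : I -> C) F G : lsum g (F ++ G) = lsum g F + lsum g G.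
Proof.
  induction F as [|x F IH]; [rewrite ?app_nil_l, ?lsum_nil, ?rsum_nil; ring|].
  rewrite <- app_comm_cons, !lsum_cons, IH; ring.
Qed.

Lemma rsum_app {I} (a : I -> R) F G : rsum a (F ++ G) = (rsum a F + rsum a G)%R.
Proof.
  induction F as [|x F IH]; [rewrite ?app_nil_l, ?lsum_nil, ?rsum_nil; ring|].
  rewrite <- app_comm_cons, !rsum_cons, IH; ring.
Qed.

Lemma lsum_perm {I} (g : I -> C) F G : Permutation F G -> lsum g F = lsum g G.
Proof.
  induction 1; rewrite ?lsum_cons; try congruence; ring.
Qed.

Lemma rsum_perm {I} (a : I -> R) F G : Permutation F G -> rsum a F = rsum a G.
Proof.
  induction 1; rewrite ?rsum_cons; try congruence; ring.
Qed.

Lemma lsum_ext {I} (g h : I -> C) F :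
  (forall i, In i F -> g i = h i) -> lsum g F = lsum h F.
Proof.
  induction F as [|x F IH]; intros H; [reflexivity|].
  rewrite !lsum_cons, H, IH; auto using in_eq, in_cons.
Qed.

Lemma lsum_zero {I} (g : I -> C) F : (forall i, In i F -> g i = 0) -> lsum g F = 0.
Proof.
  induction F as [|x F IH]; intros H; [reflexivity|].
  rewrite lsum_cons, H, IH by auto using in_eq, in_cons. ring.
Qed.

Lemma lsum_plus {I} (g h : I -> C) F :
  lsum (fun i => g i + h i) F = lsum g F + lsum h F.
Proof.
  induction F as [|x F IH]; [rewrite ?app_nil_l, ?lsum_nil, ?rsum_nil; ring|]. rewrite !lsum_cons, IH; ring.
Qed.

Lemma lsum_scal {I} (k : C) (g : I -> C) F :
  lsum (fun i => k * g i) F = k * lsum g F.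
Proof.
  induction F as [|x F IH]; [rewrite ?app_nil_l, ?lsum_nil, ?rsum_nil; ring|]. rewrite !lsum_cons, IH; ring.
Qed.

Lemma lsum_map {I J} (phi : I -> J) (g : J -> C) F :
  lsum g (map phi F) = lsum (fun i => g (phi i)) F.
Proof. unfold lsum; now rewrite map_map. Qed.

Lemma rsum_map {I J} (phi : I -> J) (a : J -> R) F :
  rsum a (map phi F) = rsum (fun i => a (phi i)) F.
Proof. unfold rsum; now rewrite map_map. Qed.

Lemma rsum_le {I} (a b : I -> R) F :
  (forall i, In i F -> (a i <= b i)%R) -> (rsum a F <= rsum b F)%R.
Proof.
  induction F as [|x F IH]; intros H; [apply Rle_refl|].
  rewrite !rsum_cons. apply Rplus_le_compat; [apply H; now left|].
  apply IH; intros; apply H; now right.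
Qed.

Lemma rsum_plus {I} (a b : I -> R) F :
  rsum (fun i => a i + b i)%R F = (rsum a F + rsum b F)%R.
Proof.
  induction F as [|x F IH]; [rewrite ?app_nil_l, ?lsum_nil, ?rsum_nil; ring|]. rewrite !rsum_cons, IH; ring.
Qed.

Lemma rsum_scal {I} (k : R) (a : I -> R) F :
  rsum (fun i => k * a i)%R F = (k * rsum a F)%R.
Proof.
  induction F as [|x F IH]; [rewrite ?app_nil_l, ?lsum_nil, ?rsum_nil; ring|]. rewrite !rsum_cons, IH; ring.
Qed.

Lemma rsum_ge0 {I} (a : I -> R) F : (forall i, (0 <= a i)%R) -> (0 <= rsum a F)%R.
Proof.
  intros H; induction F as [|x F IH]; [apply Rle_refl|].
  rewrite rsum_cons. specialize (H x); lra.
Qed.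

Lemma lsum_RtoC {I} (a : I -> R) F : lsum (fun i => RtoC (a i)) F = RtoC (rsum a F).
Proof.
  induction F as [|x F IH]; [reflexivity|].
  now rewrite lsum_cons, rsum_cons, IH, RtoC_plus.
Qed.

Lemma Cmod_lsum_le {I} (g : I -> C) F :
  (Cmod (lsum g F) <= rsum (fun i => Cmod (g i)) F)%R.
Proof.
  induction F as [|x F IH]; [cbn; rewrite Cmod_0; apply Rle_refl|].
  rewrite lsum_cons, rsum_cons. eapply Rle_trans; [apply Cmod_triangle|]. lra.
Qed.

Lemma NoDup_incl_split {I} (F F' : list I) :
  NoDup F -> incl F F' -> exists G, Permutation F' (F ++ G).
Proof.
  intros HN; revert F'; induction HN as [|x F Hx HN IH]; intros F' Hi.
  - exists F'; reflexivity.
  - destruct (in_split x F' (Hi x (in_eq _ _))) as (l1 & l2 & ->).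
    destruct (IH (l1 ++ l2)) as [G HG].
    { intros y Hy. specialize (Hi y (in_cons _ _ _ Hy)).
      apply in_app_or in Hi. apply in_or_app. destruct Hi as [Hi|[Hi|Hi]]; auto.
      subst; contradiction. }
    exists G. rewrite <- Permutation_middle. cbn. now constructor.
Qed.

Lemma rsum_incl {I} (a : I -> R) F F' :
  (forall i, (0 <= a i)%R) -> NoDup F -> incl F F' -> (rsum a F <= rsum a F')%R.
Proof.
  intros Ha HN Hi. destruct (NoDup_incl_split F F' HN Hi) as [G HG].
  rewrite (rsum_perm _ _ _ HG), rsum_app.
  pose proof (rsum_ge0 a G Ha); lra.
Qed.

Lemma lsum_incl_zero {I} (g : I -> C) F F' :
  NoDup F -> NoDup F' -> incl F F' -> (forall i, In i F' -> ~ In i F -> g i = 0) ->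
  lsum g F' = lsum g F.
Proof.
  intros HN HN' Hi Hz. destruct (NoDup_incl_split F F' HN Hi) as [G HG].
  rewrite (lsum_perm _ _ _ HG), lsum_app.
  rewrite (lsum_zero g G); [ring|].
  intros i Hin. apply Hz.
  - apply (Permutation_in i (Permutation_sym HG)), in_or_app; now right.
  - intros HF. apply (Permutation_NoDup HG) in HN'.
    clear -HF Hin HN'. induction F as [|x F IH]; [destruct HF|].
    cbn in HN'; inversion HN' as [|? ? H1 H2]; subst.
    destruct HF as [->|HF]; [|auto]. apply H1, in_or_app; now right.
Qed.

Definition union {I} (F G : list I) : list I := nodup edec (F ++ G).

Lemma union_NoDup {I} (F G : list I) : NoDup (union F G).
Proof. apply NoDup_nodup. Qed.

Lemma union_incl_l {I} (F G : list I) : incl F (union F G).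
Proof. intros x Hx. apply nodup_In, in_or_app; now left. Qed.

Lemma union_incl_r {I} (F G : list I) : incl G (union F G).
Proof. intros x Hx. apply nodup_In, in_or_app; now right. Qed.

(** The index set is a whole type instead of a subset of C, so that reindexing is composition with a
    map and the lattice can be summed over pairs of integers. *)
Definition usum {I : Type} (g : I -> C) (l : C) : Prop :=
  forall eps : R, (0 < eps)%R -> exists F0 : list I,
    forall F, NoDup F -> incl F0 F -> (Cmod (lsum g F - l) < eps)%R.

Definition rbdd {I : Type} (a : I -> R) : Prop :=
  exists M, forall F, NoDup F -> (rsum a F <= M)%R.

(** The bound on finite sums of moduli gives existence and passes to subfamilies, products and
    double families; the limit fixes the value. *)
Definition asum {I : Type} (g : I -> C) (l : C) : Prop :=
  rbdd (fun i => Cmod (g i)) /\ usum g l.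

Definition tsum {I : Type} (g : I -> C) : C := epsilon (inhabits (RtoC 0)) (usum g).

Lemma Cmod_lt_eq (x y : C) : (forall eps, (0 < eps)%R -> (Cmod (x - y) < eps)%R) -> x = y.
Proof.
  intros H. apply Ceq_minus, Cmod_eq_0.
  destruct (Rle_lt_or_eq_dec 0 (Cmod (x - y)) (Cmod_ge_0 _)) as [Hl|He]; [|auto].
  specialize (H _ Hl); lra.
Qed.

Lemma Cmod_minus_sym (x y : C) : Cmod (x - y) = Cmod (y - x).
Proof. rewrite <- Cmod_opp. f_equal; ring. Qed.

Lemma usum_unique {I} (g : I -> C) l l' : usum g l -> usum g l' -> l = l'.
Proof.
  intros H H'. apply Cmod_lt_eq; intros eps He.
  destruct (H (eps / 2)%R ltac:(lra)) as [F HF].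
  destruct (H' (eps / 2)%R ltac:(lra)) as [F' HF'].
  specialize (HF _ (union_NoDup F F') (union_incl_l F F')).
  specialize (HF' _ (union_NoDup F F') (union_incl_r F F')).
  replace (l - l') with (- (lsum g (union F F') - l) + (lsum g (union F F') - l')) by ring.
  eapply Rle_lt_trans; [apply Cmod_triangle|]. rewrite Cmod_opp; lra.
Qed.

Lemma asum_unique {I} (g : I -> C) l l' : asum g l -> asum g l' -> l = l'.
Proof. intros [_ H] [_ H']; eapply usum_unique; eauto. Qed.

Lemma usum_ext {I} (g h : I -> C) l : (forall i, g i = h i) -> usum g l -> usum h l.
Proof. intros H. now rewrite (functional_extensionality g h H). Qed.

Lemma asum_ext {I} (g h : I -> C) l : (forall i, g i = h i) -> asum g l -> asum h l.
Proof. intros H. now rewrite (functional_extensionality g h H). Qed.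

Lemma tsum_eq {I} (g : I -> C) l : usum g l -> tsum g = l.
Proof.
  intros H. eapply usum_unique; [|exact H].
  unfold tsum. apply epsilon_spec; now exists l.
Qed.

Lemma usum_plus {I} (g h : I -> C) l m :
  usum g l -> usum h m -> usum (fun i => g i + h i) (l + m).
Proof.
  intros H H' eps He.
  destruct (H (eps / 2)%R ltac:(lra)) as [F HF].
  destruct (H' (eps / 2)%R ltac:(lra)) as [F' HF'].
  exists (F ++ F'). intros G HN Hi. rewrite lsum_plus.
  specialize (HF G HN (fun x Hx => Hi x (in_or_app _ _ _ (or_introl Hx)))).
  specialize (HF' G HN (fun x Hx => Hi x (in_or_app _ _ _ (or_intror Hx)))).
  replace (lsum g G + lsum h G - (l + m)) with ((lsum g G - l) + (lsum h G - m)) by ring.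
  eapply Rle_lt_trans; [apply Cmod_triangle|]. lra.
Qed.

Lemma usum_scal {I} (k : C) (g : I -> C) l :
  usum g l -> usum (fun i => k * g i) (k * l).
Proof.
  intros H eps He. pose proof (Cmod_ge_0 k) as Hk.
  assert (He' : (0 < eps / (Cmod k + 1))%R) by (apply Rdiv_lt_0_compat; lra).
  destruct (H _ He') as [F HF].
  exists F. intros G HN Hi. specialize (HF G HN Hi). rewrite lsum_scal.
  replace (k * lsum g G - k * l) with (k * (lsum g G - l)) by ring.
  rewrite Cmod_mult. pose proof (Cmod_ge_0 (lsum g G - l)).
  apply Rle_lt_trans with ((Cmod k + 1) * Cmod (lsum g G - l))%R; [nra|].
  replace eps with ((Cmod k + 1) * (eps / (Cmod k + 1)))%R by (field; lra).
  apply Rmult_lt_compat_l; lra.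
Qed.

Lemma usum_zero {I} : usum (fun _ : I => 0) 0.
Proof.
  intros eps He. exists nil. intros. rewrite lsum_zero by auto.
  replace (0 - 0) with (RtoC 0) by ring. now rewrite Cmod_0.
Qed.

Lemma usum_finite {I} (g : I -> C) L :
  NoDup L -> (forall i, ~ In i L -> g i = 0) -> usum g (lsum g L).
Proof.
  intros HN Hz eps He. exists L. intros F HF Hi.
  rewrite (lsum_incl_zero g L F) by auto.
  replace (lsum g L - lsum g L) with (RtoC 0) by ring. now rewrite Cmod_0.
Qed.

Lemma rbdd_ext {I} (a b : I -> R) : (forall i, a i = b i) -> rbdd a -> rbdd b.
Proof. intros H. now rewrite (functional_extensionality a b H). Qed.

Lemma rbdd_le {I} (a b : I -> R) : (forall i, (a i <= b i)%R) -> rbdd b -> rbdd a.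
Proof.
  intros H [M HM]. exists M. intros F HN. eapply Rle_trans; [|apply HM, HN].
  apply rsum_le; auto.
Qed.

Lemma rbdd_scal {I} (k : R) (a : I -> R) :
  (0 <= k)%R -> rbdd a -> rbdd (fun i => k * a i)%R.
Proof.
  intros Hk [M HM]. exists (k * M)%R. intros F HN. rewrite rsum_scal.
  apply Rmult_le_compat_l; auto.
Qed.

Lemma rbdd_plus {I} (a b : I -> R) : rbdd a -> rbdd b -> rbdd (fun i => a i + b i)%R.
Proof.
  intros [M HM] [M' HM']. exists (M + M')%R. intros F HN. rewrite rsum_plus.
  apply Rplus_le_compat; auto.
Qed.

(** Comparisons often fail at finitely many indices, for instance at lattice points close to z;
    these terms are added as a correction [c] supported on [L]. *)
Lemma rbdd_le_off {I} (a b : I -> R) L :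
  (forall i, (0 <= b i)%R) -> (forall i, ~ In i L -> (a i <= b i)%R) -> rbdd b -> rbdd a.
Proof.
  intros Hb Hab HB.
  set (c := fun i => if excluded_middle_informative (In i L) then Rabs (a i) else 0%R).
  apply rbdd_le with (fun i => b i + c i)%R.
  - intros i. unfold c. destruct (excluded_middle_informative (In i L)) as [Hi|Hi].
    + specialize (Hb i). pose proof (Rle_abs (a i)). lra.
    + specialize (Hab i Hi). lra.
  - apply rbdd_plus; [exact HB|].
    assert (Hc : forall i, (0 <= c i)%R).
    { intros i. unfold c. destruct (excluded_middle_informative _); [apply Rabs_pos|lra]. }
    exists (rsum c L). intros F HN.
    assert (HF : forall F, rsum c F =
      rsum c (filter (fun i => if excluded_middle_informative (In i L) then true else false) F)).
    { induction F0 as [|x F0 IH]; [reflexivity|]. rewrite rsum_cons, IH. cbn [filter].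
      destruct (excluded_middle_informative (In x L)) as [Hx|Hx] eqn:E; [reflexivity|].
      assert (c x = 0%R) as -> by (unfold c; now rewrite E). ring. }
    rewrite HF. apply rsum_incl; [exact Hc|now apply NoDup_filter|].
    intros i Hi. apply filter_In in Hi. destruct Hi as [_ Hi].
    now destruct (excluded_middle_informative (In i L)).
Qed.

Lemma rbdd_term {I} (a : I -> R) : rbdd a -> exists M, forall i, (a i <= M)%R.
Proof.
  intros [M HM]. exists M. intros i. specialize (HM (i :: nil)).
  rewrite rsum_cons in HM. cbn in HM. assert (NoDup (i :: nil)).
  { constructor; [easy|constructor]. }
  specialize (HM H); lra.
Qed.

Lemma rbdd_comp {I J} (phi : I -> J) (a : J -> R) :
  (forall i i', phi i = phi i' -> i = i') -> rbdd a -> rbdd (fun i => a (phi i)).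
Proof.
  intros Hinj [M HM]. exists M. intros F HN. rewrite <- (rsum_map phi a).
  apply HM. now apply FinFun.Injective_map_NoDup.
Qed.

Lemma rsum_list_prod {I J} (a : I -> R) (b : J -> R) F G :
  rsum (fun p => a (fst p) * b (snd p))%R (list_prod F G) = (rsum a F * rsum b G)%R.
Proof.
  induction F as [|x F IH]; [cbn [list_prod]; rewrite !rsum_nil; ring|]. cbn [list_prod].
  rewrite rsum_app, rsum_cons, IH, rsum_map. cbn.
  rewrite rsum_scal. ring.
Qed.

Lemma rbdd_prod {I J} (a : I -> R) (b : J -> R) :
  (forall i, (0 <= a i)%R) -> (forall j, (0 <= b j)%R) -> rbdd a -> rbdd b ->
  rbdd (fun p : I * J => a (fst p) * b (snd p))%R.
Proof.
  intros Ha Hb [M HM] [M' HM']. exists (M * M')%R. intros F HN.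
  apply Rle_trans with
    (rsum (fun p => a (fst p) * b (snd p))%R
       (list_prod (nodup edec (map fst F)) (nodup edec (map snd F)))).
  - apply rsum_incl; auto.
    + intros p. now apply Rmult_le_pos.
    + intros [i j] Hp. apply in_prod; apply nodup_In.
      * change i with (fst (i, j)). now apply in_map.
      * change j with (snd (i, j)). now apply in_map.
  - rewrite rsum_list_prod. apply Rmult_le_compat; try (now apply rsum_ge0).
    + apply HM, NoDup_nodup.
    + apply HM', NoDup_nodup.
Qed.

Lemma preimage_list {I J} (phi : I -> J) (F : list J) :
  (forall i i', phi i = phi i' -> i = i') -> NoDup F ->
  exists F', NoDup F' /\ forall i, In i F' <-> In (phi i) F.
Proof.
  intros Hinj HN. induction HN as [|x F Hx HN IH].
  - exists nil. split; [constructor|]. cbn; tauto.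
  - destruct IH as (F' & HN' & HF').
    destruct (excluded_middle_informative (exists i, phi i = x)) as [[i Hi]|Hno].
    + exists (i :: F'). split.
      * constructor; [|exact HN']. now rewrite HF', Hi.
      * intros k. cbn. rewrite HF'. split.
        -- intros [<-|H]; auto.
        -- intros [H|H]; auto. left. apply Hinj. congruence.
    + exists F'. split; [exact HN'|]. intros k. rewrite HF'. cbn. split; auto.
      intros [H|H]; auto. exfalso; apply Hno; now exists k.
Qed.

Lemma usum_extend {I J} (phi : I -> J) (g : J -> C) l :
  (forall i i', phi i = phi i' -> i = i') ->
  (forall j, (forall i, phi i <> j) -> g j = 0) ->
  usum (fun i => g (phi i)) l -> usum g l.
Proof.
  intros Hinj Hz H eps He. destruct (H eps He) as [F0 HF0].
  exists (map phi F0). intros F HN Hi.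
  destruct (preimage_list phi F Hinj HN) as (F' & HN' & HF').
  rewrite (lsum_incl_zero g (map phi F') F).
  - rewrite lsum_map. apply HF0; [exact HN'|].
    intros i Hin. apply HF', Hi. now apply in_map.
  - now apply FinFun.Injective_map_NoDup.
  - exact HN.
  - intros j Hj. apply in_map_iff in Hj. destruct Hj as (i & <- & Hi'). now apply HF'.
  - intros j Hj Hnj. apply Hz. intros i Hij. apply Hnj. subst j.
    apply in_map, HF', Hj.
Qed.

Lemma rbdd_extend {I J} (phi : I -> J) (a : J -> R) :
  (forall i i', phi i = phi i' -> i = i') ->
  (forall j, (forall i, phi i <> j) -> a j = 0%R) ->
  rbdd (fun i => a (phi i)) -> rbdd a.
Proof.
  intros Hinj Hz [M HM]. exists M. intros F HN.
  destruct (preimage_list phi F Hinj HN) as (F' & HN' & HF').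
  enough (rsum a F = rsum (fun i => a (phi i)) F') as -> by now apply HM.
  apply RtoC_inj. rewrite <- !lsum_RtoC.
  rewrite (lsum_incl_zero (fun i => RtoC (a i)) (map phi F') F).
  - now rewrite lsum_map.
  - now apply FinFun.Injective_map_NoDup.
  - exact HN.
  - intros j Hj. apply in_map_iff in Hj. destruct Hj as (i & <- & Hi'). now apply HF'.
  - intros j Hj Hnj. rewrite Hz; [reflexivity|]. intros i Hij. apply Hnj. subst j.
    apply in_map, HF', Hj.
Qed.

Lemma asum_extend {I J} (phi : I -> J) (g : J -> C) l :
  (forall i i', phi i = phi i' -> i = i') ->
  (forall j, (forall i, phi i <> j) -> g j = 0) ->
  asum (fun i => g (phi i)) l -> asum g l.
Proof.
  intros Hinj Hz [HB HU]. split.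
  - apply (rbdd_extend phi); auto. intros j Hj. rewrite Hz by auto. apply Cmod_0.
  - now apply (usum_extend phi).
Qed.

Lemma asum_bij {I J} (phi : I -> J) (psi : J -> I) (g : J -> C) l :
  (forall i, psi (phi i) = i) -> (forall j, phi (psi j) = j) ->
  asum g l -> asum (fun i => g (phi i)) l.
Proof.
  intros H1 H2 H. apply (asum_extend psi).
  - intros j j' E. rewrite <- (H2 j), <- (H2 j'). now rewrite E.
  - intros i Hi. exfalso. apply (Hi (phi i)). apply H1.
  - eapply asum_ext; [|exact H]. intros j; cbn. now rewrite H2.
Qed.

Lemma usum_nonneg {I} (a : I -> R) :
  (forall i, (0 <= a i)%R) -> rbdd a -> exists l : R, usum (fun i => RtoC (a i)) (RtoC l).
Proof.
  intros Ha [M HM].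
  destruct (completeness (fun x => exists F, NoDup F /\ x = rsum a F)) as [l [Hu Hl]].
  - exists M. intros x (F & HN & ->). now apply HM.
  - exists 0%R, nil. split; [constructor|reflexivity].
  - exists l. intros eps He.
    destruct (excluded_middle_informative
      (exists F, NoDup F /\ (l - eps < rsum a F)%R)) as [(F0 & HN0 & HF0)|Hno].
    + exists F0. intros F HN Hi. rewrite lsum_RtoC, <- RtoC_minus, Cmod_R.
      pose proof (rsum_incl a F0 F Ha HN0 Hi).
      assert (rsum a F <= l)%R by (apply Hu; now exists F).
      rewrite Rabs_left1; lra.
    + exfalso. assert (l <= l - eps)%R; [|lra]. apply Hl.
      intros x (F & HN & ->). apply Rnot_lt_le. intros Hlt. apply Hno. now exists F.
Qed.

(** A real family is (|a| + a) - |a|, a difference of two nonnegative families whose sums are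
    suprema; real and imaginary parts are treated separately. *)
Lemma usum_exists {I} (g : I -> C) :
  rbdd (fun i => Cmod (g i)) -> exists l, usum g l.
Proof.
  intros HB.
  assert (Hreal : forall a : I -> R, (forall i, Rabs (a i) <= Cmod (g i))%R ->
    exists l : R, usum (fun i => RtoC (a i)) l).
  { intros a Ha.
    destruct (usum_nonneg (fun i => Rabs (a i) + a i)%R) as [l1 H1].
    - intros i. pose proof (Rabs_maj2 (a i)). lra.
    - apply rbdd_le with (fun i => 2 * Cmod (g i))%R.
      + intros i. specialize (Ha i). pose proof (Rle_abs (a i)). lra.
      + apply rbdd_scal; [lra|exact HB].
    - destruct (usum_nonneg (fun i => Rabs (a i))) as [l2 H2].
      + intros; apply Rabs_pos.
      + now apply rbdd_le with (fun i => Cmod (g i)).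
      + exists (l1 + - (1) * l2)%R. rewrite RtoC_plus, RtoC_mult.
        eapply usum_ext; [|apply usum_plus; [exact H1|apply usum_scal, H2]].
        intros i. cbn. rewrite <- RtoC_mult, <- RtoC_plus. f_equal; ring. }
  destruct (Hreal (fun i => Re (g i))) as [x Hx].
  { intros i. apply re_le_Cmod. }
  destruct (Hreal (fun i => Im (g i))) as [y Hy].
  { intros i. eapply Rle_trans; [|apply Rmax_Cmod]. apply Rmax_r. }
  exists (x + Ci * y).
  eapply usum_ext; [|apply usum_plus; [exact Hx|apply usum_scal, Hy]].
  intros i. cbn. destruct (g i) as [u v]; apply injective_projections; cbn; ring.
Qed.

Lemma asum_exists {I} (g : I -> C) :
  rbdd (fun i => Cmod (g i)) -> asum g (tsum g).
Proof.
  intros HB. split; [exact HB|]. destruct (usum_exists g HB) as [l Hl].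
  now rewrite (tsum_eq g l).
Qed.

Lemma usum_le {I} (g : I -> C) l M :
  (forall F, NoDup F -> (rsum (fun i => Cmod (g i)) F <= M)%R) -> usum g l ->
  (Cmod l <= M)%R.
Proof.
  intros HM H. apply Rnot_lt_le. intros Hlt.
  destruct (H (Cmod l - M)%R ltac:(lra)) as [F0 HF0].
  specialize (HF0 (nodup edec F0) (NoDup_nodup _ _)).
  specialize (HM (nodup edec F0) (NoDup_nodup _ _)).
  pose proof (Cmod_lsum_le g (nodup edec F0)).
  assert (Cmod (lsum g (nodup edec F0) - l) < Cmod l - M)%R as Hd.
  { apply HF0. intros x Hx. now apply nodup_In. }
  pose proof (Cmod_triangle (lsum g (nodup edec F0)) (- (lsum g (nodup edec F0) - l))) as Ht.
  replace (lsum g (nodup edec F0) + - (lsum g (nodup edec F0) - l)) with l in Ht by ring.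
  rewrite Cmod_opp in Ht. lra.
Qed.

Lemma asum_plus {I} (g h : I -> C) l m :
  asum g l -> asum h m -> asum (fun i => g i + h i) (l + m).
Proof.
  intros [HB H] [HB' H']. split; [|now apply usum_plus].
  eapply rbdd_le; [|apply rbdd_plus; [exact HB|exact HB']].
  intros i; apply Cmod_triangle.
Qed.

Lemma asum_scal {I} (k : C) (g : I -> C) l :
  asum g l -> asum (fun i => k * g i) (k * l).
Proof.
  intros [HB H]. split; [|now apply usum_scal].
  eapply rbdd_ext; [|apply (rbdd_scal (Cmod k)); [apply Cmod_ge_0|exact HB]].
  intros i; cbn. now rewrite Cmod_mult.
Qed.

Lemma asum_zero {I} : asum (fun _ : I => 0) 0.
Proof.
  split; [|apply usum_zero]. exists 0%R. intros F _.
  induction F as [|x F IH]; [apply Rle_refl|]. rewrite rsum_cons. rewrite Cmod_0 in *. lra.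
Qed.

Lemma asum_finite {I} (g : I -> C) L :
  NoDup L -> (forall i, ~ In i L -> g i = 0) -> asum g (lsum g L).
Proof.
  intros HN Hz. split; [|now apply usum_finite].
  apply rbdd_le_off with (fun _ => 0%R) L.
  - intros; lra.
  - intros i Hi. rewrite Hz, Cmod_0 by auto. lra.
  - exists 0%R. intros F _. induction F as [|x F IH]; [apply Rle_refl|].
    rewrite rsum_cons. lra.
Qed.

(** The two images partition [J]; extending [g] by 0 from each of them gives two families on [J]
    that add up to [g]. *)
Lemma asum_cover {I I' J} (phi : I -> J) (phi' : I' -> J) (g : J -> C) l l' :
  (forall i k, phi i = phi k -> i = k) -> (forall i k, phi' i = phi' k -> i = k) ->
  (forall i k, phi i <> phi' k) ->
  (forall j, (exists i, phi i = j) \/ (exists i, phi' i = j)) ->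
  asum (fun i => g (phi i)) l -> asum (fun i => g (phi' i)) l' -> asum g (l + l').
Proof.
  intros Hi Hi' Hd Hc H H'.
  set (b := fun j => excluded_middle_informative (exists i, phi i = j)).
  assert (H1 : asum (fun j => if b j then g j else 0) l).
  { apply (asum_extend phi); [exact Hi| |].
    - intros j Hj. destruct (b j) as [[i E]|]; [now elim (Hj i)|reflexivity].
    - eapply asum_ext; [|exact H]. intros i; cbv beta.
      destruct (b (phi i)) as [|Hn]; [reflexivity|]. elim Hn. now exists i. }
  assert (H2 : asum (fun j => if b j then 0 else g j) l').
  { apply (asum_extend phi'); [exact Hi'| |].
    - intros j Hj. destruct (b j) as [|Hn]; [reflexivity|].
      destruct (Hc j) as [[i E]|[i E]]; [elim Hn; now exists i|now elim (Hj i)].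
    - eapply asum_ext; [|exact H']. intros k; cbv beta.
      destruct (b (phi' k)) as [[i E]|]; [now elim (Hd i k)|reflexivity]. }
  eapply asum_ext; [|apply asum_plus; [exact H1|exact H2]].
  intros j; cbv beta. destruct (b j); ring.
Qed.

(** In each row of [E] a finite piece close to the row sum is taken, large enough to contain the
    part of [F0] in that row; the tolerance is halved from row to row, so the total error stays
    below [d]. The last estimate, on moduli, is what makes the row sums absolutely summable. *)
Lemma fubini_lists {I J} (g : I * J -> C) (r : I -> C) (F0 : list (I * J)) E :
  (forall i, usum (fun j => g (i, j)) (r i)) -> NoDup E ->
  forall d, (0 < d)%R -> exists G, NoDup G /\ (forall p, In p G -> In (fst p) E) /\
    (forall p, In p F0 -> In (fst p) E -> In p G) /\
    (Cmod (lsum r E - lsum g G) < d)%R /\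
    (rsum (fun i => Cmod (r i)) E < rsum (fun p => Cmod (g p)) G + d)%R.
Proof.
  intros Hr HN. induction HN as [|i E Hi HN IH]; intros d Hd.
  - exists nil. split; [constructor|]. split; [easy|]. split; [easy|].
    rewrite !lsum_nil, !rsum_nil. replace (0 - 0) with (RtoC 0) by ring.
    rewrite Cmod_0. lra.
  - destruct (IH (d / 2)%R ltac:(lra)) as (G & HG & HG1 & HG2 & HG3 & HG4).
    destruct (Hr i (d / 2)%R ltac:(lra)) as [K HK].
    set (L := union K (map snd (filter
      (fun p => if edec (fst p) i then true else false) F0))).
    specialize (HK L (union_NoDup _ _) (union_incl_l _ _)).
    exists (map (pair i) L ++ G). split; [|split; [|split]].
    + apply NoDup_app.
      * apply FinFun.Injective_map_NoDup; [|apply union_NoDup]. intros a b E'; congruence.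
      * exact HG.
      * intros p Hp HpG. apply in_map_iff in Hp. destruct Hp as (j & <- & _).
        apply HG1 in HpG. exact (Hi HpG).
    + intros p Hp. apply in_app_or in Hp. destruct Hp as [Hp|Hp].
      * apply in_map_iff in Hp. destruct Hp as (j & <- & _). now left.
      * right. now apply HG1.
    + intros [a j] Hp Ha. apply in_or_app. cbn in Ha.
      destruct Ha as [<-|Ha]; [left|right; now apply HG2].
      apply in_map, union_incl_r. change j with (snd (i, j)). apply in_map, filter_In.
      split; [exact Hp|]. cbn. destruct (edec i i); congruence.
    + rewrite lsum_app, rsum_app, lsum_map, rsum_map, lsum_cons, rsum_cons.
      pose proof (Cmod_lsum_le (fun j => g (i, j)) L) as HL.
      pose proof (Cmod_triangle (lsum (fun j => g (i, j)) L)
        (- (lsum (fun j => g (i, j)) L - r i))) as Ht.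
      replace (lsum (fun j => g (i, j)) L + - (lsum (fun j => g (i, j)) L - r i))
        with (r i) in Ht by ring.
      rewrite Cmod_opp in Ht.
      split; [|lra].
      replace (r i + lsum r E - (lsum (fun j => g (i, j)) L + lsum g G)) with
        (- (lsum (fun j => g (i, j)) L - r i) + (lsum r E - lsum g G)) by ring.
      eapply Rle_lt_trans; [apply Cmod_triangle|]. rewrite Cmod_opp. lra.
Qed.

Lemma asum_fubini {I J} (g : I * J -> C) (r : I -> C) l :
  (forall i, usum (fun j => g (i, j)) (r i)) -> asum g l -> asum r l.
Proof.
  intros Hr [[M HM] H]. split.
  - exists (M + 1)%R. intros E HE.
    destruct (fubini_lists g r nil E Hr HE 1%R ltac:(lra)) as (G & HG & _ & _ & _ & HG4).
    specialize (HM G HG). lra.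
  - intros eps He. destruct (H (eps / 2)%R ltac:(lra)) as [F0 HF0].
    exists (map fst F0). intros E HE Hi.
    destruct (fubini_lists g r F0 E Hr HE (eps / 2)%R ltac:(lra))
      as (G & HG & _ & HG2 & HG3 & _).
    specialize (HF0 G HG). assert (incl F0 G) as Hinc.
    { intros p Hp. apply HG2; [exact Hp|]. apply Hi. now apply in_map. }
    specialize (HF0 Hinc).
    replace (lsum r E - l) with ((lsum r E - lsum g G) + (lsum g G - l)) by ring.
    eapply Rle_lt_trans; [apply Cmod_triangle|]. lra.
Qed.

Lemma asum_swap {I J} (g : I * J -> C) l :
  asum g l -> asum (fun p : J * I => g (snd p, fst p)) l.
Proof.
  apply (asum_bij (fun p : J * I => (snd p, fst p)) (fun p => (snd p, fst p)));
    now intros [? ?].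
Qed.

(** Once the product family is known to be summable its value is forced: by Fubini it is the sum of
    the rows [B * a i]. *)
Lemma asum_prod {I J} (a : I -> C) (b : J -> C) A B :
  asum a A -> asum b B -> asum (fun p => a (fst p) * b (snd p)) (A * B).
Proof.
  intros HA HB.
  assert (HP : rbdd (fun p : I * J => Cmod (a (fst p) * b (snd p)))).
  { eapply rbdd_ext; [|apply rbdd_prod; [| |apply HA|apply HB]];
      try (intros; apply Cmod_ge_0).
    intros p; cbn. now rewrite Cmod_mult. }
  pose proof (asum_exists _ HP) as HS.
  set (l := tsum _) in HS. enough (l = A * B) as <- by exact HS.
  eapply asum_unique.
  - apply (asum_fubini _ (fun i => B * a i)) in HS; [exact HS|].
    intros i. cbn. eapply usum_ext; [|rewrite Cmult_comm; apply usum_scal, HB].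
    intros j; reflexivity.
  - rewrite Cmult_comm. now apply asum_scal.
Qed.

(** * Families indexed by [nat] and [Z] *)

Lemma lsum_sum_n (g : nat -> C) n : lsum g (seq 0 (S n)) = sum_n g n.
Proof.
  induction n as [|n IH].
  - rewrite sum_O. cbn [seq]. rewrite lsum_cons, lsum_nil. ring.
  - rewrite sum_Sn, <- IH, (seq_S (S n)), lsum_app, lsum_cons, lsum_nil.
    change plus with Cplus. cbn [Nat.add]. ring.
Qed.

Lemma asum_is_series (g : nat -> C) l :
  asum g l -> is_series (K := C_AbsRing) (V := C_NormedModule) g l.
Proof.
  intros [_ H]. apply filterlim_locally. intros eps.
  destruct (H (eps / 2)%R) as [F0 HF0]; [destruct eps; cbn; lra|].
  exists (list_max F0). intros n Hn.
  specialize (HF0 (seq 0 (S n)) (seq_NoDup _ _)).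
  rewrite lsum_sum_n in HF0.
  apply (norm_compat1 (K := C_AbsRing) (V := C_NormedModule)).
  change (Cmod (sum_n g n - l) < eps)%R.
  eapply Rlt_trans; [apply HF0|destruct eps; cbn; lra].
  intros k Hk. apply in_seq. enough (k <= list_max F0)%nat by lia.
  pose proof (proj1 (list_max_le F0 (list_max F0)) (le_n _)) as Hall.
  rewrite Forall_forall in Hall. now apply Hall.
Qed.

(** The way back from the order-dependent convergence of [is_pseries] to absolute convergence on a
    smaller disc. *)
Lemma is_series_terms_bounded (g : nat -> C) (l : C) :
  is_series (K := C_AbsRing) (V := C_NormedModule) g l ->
  exists M, forall k, (Cmod (g k) <= M)%R.
Proof.
  intros H.
  assert (Hs : exists M, forall n, (Cmod (sum_n g n) <= M)%R).
  { unfold is_series in H.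
    pose proof (proj1 (filterlim_locally _ _) H (mkposreal 1 Rlt_0_1)) as [N HN].
    exists (rsum (fun n => Cmod (sum_n g n)) (seq 0 N) + (Cmod l + 2))%R. intros n.
    assert (H0 : (0 <= rsum (fun n => Cmod (sum_n g n)) (seq 0 N))%R).
    { apply rsum_ge0. intros; apply Cmod_ge_0. }
    destruct (Nat.lt_ge_cases n N) as [Hn|Hn].
    - pose proof (rsum_incl (fun n => Cmod (sum_n g n)) (n :: nil) (seq 0 N)) as Hi.
      rewrite rsum_cons, rsum_nil in Hi.
      assert (Cmod (sum_n g n) + 0 <= rsum (fun n => Cmod (sum_n g n)) (seq 0 N))%R.
      { apply Hi.
        - intros; apply Cmod_ge_0.
        - constructor; [easy|constructor].
        - intros k [<-|[]]. apply in_seq; lia. }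
      pose proof (Cmod_ge_0 l). lra.
    - specialize (HN n Hn).
      apply (norm_compat2 (K := C_AbsRing) (V := C_NormedModule)) in HN.
      (* The factor sqrt 2 appears because balls in C compare coordinates and not moduli. *)
      change (Cmod (sum_n g n - l) < sqrt 2 * 1)%R in HN.
      assert (sqrt 2 < 2)%R by (rewrite <- (sqrt_Rsqr 2) at 2 by lra;
        apply sqrt_lt_1; unfold Rsqr; lra).
      replace (sum_n g n) with ((sum_n g n - l) + l) by ring.
      pose proof (Cmod_triangle (sum_n g n - l) l). lra. }
  destruct Hs as [M HM]. exists (M + M)%R. intros [|k].
  - specialize (HM 0%nat). rewrite sum_O in HM. pose proof (Cmod_ge_0 (g 0%nat)). lra.
  - pose proof (HM k) as H1. pose proof (HM (S k)) as H2. rewrite sum_Sn in H2.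
    change plus with Cplus in H2.
    replace (g (S k)) with ((sum_n g k + g (S k)) + - sum_n g k) by ring.
    eapply Rle_trans; [apply Cmod_triangle|]. rewrite Cmod_opp. lra.
Qed.

Lemma is_series_C_unique (g : nat -> C) (l l' : C) :
  is_series (K := C_AbsRing) (V := C_NormedModule) g l ->
  is_series (K := C_AbsRing) (V := C_NormedModule) g l' -> l = l'.
Proof.
  intros H H'.
  exact (filterlim_locally_unique (K := C_AbsRing) (V := C_NormedModule) _ _ _ H H').
Qed.

Lemma asum_single {I} (g : I -> C) i0 : (forall i, i <> i0 -> g i = 0) -> asum g (g i0).
Proof.
  intros H. replace (g i0) with (lsum g (i0 :: nil)) by (rewrite lsum_cons, lsum_nil; ring).
  apply asum_finite.
  - constructor; [easy|constructor].
  - intros i Hi. apply H. intros ->. apply Hi. now left.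
Qed.

Lemma asum_single_eq {I} (g : I -> C) i0 l :
  g i0 = l -> (forall i, i <> i0 -> g i = 0) -> asum g l.
Proof. intros <-. apply asum_single. Qed.

Lemma asum_nat_shift (g : nat -> C) l :
  asum (fun n => g (S n)) l -> asum g (g 0%nat + l).
Proof.
  intros H. apply (asum_cover (fun _ : unit => 0%nat) S); try (intros; congruence); auto.
  - now intros [] [].
  - intros [|n]; [left; now exists tt|right; now exists n].
  - apply (asum_single_eq _ tt); [reflexivity|]. now intros [] Hn.
Qed.

Lemma asum_Z_split (g : Z -> C) lp lm :
  asum (fun n => g (Z.of_nat (S n))) lp -> asum (fun n => g (- Z.of_nat (S n))%Z) lm ->
  asum g (g 0%Z + lp + lm).
Proof.
  intros Hp Hm.
  apply (asum_cover Z.of_nat (fun n => - Z.of_nat (S n))%Z); auto; try (intros; lia).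
  - intros j. destruct (Z_lt_le_dec j 0).
    + right. exists (Z.to_nat (- j - 1)). lia.
    + left. exists (Z.to_nat j). lia.
  - exact (asum_nat_shift (fun n => g (Z.of_nat n)) lp Hp).
Qed.

Lemma rbdd_nat (a : nat -> R) M :
  (forall n, (0 <= a n)%R) -> (forall n, (rsum a (seq 0 n) <= M)%R) -> rbdd a.
Proof.
  intros Ha HM. exists M. intros F HN. eapply Rle_trans; [|apply (HM (S (list_max F)))].
  apply rsum_incl; auto. intros k Hk. apply in_seq.
  pose proof (proj1 (list_max_le F (list_max F)) (le_n _)) as Hall.
  rewrite Forall_forall in Hall. specialize (Hall k Hk). lia.
Qed.

Lemma rsum_geom_le r n :
  (0 <= r < 1)%R -> (rsum (fun n => r ^ n)%R (seq 0 n) <= / (1 - r))%R.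
Proof.
  intros Hr. enough (rsum (fun n => r ^ n)%R (seq 0 n) = (1 - r ^ n) / (1 - r))%R as ->.
  - assert (0 <= r ^ n)%R by (apply pow_le; lra).
    unfold Rdiv. rewrite <- (Rmult_1_l (/ (1 - r))) at 2.
    apply Rmult_le_compat_r; [|lra]. left; apply Rinv_0_lt_compat; lra.
  - induction n as [|n IH]; [cbn [seq]; rewrite rsum_nil, pow_O; field; lra|].
    rewrite seq_S, rsum_app, IH, rsum_cons, rsum_nil. cbn. field. lra.
Qed.

Lemma rbdd_geom r : (0 <= r < 1)%R -> rbdd (fun n => r ^ n)%R.
Proof.
  intros Hr. apply rbdd_nat with (/ (1 - r))%R.
  - intros; now apply pow_le.
  - intros n. now apply rsum_geom_le.
Qed.

(** Absolute convergence comes first; the value then follows from the equation l = 1 + z l obtained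
    by shifting the index. *)
Lemma asum_geom (z : C) : (Cmod z < 1)%R -> asum (fun n => z ^ n) (/ (1 - z)).
Proof.
  intros Hz.
  assert (HB : rbdd (fun n => Cmod (z ^ n))).
  { eapply rbdd_ext; [|apply (rbdd_geom (Cmod z)); split; [apply Cmod_ge_0|exact Hz]].
    intros n; now rewrite Cmod_pow. }
  pose proof (asum_exists _ HB) as H. set (l := tsum _) in H.
  enough (l = / (1 - z)) as <- by exact H.
  assert (Hn : 1 - z <> 0).
  { intros E. apply Ceq_minus in E. rewrite <- E, Cmod_1 in Hz. lra. }
  assert (E : l = 1 + z * l).
  { eapply asum_unique; [exact H|].
    change (RtoC 1) with (z ^ 0). apply (asum_nat_shift (fun n => z ^ n)).
    apply (asum_scal z) in H. eapply asum_ext; [|exact H]. intros; reflexivity. }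
  apply (f_equal (fun x => x - z * l)) in E.
  replace (1 + z * l - z * l) with (RtoC 1) in E by ring.
  replace l with ((l - z * l) / (1 - z)) by (field; auto).
  rewrite E. field; auto.
Qed.

(** With r = s^2, one factor s^n keeps n^j s^n bounded and the other is summed as a geometric
    series. Boundedness is proved by induction on [j] with the same splitting. *)
Lemma rbdd_nat_pow_geom j r : (0 <= r < 1)%R -> rbdd (fun n => INR n ^ j * r ^ n)%R.
Proof.
  intros Hr.
  assert (Hb : forall j r, (0 <= r < 1)%R ->
    exists M, (0 <= M)%R /\ forall n, (INR n ^ j * r ^ n <= M)%R).
  { clear. intros j; induction j as [|j IH]; intros r Hr.
    - exists 1%R. split; [lra|]. intros n. rewrite pow_O, Rmult_1_l.
      rewrite <- (pow1 n). now apply pow_incr; lra.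
    - set (s := sqrt r). assert (Hs : (0 <= s < 1)%R).
      { split; [apply sqrt_pos|]. rewrite <- sqrt_1. apply sqrt_lt_1; lra. }
      assert (Es : (r = s * s)%R) by (symmetry; apply sqrt_sqrt; lra).
      destruct (IH s Hs) as (M & HM0 & HM).
      (* n s^n is at most the sum of s^k over k < n, since each of these n terms is at least s^n. *)
      assert (Hn : forall n, (INR n * s ^ n <= / (1 - s))%R).
      { intros n. apply Rle_trans with (rsum (fun k => s ^ k)%R (seq 0 n)).
        - clear -Hs. induction n as [|n IHn]; [cbn; lra|].
          rewrite seq_S, rsum_app, rsum_cons, rsum_nil, S_INR, <- tech_pow_Rmult.
          cbn [Nat.add]. assert (0 <= s ^ n)%R by (apply pow_le; lra).
          assert (0 <= INR n)%R by apply pos_INR.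
          assert (0 <= INR n * s ^ n)%R by now apply Rmult_le_pos.
          nra.
        - now apply rsum_geom_le. }
      exists (/ (1 - s) * M)%R.
      assert (0 <= / (1 - s))%R by (left; apply Rinv_0_lt_compat; lra).
      split; [now apply Rmult_le_pos|]. intros n.
      rewrite Es, Rpow_mult_distr, <- tech_pow_Rmult.
      replace (INR n * INR n ^ j * (s ^ n * s ^ n))%R
        with ((INR n * s ^ n) * (INR n ^ j * s ^ n))%R by ring.
      assert (0 <= s ^ n)%R by (apply pow_le; lra).
      apply Rmult_le_compat; auto.
      + apply Rmult_le_pos; [apply pos_INR|auto].
      + apply Rmult_le_pos; [apply pow_le, pos_INR|auto]. }
  set (s := sqrt r). assert (Hs : (0 <= s < 1)%R).
  { split; [apply sqrt_pos|]. rewrite <- sqrt_1. apply sqrt_lt_1; lra. }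
  assert (Es : (r = s * s)%R) by (symmetry; apply sqrt_sqrt; lra).
  destruct (Hb j s Hs) as (M & HM0 & HM).
  eapply rbdd_le; [|apply (rbdd_scal M); [exact HM0|apply (rbdd_geom s Hs)]].
  intros n; cbn. rewrite Es, Rpow_mult_distr, <- Rmult_assoc.
  apply Rmult_le_compat_r; [apply pow_le; lra|apply HM].
Qed.

(** * Power series *)

Ltac rmins := repeat match goal with
  | |- context [Rmin ?a ?b] => lazymatch goal with
      | _ : (Rmin a b <= a)%R |- _ => fail
      | _ => pose proof (Rmin_l a b); pose proof (Rmin_r a b) end
  | _ : context [Rmin ?a ?b] |- _ => lazymatch goal with
      | _ : (Rmin a b <= a)%R |- _ => fail
      | _ => pose proof (Rmin_l a b); pose proof (Rmin_r a b) end
  end.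

(** Absolute convergence is part of the notion, so that Cauchy products and regroupings remain valid
    on the same disc; the value at the centre is included. *)
Definition has_ps (phi : C -> C) (c : nat -> C) (r : R) : Prop :=
  (0 < r)%R /\ forall h, (Cmod h < r)%R -> asum (fun k => c k * h ^ k) (phi h).

Lemma has_ps_ext phi psi c r :
  (forall h, (Cmod h < r)%R -> phi h = psi h) -> has_ps phi c r -> has_ps psi c r.
Proof.
  intros E [Hr H]. split; [exact Hr|]. intros h Hh. rewrite <- E by auto. now apply H.
Qed.

Lemma has_ps_coef_ext phi c d r :
  (forall k, c k = d k) -> has_ps phi c r -> has_ps phi d r.
Proof. intros H. now rewrite (functional_extensionality c d H). Qed.

Lemma has_ps_le phi c r r' : (0 < r' <= r)%R -> has_ps phi c r -> has_ps phi c r'.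
Proof.
  intros Hr [_ H]. split; [lra|]. intros h Hh. apply H. lra.
Qed.

Lemma has_ps_plus phi psi c d r :
  has_ps phi c r -> has_ps psi d r ->
  has_ps (fun h => phi h + psi h) (fun k => c k + d k) r.
Proof.
  intros [Hr H] [_ H']. split; [exact Hr|]. intros h Hh.
  eapply asum_ext; [|apply asum_plus; [apply H, Hh|apply H', Hh]].
  intros k; cbn; ring.
Qed.

Lemma has_ps_scal a phi c r :
  has_ps phi c r -> has_ps (fun h => a * phi h) (fun k => a * c k) r.
Proof.
  intros [Hr H]. split; [exact Hr|]. intros h Hh.
  eapply asum_ext; [|apply asum_scal, H, Hh]. intros k; cbn; ring.
Qed.

Lemma has_ps_const a r :
  (0 < r)%R -> has_ps (fun _ => a) (fun k => match k with O => a | _ => 0 end) r.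
Proof.
  intros Hr. split; [exact Hr|]. intros h Hh.
  apply (asum_single_eq _ 0%nat); [cbn; ring|].
  intros [|k] Hk; [congruence|]. ring.
Qed.

Lemma has_ps_id r :
  (0 < r)%R -> has_ps (fun h => h) (fun k => if Nat.eq_dec k 1 then 1 else 0) r.
Proof.
  intros Hr. split; [exact Hr|]. intros h Hh.
  apply (asum_single_eq _ 1%nat); [cbn; ring|].
  intros k Hk. destruct (Nat.eq_dec k 1); [congruence|]. ring.
Qed.

Lemma has_ps_at0 phi c r : has_ps phi c r -> phi 0 = c 0%nat.
Proof.
  intros [Hr H]. eapply asum_unique; [apply H; now rewrite Cmod_0|].
  apply (asum_single_eq _ 0%nat); [cbn; ring|].
  intros [|k] Hk; [congruence|]. rewrite Cpow_S. ring.
Qed.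

Lemma pow_bound_rbdd (c : nat -> C) M r h :
  (0 < r)%R -> (forall k, (Cmod (c k) * r ^ k <= M)%R) -> (Cmod h < r)%R ->
  rbdd (fun k => Cmod (c k * h ^ k)).
Proof.
  intros Hr HM Hh. pose proof (Cmod_ge_0 h).
  assert (HM0 : (0 <= M)%R).
  { eapply Rle_trans; [|apply (HM 0%nat)]. cbn. pose proof (Cmod_ge_0 (c 0%nat)). lra. }
  assert (Hq : (0 <= Cmod h / r < 1)%R).
  { split; [apply Rdiv_le_0_compat; lra|]. apply Rmult_lt_reg_r with r; [lra|].
    unfold Rdiv. rewrite Rmult_assoc, Rinv_l by lra. lra. }
  eapply rbdd_le; [|apply (rbdd_scal M); [exact HM0|apply (rbdd_geom _ Hq)]].
  intros k; cbn. rewrite Cmod_mult, Cmod_pow.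
  replace (Cmod (c k) * Cmod h ^ k)%R with ((Cmod (c k) * r ^ k) * (Cmod h / r) ^ k)%R.
  - apply Rmult_le_compat_r; [apply pow_le; lra|apply HM].
  - rewrite Rmult_assoc, <- Rpow_mult_distr. do 2 f_equal. field. lra.
Qed.

Lemma has_ps_of_bound (c : nat -> C) M r :
  (0 < r)%R -> (forall k, (Cmod (c k) * r ^ k <= M)%R) ->
  has_ps (fun h => tsum (fun k => c k * h ^ k)) c r.
Proof.
  intros Hr HM. split; [exact Hr|]. intros h Hh. apply asum_exists.
  now apply pow_bound_rbdd with M r.
Qed.

Lemma has_ps_bound phi c r r' :
  has_ps phi c r -> (0 <= r' < r)%R -> exists M, forall k, (Cmod (c k) * r' ^ k <= M)%R.
Proof.
  intros [Hr H] Hr'. destruct (H (RtoC r')) as [HB _].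
  { rewrite Cmod_R, Rabs_pos_eq; lra. }
  apply rbdd_term in HB. destruct HB as [M HM]. exists M. intros k.
  specialize (HM k). now rewrite Cmod_mult, Cmod_pow, Cmod_R, (Rabs_pos_eq r') in HM by lra.
Qed.

(** Fubini for pairs of a degree and an index, supported on the graph of [d]: terms with the same
    exponent are collected. This yields both Cauchy products and the q-expansions of double
    series. *)
Lemma has_ps_regroup {I : Type} (c : I -> C) (d : I -> nat) phi r :
  (0 < r)%R -> (forall h, (Cmod h < r)%R -> asum (fun i => c i * h ^ d i) (phi h)) ->
  has_ps phi (fun k => tsum (fun i => if Nat.eq_dec (d i) k then c i else 0)) r.
Proof.
  intros Hr H. split; [exact Hr|]. intros h Hh.
  apply (asum_fubini (fun p : nat * I =>
    if Nat.eq_dec (d (snd p)) (fst p) then c (snd p) * h ^ fst p else 0)).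
  - intros k. cbn.
    assert (HB : rbdd (fun i => Cmod (if Nat.eq_dec (d i) k then c i else 0))).
    (* The coefficients attached to the exponent k are summable because the series converges at the
       positive real point s: each one is its term divided by s^k. *)
    { set (s := (r / 2)%R). assert (Hs : (0 < s)%R) by (unfold s; lra).
      destruct (H (RtoC s)) as [HB _].
      { unfold s. rewrite Cmod_R, Rabs_pos_eq; lra. }
      eapply rbdd_le; [|apply (rbdd_scal (/ s ^ k)); [|exact HB]].
      - intros i; cbn. rewrite Cmod_mult, Cmod_pow, Cmod_R, (Rabs_pos_eq s) by lra.
        destruct (Nat.eq_dec (d i) k) as [->|].
        + apply Req_le. field. apply pow_nonzero; lra.
        + rewrite Cmod_0. apply Rmult_le_pos; [left; apply Rinv_0_lt_compat, pow_lt; lra|].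
          apply Rmult_le_pos; [apply Cmod_ge_0|apply pow_le; lra].
      - left; apply Rinv_0_lt_compat, pow_lt; lra. }
    apply asum_exists in HB. apply (asum_scal (h ^ k)) in HB.
    rewrite Cmult_comm. eapply usum_ext; [|apply HB].
    intros i; cbn. destruct (Nat.eq_dec (d i) k); ring.
  - apply (asum_extend (fun i => (d i, i))).
    + intros; congruence.
    + intros [k i] Hj. cbn. destruct (Nat.eq_dec (d i) k) as [<-|]; [|reflexivity].
      now elim (Hj i).
    + eapply asum_ext; [|apply H, Hh]. intros i; cbn.
      now destruct (Nat.eq_dec (d i) (d i)).
Qed.

Definition cauchy (a b : nat -> C) (n : nat) : C :=
  lsum (fun k => a k * b (n - k)%nat) (seq 0 (S n)).

Lemma has_ps_mult phi psi a b r :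
  has_ps phi a r -> has_ps psi b r -> has_ps (fun h => phi h * psi h) (cauchy a b) r.
Proof.
  intros [Hr H] [_ H'].
  eapply has_ps_coef_ext;
    [|apply (has_ps_regroup (fun p : nat * nat => a (fst p) * b (snd p))
        (fun p => (fst p + snd p)%nat)); [exact Hr|]].
  - intros n. apply tsum_eq. unfold cauchy.
    replace (lsum (fun k => a k * b (n - k)%nat) (seq 0 (S n))) with
      (lsum (fun p : nat * nat =>
         if Nat.eq_dec (fst p + snd p) n then a (fst p) * b (snd p) else 0)
         (map (fun k => (k, n - k)%nat) (seq 0 (S n)))).
    + apply usum_finite.
      * apply FinFun.Injective_map_NoDup; [intros x y E; congruence|apply seq_NoDup].
      * intros [i j] Hp. cbn [fst snd]. destruct (Nat.eq_dec (i + j) n) as [E|]; [|reflexivity].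
        elim Hp. apply in_map_iff. exists i. split; [f_equal; lia|apply in_seq; lia].
    + rewrite lsum_map. apply lsum_ext. intros k Hk. apply in_seq in Hk. cbn [fst snd].
      destruct (Nat.eq_dec (k + (n - k)) n); [reflexivity|lia].
  - intros h Hh. eapply asum_ext; [|apply asum_prod; [apply H, Hh|apply H', Hh]].
    intros [i j]; cbn. rewrite Cpow_add_r. ring.
Qed.

Lemma has_ps_locally_bounded phi c r :
  has_ps phi c r -> exists M, forall h, (Cmod h <= r / 2)%R -> (Cmod (phi h) <= M)%R.
Proof.
  intros [Hr H]. destruct (H (RtoC (r / 2))) as [[M HM] _].
  { rewrite Cmod_R, Rabs_pos_eq; lra. }
  exists M. intros h Hh. destruct (H h) as [_ HU]; [lra|].
  apply (usum_le _ _ _) with (2 := HU). intros F HF.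
  eapply Rle_trans; [|apply (HM F HF)]. apply rsum_le. intros k _.
  rewrite !Cmod_mult, !Cmod_pow, Cmod_R, (Rabs_pos_eq (r / 2)) by lra.
  apply Rmult_le_compat_l; [apply Cmod_ge_0|]. apply pow_incr. split; [apply Cmod_ge_0|lra].
Qed.

Lemma has_ps_shift phi c r :
  has_ps phi c r -> exists phi1, has_ps phi1 (fun k => c (S k)) r /\
    forall h, (Cmod h < r)%R -> phi h = c 0%nat + h * phi1 h.
Proof.
  intros HP. pose proof HP as [Hr H].
  exists (fun h => tsum (fun k => c (S k) * h ^ k)).
  assert (H1 : has_ps (fun h => tsum (fun k => c (S k) * h ^ k)) (fun k => c (S k)) r).
  { split; [exact Hr|]. intros h Hh. apply asum_exists.
    set (s := ((Cmod h + r) / 2)%R). pose proof (Cmod_ge_0 h).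
    destruct (has_ps_bound phi c r s HP) as [M HM]; [unfold s; lra|].
    apply pow_bound_rbdd with (M / s)%R s; [unfold s; lra| |unfold s; lra].
    intros k. apply Rmult_le_reg_r with s; [unfold s; lra|].
    replace (M / s * s)%R with M by (field; unfold s; lra).
    eapply Rle_trans; [|apply (HM (S k))]. rewrite <- tech_pow_Rmult.
    apply Req_le; ring. }
  split; [exact H1|]. intros h Hh.
  eapply asum_unique; [now apply H|].
  destruct H1 as [_ H1]. specialize (H1 h Hh). apply (asum_scal h) in H1.
  replace (c 0%nat) with ((fun k => c k * h ^ k) 0%nat) by (cbn; ring).
  apply asum_nat_shift. eapply asum_ext; [|exact H1]. intros k; cbn; ring.
Qed.

(** At a small zero h one has |c 0| = |h phi1 h|, and phi1 is bounded near 0. *)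
Lemma has_ps_zero_head phi c r :
  has_ps phi c r ->
  (forall e, (0 < e)%R -> exists h, (0 < Cmod h < e)%R /\ phi h = 0) -> c 0%nat = 0.
Proof.
  intros HP Hz. destruct (has_ps_shift phi c r HP) as (phi1 & H1 & E1).
  destruct (has_ps_locally_bounded _ _ _ H1) as [M HM]. pose proof (proj1 HP) as Hr.
  assert (HM0 : (0 <= M)%R).
  { specialize (HM 0). rewrite Cmod_0 in HM. specialize (HM ltac:(lra)).
    pose proof (Cmod_ge_0 (phi1 0)); lra. }
  apply Cmod_lt_eq; intros eps He.
  destruct (Hz (Rmin (r / 2) (eps / (M + 1)))) as (h & Hh & E).
  { apply Rmin_glb_lt; [lra|apply Rdiv_lt_0_compat; lra]. }
  rmins.
  rewrite E1 in E by lra.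
  assert (c 0%nat - 0 = - (h * phi1 h)) as ->.
  { replace (c 0%nat - 0) with ((c 0%nat + h * phi1 h) - h * phi1 h) by ring.
    rewrite E; ring. }
  rewrite Cmod_opp, Cmod_mult. specialize (HM h ltac:(lra)).
  apply Rle_lt_trans with (Cmod h * (M + 1))%R; [apply Rmult_le_compat_l; lra|].
  replace eps with (eps / (M + 1) * (M + 1))%R by (field; lra).
  apply Rmult_lt_compat_r; lra.
Qed.

(* Zeros accumulating at the centre kill the constant term; then divide by [h]. *)
Lemma has_ps_zero phi c r :
  has_ps phi c r ->
  (forall e, (0 < e)%R -> exists h, (0 < Cmod h < e)%R /\ phi h = 0) ->
  forall k, c k = 0.
Proof.
  intros HP Hz k. revert phi c HP Hz. induction k as [|k IH]; intros phi c HP Hz.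
  - now apply has_ps_zero_head with phi r.
  - destruct (has_ps_shift phi c r HP) as (phi1 & H1 & E1). pose proof (proj1 HP) as Hr.
    pose proof (has_ps_zero_head _ _ _ HP Hz) as Hc0.
    apply (IH phi1 (fun k => c (S k)) H1). intros e He.
    destruct (Hz (Rmin e r)) as (h & Hh & E); [apply Rmin_glb_lt; lra|].
    rmins.
    exists h. split; [lra|]. rewrite E1, Hc0 in E by lra.
    assert (h <> 0) by (apply Cmod_gt_0; lra).
    replace (phi1 h) with ((0 + h * phi1 h) / h) by (field; auto). rewrite E. field; auto.
Qed.

(** The recursion for the reciprocal uses all earlier coefficients. They are carried in a list with
    the latest first, so entry k at stage n is the coefficient of index n - k. *)
Fixpoint ps_inv_list (c : nat -> C) (n : nat) : list C :=
  match n with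
  | O => / c 0%nat :: nil
  | S m => let L := ps_inv_list c m in
           (- / c 0%nat * lsum (fun k => c (S k) * nth k L 0) (seq 0 (S m))) :: L
  end.

Definition ps_inv (c : nat -> C) (n : nat) : C := nth 0 (ps_inv_list c n) 0.

Lemma ps_inv_S (c : nat -> C) n : ps_inv c (S n) =
  - / c 0%nat * lsum (fun k => c (S k) * ps_inv c (n - k)%nat) (seq 0 (S n)).
Proof.
  assert (H : forall n k, (k <= n)%nat -> nth k (ps_inv_list c n) 0 = ps_inv c (n - k)%nat).
  { intros m; induction m as [|m IH]; intros [|k] Hk; try lia; try reflexivity.
    change (nth (S k) (ps_inv_list c (S m)) 0) with (nth k (ps_inv_list c m) 0).
    rewrite IH by lia. reflexivity. }
  unfold ps_inv at 1. cbn [ps_inv_list nth]. f_equal.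
  apply lsum_ext. intros k Hk. apply in_seq in Hk. rewrite H by lia. reflexivity.
Qed.

Lemma cauchy_inv (c : nat -> C) n : c 0%nat <> 0 ->
  cauchy c (ps_inv c) n = match n with O => 1 | _ => 0 end.
Proof.
  intros Hc. unfold cauchy. destruct n as [|m].
  - cbn [seq]. rewrite lsum_cons, lsum_nil. unfold ps_inv; cbn [ps_inv_list nth Nat.sub].
    field; auto.
  - assert (seq 0 (S (S m)) = 0%nat :: map S (seq 0 (S m))) as -> by now rewrite seq_shift.
    rewrite lsum_cons, lsum_map, Nat.sub_0_r, ps_inv_S.
    cbn [Nat.sub].
    field; auto.
Qed.

(** Cauchy's majorant: if |c_k| <= M q^k with q = 1/r, the coefficients of the reciprocal are
    bounded by A K^n, where A = 1/|c_0| and K is a suitable multiple of q. *)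
Lemma ps_inv_bound (c : nat -> C) M r :
  (0 < r)%R -> (forall k, (Cmod (c k) * r ^ k <= M)%R) -> c 0%nat <> 0 ->
  exists s M', (0 < s)%R /\ forall k, (Cmod (ps_inv c k) * s ^ k <= M')%R.
Proof.
  intros Hr HM Hc. set (A := Cmod (/ c 0%nat)).
  assert (HA : (0 < A)%R).
  { unfold A. rewrite Cmod_inv by auto. apply Rinv_0_lt_compat. now apply Cmod_gt_0. }
  assert (HM0 : (0 <= M)%R).
  { eapply Rle_trans; [|apply (HM 0%nat)]. cbn. pose proof (Cmod_ge_0 (c 0%nat)). lra. }
  set (D := (A * M)%R). assert (HD : (0 <= D)%R) by (apply Rmult_le_pos; lra).
  set (q := (/ r)%R). assert (Hq : (0 < q)%R) by now apply Rinv_0_lt_compat.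
  assert (Hck : forall k, (A * Cmod (c k) <= D * q ^ k)%R).
  { intros k. unfold D. rewrite Rmult_assoc. apply Rmult_le_compat_l; [lra|].
    apply Rmult_le_reg_r with (r ^ k)%R; [now apply pow_lt|].
    rewrite Rmult_assoc, <- Rpow_mult_distr. unfold q. rewrite Rinv_l, pow1 by lra.
    specialize (HM k). lra. }
  (* The choice gives K - q = q D. The recurrence then bounds the next coefficient by A (K - q)
     times the sum of q^k K^(n-k), which telescopes to A (K^(n+1) - q^(n+1)). *)
  set (K := (q * (1 + D))%R). assert (HK : (0 < K)%R) by (apply Rmult_lt_0_compat; lra).
  assert (Hgeo : forall n, ((K - q) * rsum (fun k => q ^ k * K ^ (n - k))%R (seq 0 (S n))
      = K ^ S n - q ^ S n)%R).
  { induction n as [|n IH].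
    - cbn [seq]. rewrite rsum_cons, rsum_nil. cbn. ring.
    - rewrite seq_S, rsum_app, rsum_cons, rsum_nil. cbn [Nat.add].
      rewrite Nat.sub_diag.
      assert (E : rsum (fun k => q ^ k * K ^ (S n - k))%R (seq 0 (S n))
                = (K * rsum (fun k => q ^ k * K ^ (n - k)) (seq 0 (S n)))%R).
      { rewrite <- rsum_scal. unfold rsum. f_equal. apply map_ext_in. intros k Hk.
        apply in_seq in Hk. replace (S n - k)%nat with (S (n - k)) by lia.
        rewrite <- tech_pow_Rmult. ring. }
      rewrite E. rewrite <- !tech_pow_Rmult in *.
      transitivity (K * ((K - q) * rsum (fun k => q ^ k * K ^ (n - k)) (seq 0 (S n)))
        + (K - q) * (q * q ^ n))%R; [cbn; ring|]. rewrite IH. ring. }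
  assert (Hb : forall n, (Cmod (ps_inv c n) <= A * K ^ n)%R).
  { intros n. induction n as [n IH] using lt_wf_ind. destruct n as [|n].
    - unfold ps_inv; cbn [ps_inv_list nth]. fold A. cbn. lra.
    - rewrite ps_inv_S, Cmod_mult, Cmod_opp. fold A.
      apply Rle_trans with (A * rsum (fun k => Cmod (c (S k) * ps_inv c (n - k)%nat)) (seq 0 (S n)))%R.
      { apply Rmult_le_compat_l; [lra|apply Cmod_lsum_le]. }
      rewrite <- rsum_scal.
      apply Rle_trans with (rsum (fun k => (A * (K - q)) * (q ^ k * K ^ (n - k)))%R (seq 0 (S n))).
      + apply rsum_le. intros k Hk. apply in_seq in Hk. rewrite Cmod_mult.
        rewrite <- Rmult_assoc.
        replace (A * (K - q) * (q ^ k * K ^ (n - k)))%R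
          with ((D * q ^ S k) * (A * K ^ (n - k)))%R.
        * apply Rmult_le_compat; try apply Cmod_ge_0; [|apply Hck|apply IH; lia].
          apply Rmult_le_pos; [lra|apply Cmod_ge_0].
        * unfold K. rewrite <- tech_pow_Rmult. ring.
      + rewrite rsum_scal, Rmult_assoc, Hgeo. apply Rmult_le_compat_l; [lra|].
        assert (0 < q ^ S n)%R by now apply pow_lt. lra. }
  exists (/ K)%R, A. split; [now apply Rinv_0_lt_compat|]. intros k.
  apply Rmult_le_reg_r with (K ^ k)%R; [now apply pow_lt|].
  rewrite Rmult_assoc, <- Rpow_mult_distr, Rinv_l, pow1, Rmult_1_r by lra. apply Hb.
Qed.

Lemma has_ps_inv phi (c : nat -> C) r : has_ps phi c r -> c 0%nat <> 0 ->
  exists s, (s <= r)%R /\ has_ps (fun h => / phi h) (ps_inv c) s /\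
    forall h, (Cmod h < s)%R -> phi h <> 0.
Proof.
  intros HP Hc. pose proof (proj1 HP) as Hr.
  destruct (has_ps_bound phi c r (r / 2) HP) as [M HM]; [lra|].
  destruct (ps_inv_bound c M (r / 2)) as (s & M' & Hs & HM'); [lra|exact HM|exact Hc|].
  pose proof (has_ps_of_bound _ _ _ Hs HM') as HI.
  set (t := Rmin r s). assert (Ht : (0 < t)%R) by (apply Rmin_glb_lt; lra).
  assert (E : forall h, (Cmod h < t)%R -> phi h * tsum (fun k => ps_inv c k * h ^ k) = 1).
  { intros h Hh.
    pose proof (has_ps_mult _ _ _ _ t
      (has_ps_le _ _ _ t (conj Ht (Rmin_l _ _)) HP)
      (has_ps_le _ _ _ t (conj Ht (Rmin_r _ _)) HI)) as [_ HM1].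
    eapply asum_unique; [apply (HM1 h Hh)|].
    eapply asum_ext; [|apply (has_ps_const 1 t Ht), Hh].
    intros k. now rewrite cauchy_inv. }
  assert (Hnz : forall h, (Cmod h < t)%R -> phi h <> 0).
  { intros h Hh H0. specialize (E h Hh). rewrite H0, Cmult_0_l in E.
    now apply C1_nz. }
  exists t. split; [apply Rmin_l|]. split; [|exact Hnz].
  eapply has_ps_ext; [|apply (has_ps_le _ _ _ t (conj Ht (Rmin_r _ _)) HI)].
  intros h Hh. specialize (Hnz h Hh). specialize (E h Hh). cbn beta.
  replace (tsum (fun k => ps_inv c k * h ^ k)) with
    ((phi h * tsum (fun k => ps_inv c k * h ^ k)) / phi h) by (field; auto).
  rewrite E. field; auto.
Qed.

(** Germs at 0. Analyticity of g at p is stated as [an (fun h => g (p + h))]. The series must also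
    give the value at h = 0, so a removable singularity has to be filled with the right value
    first. *)
Definition an (phi : C -> C) : Prop := exists c r, has_ps phi c r.

Lemma an_ext phi psi r : (0 < r)%R ->
  (forall h, (Cmod h < r)%R -> phi h = psi h) -> an phi -> an psi.
Proof.
  intros Hr E (c & s & H). exists c, (Rmin r s). pose proof (proj1 H).
  apply has_ps_ext with phi.
  - intros h Hh. apply E. rmins. lra.
  - apply has_ps_le with s; [|exact H]. split; [apply Rmin_glb_lt; lra|apply Rmin_r].
Qed.

Lemma an_common phi psi : an phi -> an psi ->
  exists c d r, has_ps phi c r /\ has_ps psi d r.
Proof.
  intros (c & r & H) (d & s & H'). pose proof (proj1 H); pose proof (proj1 H').
  exists c, d, (Rmin r s). split.
  - apply has_ps_le with r; [|exact H]. split; [apply Rmin_glb_lt; lra|apply Rmin_l].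
  - apply has_ps_le with s; [|exact H']. split; [apply Rmin_glb_lt; lra|apply Rmin_r].
Qed.

Lemma an_plus phi psi : an phi -> an psi -> an (fun h => phi h + psi h).
Proof.
  intros H H'. destruct (an_common _ _ H H') as (c & d & r & Hc & Hd).
  exists (fun k => c k + d k), r. now apply has_ps_plus.
Qed.

Lemma an_mult phi psi : an phi -> an psi -> an (fun h => phi h * psi h).
Proof.
  intros H H'. destruct (an_common _ _ H H') as (c & d & r & Hc & Hd).
  exists (cauchy c d), r. now apply has_ps_mult.
Qed.

Lemma an_const a : an (fun _ => a).
Proof. eexists _, 1%R. apply has_ps_const; lra. Qed.

Lemma an_id : an (fun h => h).
Proof. eexists _, 1%R. apply has_ps_id; lra. Qed.

Lemma an_scal a phi : an phi -> an (fun h => a * phi h).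
Proof. intros H. apply an_mult; [apply an_const|exact H]. Qed.

Lemma an_minus phi psi : an phi -> an psi -> an (fun h => phi h - psi h).
Proof.
  intros H H'. apply an_plus; [exact H|].
  apply (an_ext (fun h => - (1) * psi h) _ 1%R); [lra| |now apply an_scal].
  intros; ring.
Qed.

Lemma an_inv phi : an phi -> phi 0 <> 0 -> an (fun h => / phi h).
Proof.
  intros (c & r & H) H0. rewrite (has_ps_at0 _ _ _ H) in H0.
  destruct (has_ps_inv _ _ _ H H0) as (s & _ & Hs & _). now exists (ps_inv c), s.
Qed.

Lemma an_div phi psi : an phi -> an psi -> psi 0 <> 0 -> an (fun h => phi h / psi h).
Proof. intros H H' H0. apply an_mult; [exact H|now apply an_inv]. Qed.

Lemma an_arg_opp phi : an phi -> an (fun h => phi (- h)).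
Proof.
  intros (c & r & Hr & H). exists (fun k => c k * (- (1)) ^ k), r. split; [exact Hr|].
  intros h Hh. rewrite <- Cmod_opp in Hh. eapply asum_ext; [|apply (H _ Hh)].
  intros k; cbn. replace (- h) with (- (1) * h) by ring. rewrite Cpow_mult_l. ring.
Qed.

Lemma an_locally_bounded phi : an phi ->
  exists r M, (0 < r)%R /\ forall h, (Cmod h < r)%R -> (Cmod (phi h) <= M)%R.
Proof.
  intros (c & r & H). destruct (has_ps_locally_bounded _ _ _ H) as [M HM].
  pose proof (proj1 H). exists (r / 2)%R, M. split; [lra|]. intros h Hh. apply HM; lra.
Qed.

Lemma an_factor phi : an phi ->
  exists phi1 r, an phi1 /\ (0 < r)%R /\
    forall h, (Cmod h < r)%R -> phi h = phi 0 + h * phi1 h.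
Proof.
  intros (c & r & H). destruct (has_ps_shift _ _ _ H) as (phi1 & H1 & E).
  exists phi1, r. split; [now exists (fun k => c (S k)), r|]. split; [apply H|].
  now rewrite (has_ps_at0 _ _ _ H).
Qed.

Lemma an_continuous phi : an phi -> forall eps, (0 < eps)%R ->
  exists d, (0 < d)%R /\ forall h, (Cmod h < d)%R -> (Cmod (phi h - phi 0) < eps)%R.
Proof.
  intros H eps He. destruct (an_factor _ H) as (phi1 & r & H1 & Hr & E).
  destruct (an_locally_bounded _ H1) as (s & M & Hs & HM).
  assert (HM0 : (0 <= M)%R).
  { specialize (HM 0). rewrite Cmod_0 in HM. specialize (HM Hs).
    pose proof (Cmod_ge_0 (phi1 0)); lra. }
  assert (Hd : (0 < eps / (M + 1))%R) by (apply Rdiv_lt_0_compat; lra).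
  exists (Rmin (Rmin r s) (eps / (M + 1))). split.
  - repeat apply Rmin_glb_lt; assumption.
  - intros h Hh. rmins.
    rewrite E by lra. replace (phi 0 + h * phi1 h - phi 0) with (h * phi1 h) by ring.
    rewrite Cmod_mult. specialize (HM h ltac:(lra)). pose proof (Cmod_ge_0 h).
    apply Rle_lt_trans with (Cmod h * (M + 1))%R; [apply Rmult_le_compat_l; lra|].
    replace eps with (eps / (M + 1) * (M + 1))%R by (field; lra).
    apply Rmult_lt_compat_r; lra.
Qed.

Lemma an_nonzero phi : an phi -> phi 0 <> 0 ->
  exists d, (0 < d)%R /\ forall h, (Cmod h < d)%R -> phi h <> 0.
Proof.
  intros (c & r & H) H0. rewrite (has_ps_at0 _ _ _ H) in H0.
  destruct (has_ps_inv _ _ _ H H0) as (s & _ & Hs & Hn).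
  exists s. split; [apply Hs|exact Hn].
Qed.

Lemma an_zero phi : an phi ->
  (forall e, (0 < e)%R -> exists h, (0 < Cmod h < e)%R /\ phi h = 0) ->
  exists r, (0 < r)%R /\ forall h, (Cmod h < r)%R -> phi h = 0.
Proof.
  intros (c & r & H) Hz. exists r. split; [apply H|]. intros h Hh.
  eapply asum_unique; [apply H, Hh|].
  eapply asum_ext; [|apply asum_zero]. intros k; cbn beta.
  rewrite (has_ps_zero _ _ _ H Hz k). ring.
Qed.

(** Dividing by h twice gives g (p + h) = g p + h (phi1 0 + h phi2 h) with phi2 bounded; the
    remainder is of order h^2 and phi1 0 is the derivative. *)
Lemma an_ex_derive g p : an (fun h => g (p + h)) ->
  ex_derive (K := C_AbsRing) (V := C_NormedModule) g p.
Proof.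
  intros H. destruct (an_factor _ H) as (phi1 & r & H1 & Hr & E).
  rewrite Cplus_0_r in E.
  destruct (an_factor _ H1) as (phi2 & r2 & H2 & Hr2 & E2).
  destruct (an_locally_bounded _ H2) as (s & M & Hs & HM).
  assert (HM0 : (0 <= M)%R).
  { specialize (HM 0). rewrite Cmod_0 in HM. specialize (HM Hs).
    pose proof (Cmod_ge_0 (phi2 0)); lra. }
  exists (phi1 0). split.
  - apply (is_linear_scal_l (K := C_AbsRing) (V := C_NormedModule)).
  - intros x Hx.
    assert (x = p) as -> by
      (symmetry; exact (is_filter_lim_locally_unique
         (K := C_AbsRing) (V := AbsRing_NormedModule C_AbsRing) p x Hx)).
    clear Hx. intros eps.
    set (d := Rmin (Rmin r r2) (Rmin s (eps / (M + 1)))).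
    assert (Hd0 : (0 < eps / (M + 1))%R) by (apply Rdiv_lt_0_compat; [apply eps|lra]).
    assert (Hd : (0 < d)%R) by (repeat apply Rmin_glb_lt; assumption).
    assert (Hd1 : (d <= r /\ d <= r2 /\ d <= s /\ d <= eps / (M + 1))%R).
    { unfold d. rmins. lra. }
    apply (locally_le_locally_norm (K := C_AbsRing) (V := AbsRing_NormedModule C_AbsRing)).
    exists (mkposreal d Hd). intros y Hy.
    change (Cmod (y - p) < d)%R in Hy.
    change (Cmod (g y - g p - (y - p) * phi1 0) <= eps * Cmod (y - p))%R.
    set (h := y - p) in *. replace y with (p + h) by (unfold h; ring).
    rewrite E, E2 by lra.
    replace (g p + h * (phi1 0 + h * phi2 h) - g p - h * phi1 0) with (h * phi2 h * h) by ring.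
    rewrite !Cmod_mult. apply Rmult_le_compat_r; [apply Cmod_ge_0|].
    specialize (HM h ltac:(lra)). pose proof (Cmod_ge_0 h).
    apply Rle_trans with (eps / (M + 1) * (M + 1))%R; [|right; field; lra].
    apply Rmult_le_compat; try apply Cmod_ge_0; lra.
Qed.

(** * The exponential function *)

Lemma rbdd_sigma {I J} (a : I * J -> R) (B : I -> R) :
  (forall p, (0 <= a p)%R) ->
  (forall i F, NoDup F -> (rsum (fun j => a (i, j)) F <= B i)%R) -> rbdd B -> rbdd a.
Proof.
  intros Ha HB [M HM]. exists M. intros F HN.
  set (E := nodup edec (map fst F)). set (G := nodup edec (map snd F)).
  apply Rle_trans with (rsum a (list_prod E G)).
  - apply rsum_incl; auto. intros [i j] Hp. apply in_prod; apply nodup_In.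
    + change i with (fst (i, j)). now apply in_map.
    + change j with (snd (i, j)). now apply in_map.
  - apply Rle_trans with (rsum B E); [|apply HM, NoDup_nodup].
    clearbody E. assert (HG : NoDup G) by apply NoDup_nodup. clearbody G. clear HN F.
    induction E as [|i E IH]; [apply Rle_refl|].
    cbn [list_prod]. rewrite rsum_app, rsum_cons, rsum_map.
    apply Rplus_le_compat; [now apply HB|exact IH].
Qed.

Lemma rsum_le_usum {I} (a : I -> R) (l : R) F :
  (forall i, (0 <= a i)%R) -> usum (fun i => RtoC (a i)) (RtoC l) -> NoDup F ->
  (rsum a F <= l)%R.
Proof.
  intros Ha H HN. apply Rnot_lt_le. intros Hlt.
  destruct (H (rsum a F - l)%R ltac:(lra)) as [F0 HF0].
  specialize (HF0 _ (union_NoDup F0 F) (union_incl_l F0 F)).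
  rewrite lsum_RtoC, <- RtoC_minus, Cmod_R in HF0.
  pose proof (rsum_incl a F _ Ha HN (union_incl_r F0 F)).
  rewrite Rabs_pos_eq in HF0; lra.
Qed.

Lemma usum_infinite_sum (a : nat -> R) l x :
  usum (fun k => RtoC (a k)) l -> infinite_sum a x -> l = RtoC x.
Proof.
  intros H Hs. apply Cmod_lt_eq. intros eps He.
  destruct (H (eps / 2)%R ltac:(lra)) as [F0 HF0].
  destruct (Hs (eps / 2)%R ltac:(lra)) as [N HN].
  set (n := Nat.max N (list_max F0)).
  specialize (HN n ltac:(unfold n; lia)). unfold Rdist in HN.
  specialize (HF0 (seq 0 (S n)) (seq_NoDup _ _)).
  assert (E : lsum (fun k => RtoC (a k)) (seq 0 (S n)) = RtoC (sum_f_R0 a n)).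
  { rewrite lsum_RtoC. f_equal. clear. induction n as [|n IH].
    - cbn [seq]. rewrite rsum_cons, rsum_nil. cbn. ring.
    - rewrite seq_S, rsum_app, IH, rsum_cons, rsum_nil. cbn. ring. }
  rewrite E in HF0.
  assert (Hi : incl F0 (seq 0 (S n))).
  { intros k Hk. apply in_seq.
    pose proof (proj1 (list_max_le F0 (list_max F0)) (le_n _)) as Hall.
    rewrite Forall_forall in Hall. specialize (Hall k Hk). unfold n; lia. }
  specialize (HF0 Hi).
  replace (l - RtoC x) with (- (RtoC (sum_f_R0 a n) - l) + RtoC (sum_f_R0 a n - x))
    by (rewrite RtoC_minus; ring).
  eapply Rle_lt_trans; [apply Cmod_triangle|]. rewrite Cmod_opp, Cmod_R. lra.
Qed.

Lemma asum_even_odd (g : nat -> C) A B :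
  asum (fun k => g (2 * k)%nat) A -> asum (fun k => g (2 * k + 1)%nat) B -> asum g (A + B).
Proof.
  apply asum_cover; try (intros; lia).
  intros n. destruct (Nat.Even_or_Odd n) as [[k ->]|[k ->]]; [left|right]; now exists k.
Qed.

Definition ecoef (k : nat) : C := / RtoC (INR (fact k)).

Lemma fact_nz k : RtoC (INR (fact k)) <> 0.
Proof. intros E. apply RtoC_inj in E. revert E. apply INR_fact_neq_0. Qed.

Lemma ecoef_S k : RtoC (INR (S k)) * ecoef (S k) = ecoef k.
Proof.
  unfold ecoef. rewrite fact_simpl, mult_INR, RtoC_mult. field. split.
  - apply fact_nz.
  - intros E. apply RtoC_inj in E. revert E. now apply not_0_INR.
Qed.

Lemma Cmod_ecoef k : Cmod (ecoef k) = (/ INR (fact k))%R.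
Proof.
  unfold ecoef. rewrite Cmod_inv by apply fact_nz.
  rewrite Cmod_R, Rabs_pos_eq; [reflexivity|apply pos_INR].
Qed.

Lemma ecoef_bound r : (0 < r)%R -> exists M, forall k, (Cmod (ecoef k) * r ^ k <= M)%R.
Proof.
  intros Hr. destruct (maj_by_pos (fun n => r ^ n / INR (fact n))%R) as (M & _ & HM).
  { exists 0%R. apply cv_speed_pow_fact. }
  exists M. intros k. specialize (HM k). rewrite Cmod_ecoef.
  eapply Rle_trans; [|exact HM]. eapply Rle_trans; [|apply Rle_abs].
  unfold Rdiv; lra.
Qed.

Lemma exp_ps r : (0 < r)%R -> has_ps (fun h => tsum (fun k => ecoef k * h ^ k)) ecoef r.
Proof.
  intros Hr. destruct (ecoef_bound r Hr) as [M HM]. now apply has_ps_of_bound with M.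
Qed.

Lemma asum_exp z : asum (fun k => ecoef k * z ^ k) (tsum (fun k => ecoef k * z ^ k)).
Proof.
  destruct (exp_ps (Cmod z + 1)) as [_ H]; [pose proof (Cmod_ge_0 z); lra|].
  apply H. lra.
Qed.

(** The binomial theorem by induction: multiplying the coefficient of index n + 1 by n + 1 = k + (n
    + 1 - k) splits it into two sums, from which one factor z, respectively w, comes out. *)
Lemma cauchy_exp z w n :
  cauchy (fun k => ecoef k * z ^ k) (fun k => ecoef k * w ^ k) n = ecoef n * (z + w) ^ n.
Proof.
  induction n as [|n IH].
  - unfold cauchy. cbn [seq]. rewrite lsum_cons, lsum_nil. unfold ecoef; cbn. field.
  - assert (HS : RtoC (INR (S n)) <> 0).
    { intros E. apply RtoC_inj in E. revert E. now apply not_0_INR. }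
    enough (RtoC (INR (S n)) * cauchy (fun k => ecoef k * z ^ k) (fun k => ecoef k * w ^ k) (S n)
      = (z + w) * cauchy (fun k => ecoef k * z ^ k) (fun k => ecoef k * w ^ k) n) as E.
    + rewrite IH, <- ecoef_S in E.
      apply (f_equal (fun x => x / RtoC (INR (S n)))) in E.
      transitivity (RtoC (INR (S n)) * cauchy (fun k => ecoef k * z ^ k)
        (fun k => ecoef k * w ^ k) (S n) / RtoC (INR (S n))); [field; auto|].
      rewrite E, Cpow_S. field; auto.
    + unfold cauchy. rewrite <- lsum_scal.
      rewrite (lsum_ext _ (fun k => RtoC (INR k) * (ecoef k * z ^ k) * (ecoef (S n - k) * w ^ (S n - k))
         + (ecoef k * z ^ k) * (RtoC (INR (S n - k)) * (ecoef (S n - k) * w ^ (S n - k))))).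
      2: { intros k Hk. apply in_seq in Hk.
           assert (INR (S n) = INR k + INR (S n - k))%R as -> by
             (rewrite <- plus_INR; f_equal; lia).
           rewrite RtoC_plus. ring. }
      rewrite lsum_plus, Cmult_plus_distr_r. f_equal.
      * assert (seq 0 (S (S n)) = 0%nat :: map S (seq 0 (S n))) as -> by
          now rewrite seq_shift.
        rewrite lsum_cons, lsum_map, <- lsum_scal. cbn [INR].
        rewrite !Cmult_0_l, Cplus_0_l. apply lsum_ext. intros k _.
        cbn [Nat.sub]. rewrite <- (ecoef_S k), Cpow_S.
        change (match k with O => 1%R | S _ => (INR k + 1)%R end) with (INR (S k)). ring.
      * rewrite seq_S, lsum_app, lsum_cons, lsum_nil, Nat.sub_diag. cbn [INR].
        rewrite !Cmult_0_l, Cmult_0_r, !Cplus_0_r, <- lsum_scal. apply lsum_ext.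
        intros k Hk. apply in_seq in Hk. replace (S n - k)%nat with (S (n - k)) by lia.
        rewrite <- (ecoef_S (n - k)), Cpow_S. ring.
Qed.

Lemma exp_tsum_plus z w :
  tsum (fun k => ecoef k * (z + w) ^ k) =
  tsum (fun k => ecoef k * z ^ k) * tsum (fun k => ecoef k * w ^ k).
Proof.
  assert (H : forall z, has_ps (fun h => tsum (fun k => ecoef k * (z * h) ^ k))
    (fun k => ecoef k * z ^ k) 2).
  { intros u. split; [lra|]. intros h _. eapply asum_ext; [|apply (asum_exp (u * h))].
    intros k; cbn beta. rewrite Cpow_mult_l. ring. }
  pose proof (has_ps_mult _ _ _ _ _ (H z) (H w)) as [_ HM].
  specialize (HM 1). rewrite Cmod_1 in HM. specialize (HM ltac:(lra)).
  rewrite !Cmult_1_r in HM.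
  eapply asum_unique; [apply asum_exp|].
  eapply asum_ext; [|exact HM]. intros k. cbn beta. rewrite cauchy_exp, Cpow_1_l. ring.
Qed.

Lemma tsum_exp_real x : tsum (fun k => ecoef k * (RtoC x) ^ k) = RtoC (exp x).
Proof.
  apply usum_infinite_sum with (fun k => / INR (fact k) * x ^ k)%R.
  - eapply usum_ext; [|apply (asum_exp (RtoC x))]. intros k; cbn beta.
    unfold ecoef. rewrite RtoC_mult, RtoC_inv, RtoC_pow; [reflexivity|].
    apply INR_fact_neq_0.
  - unfold exp. now destruct (exist_exp x).
Qed.

Lemma Ci_sqr : Ci * Ci = - (1).
Proof. unfold Ci, Cmult, Copp, RtoC. cbn. f_equal; ring. Qed.

(** The even and odd terms are compared with the series in y^2 through which [cos] and [sin] are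
    defined. *)
Lemma tsum_exp_imag y : tsum (fun k => ecoef k * (Ci * RtoC y) ^ k) = (cos y, sin y).
Proof.
  set (g := fun k => ecoef k * (Ci * RtoC y) ^ k).
  pose proof (asum_exp (Ci * RtoC y)) as [HB _]. fold g in HB.
  assert (HE : asum (fun k => g (2 * k)%nat) (tsum (fun k => g (2 * k)%nat))).
  { apply asum_exists, (rbdd_comp (fun k => 2 * k)%nat (fun k => Cmod (g k))); [|exact HB].
    intros; lia. }
  assert (HO : asum (fun k => g (2 * k + 1)%nat) (tsum (fun k => g (2 * k + 1)%nat))).
  { apply asum_exists, (rbdd_comp (fun k => 2 * k + 1)%nat (fun k => Cmod (g k))); [|exact HB].
    intros; lia. }
  assert (Hp : forall k, (Ci * RtoC y) ^ (2 * k) = RtoC ((- 1) ^ k * (Rsqr y) ^ k)).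
  { intros k. rewrite Cpow_mult_r. replace ((Ci * RtoC y) ^ 2) with (RtoC (-1 * Rsqr y)).
    - now rewrite <- RtoC_pow, Rpow_mult_distr.
    - unfold Rsqr. rewrite !RtoC_mult.
      replace (RtoC (-1)) with (- (1)) by (rewrite <- RtoC_opp; f_equal; lra).
      transitivity ((Ci * Ci) * (RtoC y * RtoC y)); [rewrite Ci_sqr; ring|cbn; ring]. }
  assert (E1 : tsum (fun k => g (2 * k)%nat) = RtoC (cos y)).
  { apply usum_infinite_sum with (fun k => cos_n k * (Rsqr y) ^ k)%R.
    - eapply usum_ext; [|apply HE]. intros k; cbn beta. unfold g, ecoef, cos_n.
      rewrite Hp, <- RtoC_inv by apply INR_fact_neq_0. rewrite <- RtoC_mult. f_equal.
      unfold Rdiv; ring.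
    - unfold cos. now destruct (exist_cos (Rsqr y)). }
  assert (E2 : - Ci * tsum (fun k => g (2 * k + 1)%nat) = RtoC (sin y)).
  { apply (asum_scal (- Ci)) in HO.
    unfold sin. destruct (exist_sin (Rsqr y)) as [l Hl]. rewrite RtoC_mult.
    pose proof (fun (l' : C) H => usum_infinite_sum (fun k => sin_n k * (Rsqr y) ^ k)%R l' l H Hl)
      as HU.
    (* The sine is defined as y times a series in y^2, so the comparison of series divides by y. *)
    destruct (Req_dec y 0) as [->|Hy].
    - eapply asum_unique; [exact HO|]. rewrite Cmult_0_l.
      eapply asum_ext; [|apply asum_zero]. intros k; cbn beta. unfold g.
      rewrite Nat.add_1_r, Cpow_S. ring.
    - assert (HyC : RtoC y <> 0) by (intros E; apply RtoC_inj in E; auto).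
      apply (asum_scal (/ RtoC y)) in HO.
      enough (/ RtoC y * (- Ci * tsum (fun k => g (2 * k + 1)%nat)) = RtoC l) as <- by
        (field; auto).
      apply HU. eapply usum_ext; [|apply HO]. intros k; cbn beta.
      unfold g. rewrite Cpow_add_r, Hp, Cpow_1_r. unfold ecoef, sin_n, Rdiv.
      rewrite <- (RtoC_inv (INR (fact (2 * k + 1)))) by apply INR_fact_neq_0.
      transitivity (- (Ci * Ci) * RtoC (/ INR (fact (2 * k + 1))) *
        RtoC ((-1) ^ k * Rsqr y ^ k)); [field; auto|].
      rewrite Ci_sqr, !RtoC_mult. ring. }
  pose proof (asum_even_odd g _ _ HE HO) as HS.
  pose proof (asum_unique _ _ _ HS (asum_exp (Ci * RtoC y))) as E. fold g in E.
  rewrite <- E, E1.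
  replace (tsum (fun k => g (2 * k + 1)%nat)) with
    (Ci * (- Ci * tsum (fun k => g (2 * k + 1)%nat))).
  - rewrite E2. unfold Ci, Cmult, Cplus, RtoC. cbn. f_equal; ring.
  - transitivity (- (Ci * Ci) * tsum (fun k => g (2 * k + 1)%nat)); [ring|].
    rewrite Ci_sqr; ring.
Qed.

Lemma asum_Cexp z : asum (fun k => ecoef k * z ^ k) (Cexp z).
Proof.
  enough (Cexp z = tsum (fun k => ecoef k * z ^ k)) as -> by apply asum_exp.
  assert (Ez : z = RtoC (Re z) + Ci * RtoC (Im z)).
  { destruct z as [x y]. unfold Ci, Cmult, Cplus, RtoC. cbn. f_equal; ring. }
  transitivity (tsum (fun k => ecoef k * (RtoC (Re z) + Ci * RtoC (Im z)) ^ k));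
    [|now rewrite <- Ez].
  rewrite exp_tsum_plus, tsum_exp_real, tsum_exp_imag.
  unfold Cexp, Cmult, RtoC. cbn. f_equal; ring.
Qed.

Lemma Cexp_plus z w : Cexp (z + w) = Cexp z * Cexp w.
Proof.
  unfold Cexp, Cmult, Cplus, Re, Im. cbn. rewrite exp_plus, cos_plus, sin_plus.
  f_equal; ring.
Qed.

Lemma Cexp_0 : Cexp 0 = 1.
Proof. unfold Cexp, RtoC, Re, Im. cbn. rewrite exp_0, cos_0, sin_0. f_equal; ring. Qed.

Lemma Cexp_opp z : Cexp z * Cexp (- z) = 1.
Proof. rewrite <- Cexp_plus, Cplus_opp_r. apply Cexp_0. Qed.

Lemma Cexp_nz z : Cexp z <> 0.
Proof.
  intros E. pose proof (Cexp_opp z) as H. rewrite E, Cmult_0_l in H. now apply C1_nz.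
Qed.

Lemma Cexp_inv z : Cexp (- z) = / Cexp z.
Proof.
  pose proof (Cexp_opp z) as H. pose proof (Cexp_nz z).
  replace (Cexp (- z)) with (Cexp z * Cexp (- z) / Cexp z) by (field; auto).
  rewrite H. field; auto.
Qed.

Lemma Cexp_pow z n : Cexp z ^ n = Cexp (RtoC (INR n) * z).
Proof.
  induction n as [|n IH].
  - cbn [INR]. rewrite Cmult_0_l, Cexp_0. reflexivity.
  - rewrite Cpow_S, IH, <- Cexp_plus. f_equal. rewrite S_INR, RtoC_plus. ring.
Qed.

Lemma Cmod_Cexp z : Cmod (Cexp z) = exp (Re z).
Proof.
  unfold Cexp, Cmod. cbn. rewrite !Rmult_1_r.
  replace (exp (Re z) * cos (Im z) * (exp (Re z) * cos (Im z)) +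
    exp (Re z) * sin (Im z) * (exp (Re z) * sin (Im z)))%R
    with ((exp (Re z)) * (exp (Re z)) * (Rsqr (sin (Im z)) + Rsqr (cos (Im z))))%R
    by (unfold Rsqr; ring).
  rewrite sin2_cos2, Rmult_1_r. apply sqrt_square. left; apply exp_pos.
Qed.

Lemma Cmod_Cexp_le z : (Cmod (Cexp z) <= exp (Cmod z))%R.
Proof.
  rewrite Cmod_Cexp. pose proof (re_le_Cmod z). pose proof (Rle_abs (Re z)).
  destruct (Rle_lt_or_eq_dec (Re z) (Cmod z)) as [H1|<-]; [lra| |lra].
  left; now apply exp_increasing.
Qed.

Lemma Cexp_2PI_Z (n : Z) : Cexp (2 * RtoC PI * Ci * IZC n) = 1.
Proof.
  assert (H : forall n : nat, Cexp (2 * RtoC PI * Ci * RtoC (INR n)) = 1).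
  { intros k. rewrite Cmult_comm, <- Cexp_pow.
    assert (Cexp (2 * RtoC PI * Ci) = 1) as ->; [|apply Cpow_1_l].
    unfold Cexp, Ci, RtoC, Cmult, Re, Im. cbn.
    replace ((2 * PI - 0 * 0) * 0 - (2 * 0 + 0 * PI) * 1)%R with 0%R by ring.
    replace ((2 * PI - 0 * 0) * 1 + (2 * 0 + 0 * PI) * 0)%R with (2 * PI)%R by ring.
    rewrite exp_0, cos_2PI, sin_2PI. f_equal; ring. }
  unfold IZC. destruct n as [|p|p].
  - apply (H 0%nat).
  - specialize (H (Pos.to_nat p)). now rewrite INR_IZR_INZ, positive_nat_Z in H.
  - specialize (H (Pos.to_nat p)). rewrite INR_IZR_INZ, positive_nat_Z in H.
    change (Z.neg p) with (- Z.pos p)%Z. rewrite opp_IZR, RtoC_opp.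
    replace (2 * RtoC PI * Ci * - RtoC (IZR (Z.pos p))) with
      (- (2 * RtoC PI * Ci * RtoC (IZR (Z.pos p)))) by ring.
    rewrite Cexp_inv, H. field.
Qed.

Lemma Cexp_eq_1 z : Cexp z = 1 -> exists n : Z, z = 2 * RtoC PI * Ci * IZC n.
Proof.
  intros E. assert (HR : Re z = 0%R).
  { pose proof (Cmod_Cexp z) as H. rewrite E, Cmod_1 in H.
    apply exp_inv. now rewrite exp_0. }
  unfold Cexp in E. rewrite HR, exp_0 in E. injection E as Ec Es.
  rewrite Rmult_1_l in Ec.
  assert (Hs : sin (Im z / 2) = 0%R).
  { replace (Im z) with (2 * (Im z / 2))%R in Ec by field.
    rewrite cos_2a_sin in Ec. apply Rsqr_0_uniq. unfold Rsqr. lra. }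
  apply sin_eq_0_0 in Hs. destruct Hs as [k Hk]. exists k.
  destruct z as [x y]. cbn in *. unfold IZC, Ci, RtoC, Cmult. cbn.
  f_equal; [rewrite HR; ring|]. lra.
Qed.

Lemma polar z : exists t : R, z = RtoC (Cmod z) * Cexp (Ci * RtoC t).
Proof.
  destruct (Req_dec (Cmod z) 0) as [H0|H0].
  { exists 0%R. rewrite H0. rewrite (Cmod_eq_0 _ H0). ring. }
  assert (Hm : (0 < Cmod z)%R) by (pose proof (Cmod_ge_0 z); lra).
  set (x := (Re z / Cmod z)%R).
  assert (Hx : (-1 <= x <= 1)%R).
  { pose proof (re_le_Cmod z) as H. apply Rabs_le_between in H. unfold x.
    split; apply Rmult_le_reg_r with (Cmod z); try lra; unfold Rdiv;
      rewrite Rmult_assoc, Rinv_l; lra. }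
  pose proof (Cmod2_alt z) as H2.
  assert (H2' : (Cmod z ^ 2 = Re z ^ 2 + Im z ^ 2)%R).
  { apply RtoC_inj. rewrite H2. reflexivity. }
  assert (Hs : (sqrt (1 - Rsqr x) = Rabs (Im z) / Cmod z)%R).
  { replace (1 - Rsqr x)%R with (Rsqr (Rabs (Im z) / Cmod z)).
    - rewrite sqrt_Rsqr; [reflexivity|]. apply Rdiv_le_0_compat; [apply Rabs_pos|lra].
    - unfold x. rewrite !Rsqr_div', <- Rsqr_abs. unfold Rsqr.
      apply Rmult_eq_reg_r with (Cmod z * Cmod z)%R; [|nra].
      field_simplify; try lra. }
  assert (HE : forall t, cos t = x -> sin t = (Im z / Cmod z)%R ->
    z = RtoC (Cmod z) * Cexp (Ci * RtoC t)).
  { intros t Hc Hsn. unfold Cexp, Ci, RtoC, Cmult, Re, Im. cbn [fst snd].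
    replace (0 * t - 1 * 0)%R with 0%R by ring. replace (0 * 0 + 1 * t)%R with t by ring.
    rewrite exp_0, Hc, Hsn. unfold x. destruct z as [a b]. cbn [fst snd Re Im].
    f_equal; field; auto. }
  destruct (Rle_dec 0 (Im z)) as [Hi|Hi].
  - exists (acos x). apply HE; [now apply cos_acos|].
    rewrite sin_acos, Hs, Rabs_pos_eq; auto.
  - exists (- acos x)%R. apply HE.
    + rewrite cos_neg. now apply cos_acos.
    + rewrite sin_neg, sin_acos, Hs, Rabs_left by lra. field; auto.
Qed.

Lemma an_arg_scal k phi : an phi -> an (fun h => phi (k * h)).
Proof.
  intros (c & r & Hr & H). pose proof (Cmod_ge_0 k) as Hk.
  exists (fun n => c n * k ^ n), (r / (Cmod k + 1))%R. split; [apply Rdiv_lt_0_compat; lra|].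
  intros h Hh. eapply asum_ext; [|apply (H (k * h))].
  - intros n; cbn. rewrite Cpow_mult_l. ring.
  - rewrite Cmod_mult. pose proof (Cmod_ge_0 h).
    apply Rle_lt_trans with ((Cmod k + 1) * Cmod h)%R; [nra|].
    replace r with ((Cmod k + 1) * (r / (Cmod k + 1)))%R by (field; lra).
    apply Rmult_lt_compat_l; lra.
Qed.

Lemma has_ps_Cexp r : (0 < r)%R -> has_ps Cexp ecoef r.
Proof. intros Hr. split; [exact Hr|]. intros h _. apply asum_Cexp. Qed.

Lemma an_Cexp_lin a k : an (fun h => Cexp (a + k * h)).
Proof.
  apply (an_ext (fun h => Cexp a * Cexp (k * h)) _ 1%R); [lra| |].
  - intros h _. now rewrite Cexp_plus.
  - apply an_scal. apply (an_arg_scal k Cexp). exists ecoef, 1%R. apply has_ps_Cexp; lra.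
Qed.

Lemma rsum_exp_le x F : (0 <= x)%R -> NoDup F ->
  (rsum (fun k => / INR (fact k) * x ^ k)%R F <= exp x)%R.
Proof.
  intros Hx HN. apply rsum_le_usum; [|  |exact HN].
  - intros k. apply Rmult_le_pos; [left; apply Rinv_0_lt_compat, INR_fact_lt_0|].
    now apply pow_le.
  - rewrite <- tsum_exp_real. eapply usum_ext; [|apply (asum_exp (RtoC x))].
    intros k; cbn beta. unfold ecoef. rewrite RtoC_mult, RtoC_inv, RtoC_pow; [reflexivity|].
    apply INR_fact_neq_0.
Qed.

(** Expanding every exponential gives a double family in i and k. The weight exp(|mu_i| r) bounds
    the sum over k of the moduli, so the two summations may be exchanged; the coefficients are
    moments of the frequencies. *)
Lemma has_ps_exp_sum {I : Type} (c mu : I -> C) r :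
  (0 < r)%R -> rbdd (fun i => Cmod (c i) * exp (Cmod (mu i) * r))%R ->
  has_ps (fun h => tsum (fun i => c i * Cexp (mu i * h)))
    (fun k => ecoef k * tsum (fun i => c i * mu i ^ k)) r /\
  (forall h, (Cmod h < r)%R -> rbdd (fun i => Cmod (c i * Cexp (mu i * h)))).
Proof.
  intros Hr HB.
  assert (HB2 : forall h, (Cmod h < r)%R ->
    rbdd (fun p : I * nat => Cmod (c (fst p) * (ecoef (snd p) * (mu (fst p) * h) ^ snd p)))).
  { intros h Hh. eapply rbdd_sigma; [intros; apply Cmod_ge_0| |exact HB].
    intros i F HF. cbn beta. cbn [fst snd].
    apply Rle_trans with (rsum (fun k => Cmod (c i) *
       (/ INR (fact k) * (Cmod (mu i) * Cmod h) ^ k))%R F).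
    - apply rsum_le. intros k _. rewrite !Cmod_mult, Cmod_ecoef, Cmod_pow, Cmod_mult. lra.
    - rewrite rsum_scal. apply Rmult_le_compat_l; [apply Cmod_ge_0|].
      pose proof (Cmod_ge_0 (mu i)). pose proof (Cmod_ge_0 h).
      eapply Rle_trans; [apply rsum_exp_le; [now apply Rmult_le_pos|exact HF]|].
      destruct (Req_dec (Cmod (mu i)) 0) as [->|Hm]; [rewrite !Rmult_0_l; lra|].
      left. apply exp_increasing. apply Rmult_lt_compat_l; lra. }
  assert (Hrow : forall h, (Cmod h < r)%R -> asum (fun i => c i * Cexp (mu i * h))
    (tsum (fun p : I * nat => c (fst p) * (ecoef (snd p) * (mu (fst p) * h) ^ snd p)))).
  { intros h Hh. eapply asum_fubini; [|apply asum_exists, HB2, Hh].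
    intros i. cbn [fst snd]. apply usum_scal, asum_Cexp. }
  split; [split; [exact Hr|]|]; intros h Hh; [|apply (Hrow h Hh)].
  rewrite (tsum_eq _ _ (proj2 (Hrow h Hh))).
  pose proof (asum_swap _ _ (asum_exists _ (HB2 h Hh))) as HS.
  eapply asum_fubini; [|exact HS]. intros k. cbn [fst snd].
  assert (Hk : rbdd (fun i => Cmod (c i * mu i ^ k))).
  { eapply rbdd_le; [|apply (rbdd_scal (INR (fact k) * / r ^ k)%R); [|exact HB]].
    - intros i; cbn beta. rewrite Cmod_mult, Cmod_pow.
      pose proof (Cmod_ge_0 (c i)). pose proof (Cmod_ge_0 (mu i)).
      assert (Hf : (0 < INR (fact k))%R) by apply INR_fact_lt_0.
      assert (Hrk : (0 < r ^ k)%R) by now apply pow_lt.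
      pose proof (rsum_exp_le (Cmod (mu i) * r) (k :: nil)) as He.
      rewrite rsum_cons, rsum_nil, Rplus_0_r, Rpow_mult_distr in He.
      assert (Hle : (/ INR (fact k) * (Cmod (mu i) ^ k * r ^ k) <= exp (Cmod (mu i) * r))%R).
      { apply He; [apply Rmult_le_pos; lra|]. constructor; [easy|constructor]. }
      replace (INR (fact k) * / r ^ k * (Cmod (c i) * exp (Cmod (mu i) * r)))%R with
        (Cmod (c i) * (INR (fact k) * / r ^ k * exp (Cmod (mu i) * r)))%R by ring.
      apply Rmult_le_compat_l; [lra|].
      replace (Cmod (mu i) ^ k)%R with (INR (fact k) * / r ^ k *
        (/ INR (fact k) * (Cmod (mu i) ^ k * r ^ k)))%R by (field; lra).
      apply Rmult_le_compat_l; [|exact Hle].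
      apply Rmult_le_pos; [lra|left; now apply Rinv_0_lt_compat].
    - apply Rmult_le_pos; [apply pos_INR|]. left; apply Rinv_0_lt_compat, pow_lt; lra. }
  apply asum_exists in Hk. apply (asum_scal (ecoef k * h ^ k)) in Hk.
  replace (ecoef k * tsum (fun i => c i * mu i ^ k) * h ^ k) with
    (ecoef k * h ^ k * tsum (fun i => c i * mu i ^ k)) by ring.
  eapply usum_ext; [|apply Hk]. intros i; cbn beta. rewrite Cpow_mult_l. ring.
Qed.

(** * The partial fractions of the squared cosecant *)

(** Compactness of a closed rectangle. The predicate [P] allows points such as poles to be left out,
    provided the function is bounded on the remaining points around them. *)
Lemma box_bounded (P : C -> Prop) (phi : C -> R) a b a' b' :
  (forall p, (a <= Re p <= b)%R -> (a' <= Im p <= b')%R ->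
    exists r M, (0 < r)%R /\ forall z, P z -> (Cmod (z - p) < r)%R -> (phi z <= M)%R) ->
  exists M, forall z, (a <= Re z <= b)%R -> (a' <= Im z <= b')%R -> P z -> (phi z <= M)%R.
Proof.
  intros H.
  assert (H' : forall p : C, exists rM : posreal * R,
    (a <= Re p <= b)%R -> (a' <= Im p <= b')%R ->
    forall z, P z -> (Cmod (z - p) < fst rM)%R -> (phi z <= snd rM)%R).
  { intros p. destruct (excluded_middle_informative
      ((a <= Re p <= b)%R /\ (a' <= Im p <= b')%R)) as [[H1 H2]|Hn].
    - destruct (H p H1 H2) as (r & M & Hr & HM). now exists (mkposreal r Hr, M).
    - exists (mkposreal 1 Rlt_0_1, 0%R). tauto. }
  set (rM := fun p => proj1_sig (constructive_indefinite_description _ (H' p))).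
  assert (HrM : forall p, (a <= Re p <= b)%R -> (a' <= Im p <= b')%R ->
    forall z, P z -> (Cmod (z - p) < fst (rM p))%R -> (phi z <= snd (rM p))%R).
  { intros p. unfold rM. now destruct (constructive_indefinite_description _ (H' p)). }
  clearbody rM. clear H H'.
  assert (Hd : forall p : C, (0 < fst (rM p) / 2)%R) by
    (intros p; destruct (fst (rM p)) as [d Hd]; cbn; lra).
  (* Half the radius in each coordinate is enough, since |Re| + |Im| bounds the modulus. *)
  set (delta := fun t : Compactness.Tn 2 R => let '(x, (y, _)) := t in
    mkposreal (fst (rM (x, y)) / 2) (Hd (x, y))).
  pose proof (compactness_list 2 (a, (a', tt)) (b, (b', tt)) delta) as HC.
  (* [compactness_list] delivers its finite cover under a double negation, so the goal is first
     decided classically. *)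
  destruct (excluded_middle_informative (exists M, forall z,
    (a <= Re z <= b)%R -> (a' <= Im z <= b')%R -> P z -> (phi z <= M)%R)) as [HE|HE];
    [exact HE|].
  exfalso. apply HC. intros [l Hl]. apply HE. clear HC HE.
  exists (rsum (fun t : Compactness.Tn 2 R =>
    let '(x, (y, _)) := t in Rabs (snd (rM (x, y)))) l).
  intros z H1 H2 HP. destruct (Hl (Re z, (Im z, tt))) as ([u [v []]] & Hin & Hb & Hc).
  { cbn. auto. }
  cbn in Hb, Hc. destruct Hb as (Hb1 & Hb2 & _). destruct Hc as (Hc1 & Hc2 & _).
  apply Rle_trans with (snd (rM (u, v))).
  - apply (HrM (u, v)); auto.
    replace (z - (u, v)) with (RtoC (Re z - u) + Ci * RtoC (Im z - v)).
    + eapply Rle_lt_trans; [apply Cmod_triangle|].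
      rewrite Cmod_mult, Cmod_Ci, !Cmod_R. lra.
    + destruct z as [x y]. apply injective_projections; cbn; ring.
  - eapply Rle_trans; [apply Rle_abs|]. clear -Hin.
    induction l as [|t l IH]; [destruct Hin|]. rewrite rsum_cons.
    assert (0 <= rsum (fun t : Compactness.Tn 2 R =>
      let '(x, (y, _)) := t in Rabs (snd (rM (x, y)))) l)%R.
    { apply rsum_ge0. intros [x [y _]]. apply Rabs_pos. }
    destruct Hin as [->|Hin]; [lra|]. specialize (IH Hin).
    destruct t as [x [y _]]. pose proof (Rabs_pos (snd (rM (x, y)))). lra.
Qed.

(** (k + 2)^(-3/2) is summable in one variable, while a product of two such weights dominates, up to
    a constant, the size |w|^(-3) of the terms of the Weierstrass series: 3/2 + 3/2 = 3. The shift
    by 2 keeps the base away from 0. *)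
Definition wt (k : nat) : R := (/ ((INR k + 2) * sqrt (INR k + 2)))%R.

Lemma wt_pos k : (0 < wt k)%R.
Proof.
  pose proof (pos_INR k). apply Rinv_0_lt_compat, Rmult_lt_0_compat; [lra|].
  apply sqrt_lt_R0; lra.
Qed.

Lemma rbdd_wt : rbdd wt.
Proof.
  apply rbdd_nat with 2%R; [intros; left; apply wt_pos|]. intros n.
  (* Comparison with the integral of x^(-3/2): each term is at most 2 (1/sqrt(n+1) - 1/sqrt(n+2)),
     and these differences telescope. *)
  assert (H : (rsum wt (seq 0 n) <= 2 * (1 - / sqrt (INR n + 1)))%R).
  { induction n as [|n IH].
    - cbn [seq]. rewrite rsum_nil. cbn [INR]. rewrite Rplus_0_l, sqrt_1. lra.
    - rewrite seq_S, rsum_app, rsum_cons, rsum_nil. cbn [Nat.add]. rewrite S_INR.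
      replace (INR n + 1 + 1)%R with (INR n + 2)%R by ring.
      pose proof (pos_INR n) as Hn.
      set (s := sqrt (INR n + 1)) in *. set (t := sqrt (INR n + 2)).
      assert (Hs : (0 < s)%R) by (apply sqrt_lt_R0; lra).
      assert (Ht : (0 < t)%R) by (apply sqrt_lt_R0; lra).
      assert (Es : (s * s = INR n + 1)%R) by (apply sqrt_sqrt; lra).
      assert (Et : (t * t = INR n + 2)%R) by (apply sqrt_sqrt; lra).
      assert (wt n = / (t * t * t))%R as -> by (unfold wt; fold t; now rewrite <- Et).
      assert (Hst : (s < t)%R) by (apply sqrt_lt_1; lra).
      assert (E : (/ s - / t = / (s * t * (s + t)))%R).
      { assert (E1 : ((t - s) * (t + s) = 1)%R) by lra.
        apply Rmult_eq_reg_r with (s * t * (s + t))%R; [|apply Rgt_not_eq, Rmult_lt_0_compat; [now apply Rmult_lt_0_compat|lra]].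
        rewrite Rinv_l; [|apply Rgt_not_eq, Rmult_lt_0_compat; [now apply Rmult_lt_0_compat|lra]].
        transitivity ((t - s) * (t + s))%R; [field; lra|exact E1]. }
      assert (Hle : (/ (t * t * t) <= 2 * / (s * t * (s + t)))%R).
      { replace (2 * / (s * t * (s + t)))%R with (/ (s * t * ((s + t) / 2)))%R by (field; lra).
        apply Rinv_le_contravar.
        - apply Rmult_lt_0_compat; [now apply Rmult_lt_0_compat|lra].
        - assert (0 < s * t)%R by now apply Rmult_lt_0_compat.
          apply Rmult_le_compat; try lra. apply Rmult_le_compat_r; lra. }
      lra. }
  assert (0 < / sqrt (INR n + 1))%R; [|lra].
  apply Rinv_0_lt_compat, sqrt_lt_R0. pose proof (pos_INR n). lra.
Qed.

Lemma wt_sqr k : (/ (INR k + 2) ^ 2 <= wt k)%R.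
Proof.
  pose proof (pos_INR k). unfold wt.
  assert (0 < sqrt (INR k + 2))%R by (apply sqrt_lt_R0; lra).
  assert (sqrt (INR k + 2) * sqrt (INR k + 2) = INR k + 2)%R by (apply sqrt_sqrt; lra).
  apply Rinv_le_contravar; [apply Rmult_lt_0_compat; lra|].
  cbn. rewrite Rmult_1_r. apply Rmult_le_compat_l; [lra|]. nra.
Qed.

Definition wtZ (n : Z) : R := wt (Z.abs_nat n).

Lemma wtZ_pos n : (0 < wtZ n)%R.
Proof. apply wt_pos. Qed.

Lemma rbdd_wtZ : rbdd wtZ.
Proof.
  assert (H : rbdd (fun p : bool * nat => 1 * wt (snd p))%R).
  { apply (rbdd_prod (fun _ => 1%R) wt); try (intros; lra); [intros; left; apply wt_pos| |exact rbdd_wt].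
    exists 2%R. intros F HF.
    eapply Rle_trans; [apply (rsum_incl _ F (true :: false :: nil))|].
    - intros; lra.
    - exact HF.
    - intros []; cbn; auto.
    - rewrite !rsum_cons, rsum_nil. lra. }
  apply (rbdd_comp (fun n : Z => (Z.ltb n 0, Z.abs_nat n))) in H.
  - eapply rbdd_ext; [|exact H]. intros n; cbn. unfold wtZ; ring.
  - intros n m E. injection E as E1 E2.
    destruct (Z.ltb_spec n 0), (Z.ltb_spec m 0); try discriminate; lia.
Qed.

(** * The function pi^2 / sin^2(pi z) *)

Definition isZ (z : C) : Prop := exists n : Z, z = IZC n.

Definition tpi : C := 2 * RtoC PI * Ci.

(** With w = exp(2 pi i z) this is pi^2 / sin^2(pi z), in the form (2 pi i)^2 w / (1 - w)^2 that
    expands into powers of w on the upper half plane. *)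
Definition csc2 (z : C) : C :=
  tpi * tpi * Cexp (tpi * z) / ((1 - Cexp (tpi * z)) * (1 - Cexp (tpi * z))).

Lemma RtoC_nz x : x <> 0%R -> RtoC x <> 0.
Proof. intros H E. apply RtoC_inj in E. auto. Qed.

Lemma C2_nz : RtoC 2 <> 0.
Proof. apply RtoC_nz; lra. Qed.

Lemma tpi_nz : tpi <> 0.
Proof.
  unfold tpi. apply Cmult_neq_0; [apply Cmult_neq_0|].
  - exact C2_nz.
  - apply RtoC_nz, PI_neq0.
  - exact Ci_nz.
Qed.

Lemma Cexp_tpi_1 z : Cexp (tpi * z) = 1 <-> isZ z.
Proof.
  split.
  - intros E. apply Cexp_eq_1 in E. destruct E as [n En]. exists n. fold tpi in En.
    replace z with (tpi * z / tpi) by (field; apply tpi_nz). rewrite En. field. apply tpi_nz.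
  - intros [n ->]. apply Cexp_2PI_Z.
Qed.

Lemma csc2_den_nz z : ~ isZ z -> 1 - Cexp (tpi * z) <> 0.
Proof.
  intros Hz E. apply Hz, Cexp_tpi_1. symmetry. now apply Ceq_minus.
Qed.

Lemma IZC_plus m n : IZC (m + n) = IZC m + IZC n.
Proof. unfold IZC. now rewrite plus_IZR, RtoC_plus. Qed.

Lemma IZC_mult m n : IZC (m * n) = IZC m * IZC n.
Proof. unfold IZC. now rewrite mult_IZR, RtoC_mult. Qed.

Lemma IZC_opp n : IZC (- n) = - IZC n.
Proof. unfold IZC. now rewrite opp_IZR, RtoC_opp. Qed.

Lemma IZC_inj m n : IZC m = IZC n -> m = n.
Proof. intros E. apply RtoC_inj in E. now apply eq_IZR. Qed.

Lemma csc2_per z n : csc2 (z + IZC n) = csc2 z.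
Proof.
  unfold csc2. enough (Cexp (tpi * (z + IZC n)) = Cexp (tpi * z)) as -> by reflexivity.
  rewrite Cmult_plus_distr_l, Cexp_plus.
  assert (Cexp (tpi * IZC n) = 1) as -> by (apply Cexp_tpi_1; now exists n). ring.
Qed.

Lemma isZ_opp z : isZ (- z) <-> isZ z.
Proof.
  split; intros [n E]; exists (- n)%Z; rewrite IZC_opp, <- E; ring.
Qed.

Lemma isZ_shift z n : isZ (z + IZC n) <-> isZ z.
Proof.
  split; intros [m E].
  - exists (m - n)%Z. unfold Z.sub. rewrite IZC_plus, IZC_opp, <- E. ring.
  - exists (m + n)%Z. rewrite IZC_plus, <- E. ring.
Qed.

(** sin^2(pi z) / pi^2, the entire reciprocal of [csc2]; multiplying by it clears the double
    poles. *)
Definition csc2_inv (z : C) : C := (Cexp (tpi * z) + Cexp (- tpi * z) - 2) / (tpi * tpi).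

Lemma csc2_inv_spec z : ~ isZ z -> csc2 z = / csc2_inv z /\ csc2_inv z <> 0.
Proof.
  intros Hz. pose proof (csc2_den_nz z Hz) as Hd. unfold csc2, csc2_inv.
  replace (- tpi * z) with (- (tpi * z)) by ring. rewrite Cexp_inv.
  pose proof (Cexp_nz (tpi * z)) as Hw. set (w := Cexp (tpi * z)) in *.
  pose proof tpi_nz as Ht.
  assert (E : w + / w - 2 = (1 - w) * (1 - w) / w) by (field; auto).
  rewrite E. split.
  - field. auto.
  - unfold Cdiv. repeat apply Cmult_neq_0; auto.
    + intros E0. apply (f_equal (fun x => x * w)) in E0. rewrite Cinv_l, Cmult_0_l in E0 by auto.
      now apply C1_nz.
    + intros E0. apply (f_equal (fun x => x * (tpi * tpi))) in E0.
      rewrite Cinv_l, Cmult_0_l in E0 by now apply Cmult_neq_0. now apply C1_nz.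
Qed.

Lemma csc2_even z : ~ isZ z -> csc2 (- z) = csc2 z.
Proof.
  intros Hz. destruct (csc2_inv_spec z Hz) as [-> _].
  destruct (csc2_inv_spec (- z)) as [-> _]; [now rewrite isZ_opp|].
  f_equal. unfold csc2_inv. replace (tpi * - z) with (- tpi * z) by ring.
  replace (- tpi * - z) with (tpi * z) by ring. f_equal. ring.
Qed.

Lemma isZ_half z : isZ (z / 2) -> isZ z.
Proof.
  intros [n E]. exists (2 * n)%Z. rewrite IZC_mult, <- E. unfold IZC. field.
Qed.

Lemma isZ_half_shift z : isZ (z / 2 + / 2) -> isZ z.
Proof.
  intros [n E]. exists (2 * n - 1)%Z. unfold Z.sub. rewrite IZC_plus, IZC_mult, <- E.
  unfold IZC. assert (RtoC (IZR (- (1))) = - (1)) as -> by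
    (apply injective_projections; cbn; ring).
  field.
Qed.

(** With v = exp(pi i z), shifting z/2 by 1/2 changes v into -v, and v/(1 - v)^2 - v/(1 + v)^2 = 4
    v^2/(1 - v^2)^2. *)
Lemma csc2_dup z : ~ isZ z -> csc2 (z / 2) + csc2 (z / 2 + / 2) = 4 * csc2 z.
Proof.
  intros Hz.
  assert (H1 : ~ isZ (z / 2)) by (intros H; now apply Hz, isZ_half).
  assert (H2 : ~ isZ (z / 2 + / 2)) by (intros H; now apply Hz, isZ_half_shift).
  pose proof (csc2_den_nz _ Hz) as D. pose proof (csc2_den_nz _ H1) as D1.
  pose proof (csc2_den_nz _ H2) as D2. unfold csc2.
  assert (E1 : Cexp (tpi * z) = Cexp (tpi * (z / 2)) * Cexp (tpi * (z / 2))).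
  { rewrite <- Cexp_plus. f_equal. field. }
  assert (E2 : Cexp (tpi * (z / 2 + / 2)) = - Cexp (tpi * (z / 2))).
  { rewrite Cmult_plus_distr_l, Cexp_plus.
    enough (Cexp (tpi * / 2) = - (1)) as -> by ring.
    unfold tpi. replace (2 * RtoC PI * Ci * / 2) with (Ci * RtoC PI) by field.
    unfold Cexp, Ci, RtoC, Cmult, Copp, Re, Im. cbn [fst snd].
    replace (0 * PI - 1 * 0)%R with 0%R by ring. replace (0 * 0 + 1 * PI)%R with PI by ring.
    rewrite exp_0, cos_PI, sin_PI. f_equal; ring. }
  rewrite E1, E2 in *. set (v := Cexp (tpi * (z / 2))) in *.
  assert (D2' : 1 + v <> 0) by (intros E; apply D2; rewrite <- E; ring).
  assert (Dv : 1 - v * v <> 0) by exact D.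
  replace (1 - v * v) with ((1 - v) * (1 + v)) by ring.
  replace (1 - - v) with (1 + v) by ring. field. auto.
Qed.

Lemma an_csc2_inv : an csc2_inv.
Proof.
  unfold csc2_inv. apply an_mult; [|apply an_const].
  apply an_minus; [apply an_plus|apply an_const].
  - apply (an_ext (fun h => Cexp (0 + tpi * h)) _ 1%R); [lra| |apply an_Cexp_lin].
    intros h _. now rewrite Cplus_0_l.
  - apply (an_ext (fun h => Cexp (0 + (- tpi) * h)) _ 1%R); [lra| |apply an_Cexp_lin].
    intros h _. now rewrite Cplus_0_l.
Qed.

(** The coefficients of index 0, 1 and 3 vanish and that of index 2 is [tpi * tpi], so four
    divisions by z leave an analytic remainder. The missing cubic term keeps 1/z out of the
    expansion of [csc2] at 0. *)
Lemma csc2_inv_local : exists chi r, an chi /\ (0 < r)%R /\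
  forall z, (Cmod z < r)%R -> csc2_inv z = z * z * (1 + z * z * chi z).
Proof.
  set (phi := fun h => Cexp (tpi * h) + (Cexp (- tpi * h) + - (2))).
  assert (HE : forall k, has_ps (fun h => Cexp (k * h)) (fun n => ecoef n * k ^ n) 1).
  { intros k. split; [lra|]. intros h _. eapply asum_ext; [|apply asum_Cexp].
    intros n; cbn beta. rewrite Cpow_mult_l. ring. }
  assert (HP : has_ps phi (fun n => ecoef n * tpi ^ n + (ecoef n * (- tpi) ^ n +
    match n with O => - (2) | _ => 0 end)) 1).
  { apply has_ps_plus; [apply HE|apply has_ps_plus; [apply HE|apply has_ps_const; lra]]. }
  set (c := fun n => _) in HP.
  assert (c 0%nat = 0) as C0.
  { unfold c, ecoef. cbn. field. }
  assert (c 1%nat = 0) as C1'.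
  { unfold c, ecoef. cbn. field. }
  assert (c 2%nat = tpi * tpi) as C2'.
  { unfold c, ecoef. replace (INR (fact 2)) with 2%R by (cbn; ring). cbn [Cpow].
    field. }
  assert (c 3%nat = 0) as C3'.
  { unfold c, ecoef. replace (INR (fact 3)) with 6%R by (cbn; ring). cbn [Cpow].
    field. }
  destruct (has_ps_shift _ _ _ HP) as (p1 & H1 & E1).
  destruct (has_ps_shift _ _ _ H1) as (p2 & H2 & E2).
  destruct (has_ps_shift _ _ _ H2) as (p3 & H3 & E3).
  destruct (has_ps_shift _ _ _ H3) as (p4 & H4 & E4).
  exists (fun z => / (tpi * tpi) * p4 z), 1%R. split; [|split; [lra|]].
  - apply an_scal. now exists (fun k => c (S (S (S (S k))))), 1%R.
  - intros z Hz. unfold csc2_inv.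
    replace (Cexp (tpi * z) + Cexp (- tpi * z) - 2) with (phi z) by (unfold phi; ring).
    rewrite E1, E2, E3, E4, C0, C1', C2', C3' by auto. field. apply tpi_nz.
Qed.

Lemma csc2_local : exists kap r, an kap /\ (0 < r)%R /\
  forall z, (0 < Cmod z < r)%R -> ~ isZ z /\ csc2 z = / (z * z) + kap z.
Proof.
  destruct csc2_inv_local as (chi & r & Hchi & Hr & E).
  set (psi := fun z => 1 + z * z * chi z).
  assert (Hpsi : an psi).
  { apply an_plus; [apply an_const|]. apply an_mult; [apply an_mult; apply an_id|exact Hchi]. }
  assert (Hpsi0 : psi 0 <> 0).
  { unfold psi. rewrite !Cmult_0_l, Cplus_0_r. exact C1_nz. }
  destruct (an_nonzero _ Hpsi Hpsi0) as (d & Hd & Hnz).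
  (* As psi = 1 + z^2 chi, one has 1/(z^2 psi) - 1/z^2 = -chi/psi. The radius 1 excludes the nonzero
     integers. *)
  exists (fun z => - (1) * chi z / psi z), (Rmin (Rmin r d) 1). split; [|split].
  - apply an_div; auto. now apply an_scal.
  - repeat apply Rmin_glb_lt; lra.
  - intros z Hz. rmins.
    assert (Hz0 : z <> 0) by (apply Cmod_gt_0; lra).
    assert (HZ : ~ isZ z).
    { intros [n En]. assert (Hn : n <> 0%Z) by (intros ->; apply Hz0; exact En).
      destruct Hz as [_ Hz]. rewrite En in Hz. unfold IZC in Hz.
      rewrite Cmod_R, <- abs_IZR in Hz. assert (Hn' : (1 <= Z.abs n)%Z) by lia.
      apply IZR_le in Hn'. lra. }
    split; [exact HZ|]. destruct (csc2_inv_spec z HZ) as [-> _].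
    rewrite E by lra. fold (psi z). specialize (Hnz z ltac:(lra)).
    unfold psi in *. field. auto.
Qed.

Lemma an_csc2 p : ~ isZ p -> an (fun h => csc2 (p + h)).
Proof.
  intros Hp. pose proof (csc2_den_nz p Hp) as Hd.
  assert (HE : an (fun h => Cexp (tpi * (p + h)))).
  { apply (an_ext (fun h => Cexp (tpi * p + tpi * h)) _ 1%R); [lra| |apply an_Cexp_lin].
    intros h _. f_equal; ring. }
  assert (HD : an (fun h => 1 - Cexp (tpi * (p + h)))).
  { apply an_minus; [apply an_const|exact HE]. }
  unfold csc2. apply an_div.
  - apply an_mult; [apply an_const|exact HE].
  - now apply an_mult.
  - rewrite Cplus_0_r. now apply Cmult_neq_0.
Qed.

(** For Im z >= 1 the number w = exp(2 pi i z) has modulus at most 1/2, because exp(2 pi) > 2;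
    evenness covers the lower half plane. *)
Lemma csc2_bound_im z : (1 <= Rabs (Im z))%R -> (Cmod (csc2 z) <= 8 * Cmod (tpi * tpi))%R.
Proof.
  assert (H : forall z, (1 <= Im z)%R -> (Cmod (csc2 z) <= 8 * Cmod (tpi * tpi))%R).
  { clear z. intros z Hz. unfold csc2.
    assert (Hw : (Cmod (Cexp (tpi * z)) <= / 2)%R).
    { rewrite Cmod_Cexp.
      assert (Re (tpi * z) = - (2 * PI * Im z))%R as ->.
      { unfold tpi, Ci, RtoC, Cmult, Re, Im. cbn. ring. }
      rewrite exp_Ropp. pose proof PI2_1.
      apply Rinv_le_contravar; [lra|].
      eapply Rle_trans; [|apply Rlt_le, exp_ineq1; nra]. nra. }
    set (w := Cexp (tpi * z)) in *.
    assert (Hd : (/ 2 <= Cmod (1 - w))%R).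
    { pose proof (Cmod_triangle (1 - w) w) as Ht. replace (1 - w + w) with (RtoC 1) in Ht by ring.
      rewrite Cmod_1 in Ht. lra. }
    assert (1 - w <> 0) by (apply Cmod_gt_0; lra).
    rewrite Cmod_div, (Cmod_mult (tpi * tpi)), (Cmod_mult (1 - w)) by now apply Cmult_neq_0.
    pose proof (Cmod_ge_0 (tpi * tpi)). pose proof (Cmod_ge_0 w).
    assert (Hi : (/ (Cmod (1 - w) * Cmod (1 - w)) <= 4)%R).
    { replace 4%R with (/ (/ 2 * / 2))%R by field. apply Rinv_le_contravar; [lra|].
      apply Rmult_le_compat; lra. }
    assert (0 < / (Cmod (1 - w) * Cmod (1 - w)))%R by
      (apply Rinv_0_lt_compat, Rmult_lt_0_compat; lra).
    unfold Rdiv. rewrite Rmult_assoc, (Rmult_comm 8). apply Rmult_le_compat_l; [lra|].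
    apply Rle_trans with (/ 2 * 4)%R; [apply Rmult_le_compat; lra|lra]. }
  intros Hz. destruct (Rle_dec 0 (Im z)) as [Hi|Hi].
  - apply H. now rewrite Rabs_pos_eq in Hz.
  - rewrite <- csc2_even.
    + apply H. rewrite Rabs_left in Hz by lra. destruct z; cbn in *; lra.
    + intros [n E]. rewrite E in Hi. cbn in Hi. lra.
Qed.

(** * The sum of 1/(z + n)^2 over the integers, compared with [csc2] *)

Definition rowsum (z : C) : C := tsum (fun n : Z => / ((z + IZC n) * (z + IZC n))).

Lemma row_term_bound z n : (Rabs (Re z) <= / 2)%R -> n <> 0%Z ->
  (Cmod (/ ((z + IZC n) * (z + IZC n))) <= 36 * wtZ n)%R.
Proof.
  intros Hz Hn.
  assert (Hk : (INR (Z.abs_nat n) = Rabs (IZR n))%R).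
  { rewrite INR_IZR_INZ, Zabs2Nat.id_abs, abs_IZR. reflexivity. }
  assert (H1 : (1 <= Rabs (IZR n))%R).
  { rewrite <- abs_IZR. apply (IZR_le 1). lia. }
  (* |n| - 1/2 >= (|n| + 2)/6 for |n| >= 1, with equality at 1. This compares the distance with the
     base of the weight, and 36 = 6^2. *)
  assert (Hl : ((Rabs (IZR n) + 2) / 6 <= Cmod (z + IZC n))%R).
  { eapply Rle_trans; [|apply re_le_Cmod].
    replace (Re (z + IZC n)) with (Re z + IZR n)%R by reflexivity.
    pose proof (Rabs_triang (Re z + IZR n) (- Re z)) as Ht.
    replace (Re z + IZR n + - Re z)%R with (IZR n) in Ht by ring.
    rewrite Rabs_Ropp in Ht. lra. }
  assert (z + IZC n <> 0) by (apply Cmod_gt_0; lra).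
  rewrite Cmod_inv, Cmod_mult by now apply Cmult_neq_0.
  apply Rle_trans with (36 * / (INR (Z.abs_nat n) + 2) ^ 2)%R;
    [|apply Rmult_le_compat_l; [lra|apply wt_sqr]].
  rewrite Hk.
  replace (36 * / (Rabs (IZR n) + 2) ^ 2)%R with
    (/ ((Rabs (IZR n) + 2) / 6 * ((Rabs (IZR n) + 2) / 6)))%R by (field; lra).
  apply Rinv_le_contravar; [apply Rmult_lt_0_compat; lra|].
  apply Rmult_le_compat; lra.
Qed.

Lemma exists_round (x : R) : exists n : Z, (Rabs (x + IZR n) <= / 2)%R.
Proof.
  exists (- up (x - / 2))%Z. destruct (archimed (x - / 2)) as [H1 H2].
  rewrite opp_IZR. apply Rabs_le. lra.
Qed.

Lemma rbdd_row z : rbdd (fun n : Z => Cmod (/ ((z + IZC n) * (z + IZC n)))).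
Proof.
  destruct (exists_round (Re z)) as [n0 Hn0].
  assert (H : rbdd (fun n : Z => Cmod (/ ((z + IZC n0 + IZC n) * (z + IZC n0 + IZC n))))).
  { apply rbdd_le_off with (fun n => 36 * wtZ n)%R (0%Z :: nil).
    - intros n. pose proof (wtZ_pos n). lra.
    - intros n Hn. apply row_term_bound; [exact Hn0|]. intros ->. apply Hn. now left.
    - apply rbdd_scal; [lra|exact rbdd_wtZ]. }
  apply (rbdd_comp (fun n => n - n0)%Z) in H; [|intros; lia].
  eapply rbdd_ext; [|exact H]. intros n; cbn beta. unfold Z.sub. rewrite IZC_plus, IZC_opp.
  do 3 f_equal; ring.
Qed.

Lemma asum_row z : asum (fun n : Z => / ((z + IZC n) * (z + IZC n))) (rowsum z).
Proof. apply asum_exists, rbdd_row. Qed.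

Lemma rowsum_per z m : rowsum (z + IZC m) = rowsum z.
Proof.
  eapply asum_unique; [apply asum_row|].
  eapply asum_ext; [|apply (asum_bij (fun n => m + n)%Z (fun n => n - m)%Z _ _
    ltac:(intros; cbv beta; lia) ltac:(intros; cbv beta; lia) (asum_row z))].
  intros n; cbn beta. rewrite IZC_plus. f_equal. ring.
Qed.

(** For |Re z| <= 1/2 the only singular term is 1/z^2; the others are dominated by weights that do
    not depend on z. *)
Lemma rowsum_near : exists M, forall z, (Rabs (Re z) <= / 2)%R ->
  (Cmod (rowsum z - / (z * z)) <= M)%R.
Proof.
  destruct (rbdd_scal 36 wtZ ltac:(lra) rbdd_wtZ) as [M HM]. exists M. intros z Hz.
  pose proof (asum_single (fun n => if Z.eq_dec n 0 then - / (z * z) else 0) 0%Z) as H0.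
  cbv beta in H0. destruct (Z.eq_dec 0 0) as [_|]; [|congruence].
  assert (H1 : asum (fun n => if Z.eq_dec n 0 then 0 else / ((z + IZC n) * (z + IZC n)))
    (rowsum z - / (z * z))).
  { eapply asum_ext; [|apply asum_plus; [apply asum_row|apply H0]].
    - intros n; cbn beta. destruct (Z.eq_dec n 0) as [->|]; [|ring].
      replace (z + IZC 0) with z by (unfold IZC; ring). ring.
    - intros n Hn. now destruct (Z.eq_dec n 0). }
  destruct H1 as [_ H1]. apply (usum_le _ _ _) with (2 := H1).
  intros F HF. eapply Rle_trans; [|apply (HM F HF)]. apply rsum_le. intros n _.
  destruct (Z.eq_dec n 0) as [->|Hn].
  - rewrite Cmod_0. pose proof (wtZ_pos 0). lra.
  - now apply row_term_bound.
Qed.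

(** The principal part on this strip is the same as for the row sum, so the difference of the two
    functions is bounded. Compactness handles |Im z| <= 1, and the bound far from the real axis
    handles the rest. *)
Lemma csc2_near : exists M, forall z, (Rabs (Re z) <= / 2)%R -> ~ isZ z ->
  (Cmod (csc2 z - / (z * z)) <= M)%R.
Proof.
  destruct (box_bounded (fun z => ~ isZ z) (fun z => Cmod (csc2 z - / (z * z)))
    (- / 2) (/ 2) (-1) 1) as [M HM].
  { intros p Hp1 Hp2. destruct (Req_dec (Cmod p) 0) as [Hp|Hp].
    - apply Cmod_eq_0 in Hp. subst p.
      destruct csc2_local as (kap & r & Hk & Hr & E).
      destruct (an_locally_bounded _ Hk) as (s & M & Hs & HM).
      exists (Rmin r s), M. split; [now apply Rmin_glb_lt|]. intros z HZ Hz.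
      rmins.
      replace (z - 0) with z in Hz by ring.
      assert (Hz0 : z <> 0) by (intros ->; apply HZ; now exists 0%Z).
      apply Cmod_gt_0 in Hz0. destruct (E z) as [_ ->]; [lra|].
      replace (/ (z * z) + kap z - / (z * z)) with (kap z) by ring. apply HM. lra.
    - assert (Hp0 : p <> 0) by (intros ->; apply Hp, Cmod_0).
      assert (HZ : ~ isZ p).
      { intros [n En]. assert (Hn : n <> 0%Z) by (intros ->; apply Hp0; exact En).
        rewrite En in Hp1. unfold IZC in Hp1. cbn in Hp1.
        destruct (Z_lt_le_dec n 0) as [Hl|Hl].
        - assert (Hl' : (n <= -1)%Z) by lia. apply IZR_le in Hl'. lra.
        - assert (Hl' : (1 <= n)%Z) by lia. apply IZR_le in Hl'. lra. }
      assert (HA : an (fun h => csc2 (p + h) - / ((p + h) * (p + h)))).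
      { apply an_minus; [now apply an_csc2|]. apply an_inv.
        - apply an_mult; apply an_plus; try apply an_const; apply an_id.
        - rewrite Cplus_0_r. now apply Cmult_neq_0. }
      destruct (an_locally_bounded _ HA) as (s & M & Hs & HM).
      exists s, M. split; [exact Hs|]. intros z _ Hz. specialize (HM (z - p) Hz).
      cbv beta in HM. now replace (p + (z - p)) with z in HM by ring. }
  exists (Rmax M (8 * Cmod (tpi * tpi) + 1))%R. intros z Hz HZ.
  destruct (Rle_dec (Rabs (Im z)) 1) as [Hi|Hi].
  - eapply Rle_trans; [|apply Rmax_l]. apply Rabs_le_between in Hz, Hi. apply HM; auto.
  - eapply Rle_trans; [|apply Rmax_r]. apply Rnot_le_lt in Hi.
    unfold Cminus. eapply Rle_trans; [apply Cmod_triangle|]. rewrite Cmod_opp.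
    apply Rplus_le_compat; [apply csc2_bound_im; lra|].
    assert (Hm : (1 <= Cmod z)%R).
    { apply Rle_trans with (Rabs (Im z)); [lra|].
      eapply Rle_trans; [|apply Rmax_Cmod]. apply Rmax_r. }
    assert (z <> 0) by (apply Cmod_gt_0; lra).
    rewrite Cmod_inv, Cmod_mult by now apply Cmult_neq_0.
    apply Rle_trans with (/ 1)%R; [apply Rinv_le_contravar; [lra|nra]|rewrite Rinv_1; lra].
Qed.

Lemma asum_Z_even_odd (g : Z -> C) A B :
  asum (fun k => g (2 * k)%Z) A -> asum (fun k => g (2 * k + 1)%Z) B -> asum g (A + B).
Proof.
  apply asum_cover; try (intros; lia).
  intros n. destruct (Z.Even_or_Odd n) as [[k ->]|[k ->]]; [left|right]; now exists k.
Qed.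

(** The terms at z/2 and at (z + 1)/2 are four times the terms of even and of odd index at z. *)
Lemma rowsum_dup z : ~ isZ z -> rowsum (z / 2) + rowsum (z / 2 + / 2) = 4 * rowsum z.
Proof.
  intros Hz.
  assert (Hnz : forall n, z + IZC n <> 0).
  { intros n E. apply Hz. exists (- n)%Z. rewrite IZC_opp.
    replace z with (z + IZC n - IZC n) by ring. rewrite E. ring. }
  eapply asum_unique; [|apply asum_scal, asum_row].
  apply asum_Z_even_odd.
  - eapply asum_ext; [|apply (asum_row (z / 2))]. intros n; cbn beta.
    pose proof (Hnz (2 * n)%Z) as Hn. rewrite IZC_mult in *. unfold IZC at 1 in Hn.
    replace (IZC 2) with (RtoC 2) by reflexivity.
    replace (z / 2 + IZC n) with ((z + 2 * IZC n) / 2) by field.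
    replace (RtoC 4) with (2 * 2) by (rewrite <- RtoC_mult; f_equal; ring).
    field. exact Hn.
  - eapply asum_ext; [|apply (asum_row (z / 2 + / 2))]. intros n; cbn beta.
    pose proof (Hnz (2 * n + 1)%Z) as Hn. rewrite IZC_plus, IZC_mult in *.
    replace (IZC 2) with (RtoC 2) in * by reflexivity.
    replace (IZC 1) with (RtoC 1) in * by reflexivity.
    replace (z / 2 + / 2 + IZC n) with ((z + (2 * IZC n + 1)) / 2) by field.
    replace (RtoC 4) with (2 * 2) by (rewrite <- RtoC_mult; f_equal; ring).
    field. exact Hn.
Qed.

(* Herglotz' trick: the difference [g] of the two sides is bounded and satisfies
   [4 g(z) = g(z/2) + g((z+1)/2)], so every bound for [g] can be halved. *)
Lemma lipschitz z : ~ isZ z -> asum (fun n : Z => / ((z + IZC n) * (z + IZC n))) (csc2 z).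
Proof.
  intros Hz. enough (csc2 z - rowsum z = 0) as E.
  { replace (csc2 z) with (rowsum z); [apply asum_row|]. symmetry. now apply Ceq_minus. }
  assert (HB : exists M, forall z, ~ isZ z -> (Cmod (csc2 z - rowsum z) <= M)%R).
  { destruct rowsum_near as [M1 H1]. destruct csc2_near as [M2 H2].
    exists (M2 + M1)%R. intros u Hu. destruct (exists_round (Re u)) as [n Hn].
    rewrite <- (csc2_per u n), <- (rowsum_per u n).
    assert (Hu' : ~ isZ (u + IZC n)) by now rewrite isZ_shift.
    set (v := u + IZC n) in *. specialize (H1 v Hn). specialize (H2 v Hn Hu').
    replace (csc2 v - rowsum v) with ((csc2 v - / (v * v)) + - (rowsum v - / (v * v))) by ring.
    eapply Rle_trans; [apply Cmod_triangle|]. rewrite Cmod_opp. lra. }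
  destruct HB as [M HM].
  assert (HM0 : (0 <= M)%R).
  { eapply Rle_trans; [apply Cmod_ge_0|apply (HM z Hz)]. }
  assert (Hn : forall n z, ~ isZ z -> (Cmod (csc2 z - rowsum z) <= M * (/ 2) ^ n)%R).
  { intros n. induction n as [|n IH]; intros u Hu.
    - rewrite pow_O, Rmult_1_r. now apply HM.
    - assert (E : csc2 u - rowsum u = / 4 * ((csc2 (u / 2) - rowsum (u / 2)) +
        (csc2 (u / 2 + / 2) - rowsum (u / 2 + / 2)))).
      { pose proof (csc2_dup u Hu) as Ec. pose proof (rowsum_dup u Hu) as Er.
        replace ((csc2 (u / 2) - rowsum (u / 2)) + (csc2 (u / 2 + / 2) - rowsum (u / 2 + / 2)))
          with ((csc2 (u / 2) + csc2 (u / 2 + / 2)) - (rowsum (u / 2) + rowsum (u / 2 + / 2)))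
          by ring.
        rewrite Ec, Er. field. }
      rewrite E, Cmod_mult, Cmod_inv, Cmod_R, Rabs_pos_eq by (try apply RtoC_nz; lra).
      pose proof (IH _ (fun H => Hu (isZ_half _ H))) as B1.
      pose proof (IH _ (fun H => Hu (isZ_half_shift _ H))) as B2.
      pose proof (Cmod_triangle (csc2 (u / 2) - rowsum (u / 2))
        (csc2 (u / 2 + / 2) - rowsum (u / 2 + / 2))) as Ht.
      rewrite <- tech_pow_Rmult. lra. }
  apply Cmod_eq_0. destruct (Rle_lt_or_eq_dec 0 _ (Cmod_ge_0 (csc2 z - rowsum z))) as [Hl|He];
    [|now symmetry].
  exfalso. destruct (pow_lt_1_zero (/ 2) ltac:(rewrite Rabs_pos_eq; lra)
    (Cmod (csc2 z - rowsum z) / (M + 1))) as [N HN]; [apply Rdiv_lt_0_compat; lra|].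
  specialize (HN N (le_n _)). rewrite Rabs_pos_eq in HN by (apply pow_le; lra).
  specialize (Hn N z Hz).
  assert (Hlt : (M * (/ 2) ^ N < Cmod (csc2 z - rowsum z))%R); [|lra].
  apply Rle_lt_trans with ((M + 1) * (/ 2) ^ N)%R.
  - apply Rmult_le_compat_r; [apply pow_le|]; lra.
  - replace (Cmod (csc2 z - rowsum z)) with
      ((M + 1) * (Cmod (csc2 z - rowsum z) / (M + 1)))%R by (field; lra).
    apply Rmult_lt_compat_l; lra.
Qed.

(** * Sums over the lattice *)

Lemma is_set_sum_unique A g l l' : is_set_sum A g l -> is_set_sum A g l' -> l = l'.
Proof.
  intros H H'. apply Cmod_lt_eq; intros eps He.
  destruct (H (eps / 2)%R ltac:(lra)) as (F & HF & HFs).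
  destruct (H' (eps / 2)%R ltac:(lra)) as (F' & HF' & HFs').
  assert (HA : List.Forall A (union F F')).
  { apply Forall_forall. intros x Hx. apply nodup_In, in_app_or in Hx.
    rewrite Forall_forall in HF, HF'. destruct Hx; auto. }
  specialize (HFs _ (union_NoDup F F') HA (union_incl_l F F')).
  specialize (HFs' _ (union_NoDup F F') HA (union_incl_r F F')).
  set (s := finite_sum g (union F F')) in *.
  replace (l - l') with (- (s - l) + (s - l')) by ring.
  eapply Rle_lt_trans; [apply Cmod_triangle|]. rewrite Cmod_opp; lra.
Qed.

Lemma set_sum_eq A g l : is_set_sum A g l -> set_sum A g = l.
Proof.
  intros H. apply (is_set_sum_unique A g); [|exact H].
  unfold set_sum. apply epsilon_spec. now exists l.
Qed.

Lemma is_set_sum_scale (A A' : C -> Prop) (g g' : C -> C) (j k l : C) :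
  j <> 0 -> (forall w, A' w <-> A (j * w)) -> (forall w, A' w -> g' w = k * g (j * w)) ->
  is_set_sum A g l -> is_set_sum A' g' (k * l).
Proof.
  intros Hj HA Hg H eps He. pose proof (Cmod_ge_0 k) as Hk.
  destruct (H (eps / (Cmod k + 1))%R) as (F0 & HF0 & HFs).
  { apply Rdiv_lt_0_compat; lra. }
  exists (map (Cmult (/ j)) F0). split.
  - apply Forall_forall. intros x Hx. apply in_map_iff in Hx. destruct Hx as (w & <- & Hw).
    apply HA. replace (j * (/ j * w)) with w by (field; auto).
    rewrite Forall_forall in HF0. now apply HF0.
  - intros F HN HF Hi. rewrite Forall_forall in HF.
    specialize (HFs (map (Cmult j) F)).
    assert (E : finite_sum g' F = k * finite_sum g (map (Cmult j) F)).
    { change (lsum g' F = k * lsum g (map (Cmult j) F)).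
      rewrite lsum_map, <- lsum_scal. apply lsum_ext. intros w Hw. now apply Hg, HF. }
    rewrite E.
    replace (k * finite_sum g (map (Cmult j) F) - k * l) with
      (k * (finite_sum g (map (Cmult j) F) - l)) by ring.
    rewrite Cmod_mult.
    assert (Hd : (Cmod (finite_sum g (map (Cmult j) F) - l) < eps / (Cmod k + 1))%R).
    { apply HFs.
      - apply FinFun.Injective_map_NoDup; [|exact HN]. intros a b Eab.
        replace a with (/ j * (j * a)) by (field; auto). rewrite Eab. field; auto.
      - apply Forall_forall. intros x Hx. apply in_map_iff in Hx.
        destruct Hx as (w & <- & Hw). now apply HA, HF.
      - intros x Hx. apply in_map_iff. exists (/ j * x). split; [field; auto|].
        apply Hi. apply in_map_iff. now exists x. }
    set (d := Cmod (finite_sum g (map (Cmult j) F) - l)) in *.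
    assert (0 <= d)%R by apply Cmod_ge_0.
    apply Rle_lt_trans with ((Cmod k + 1) * d)%R; [nra|].
    replace eps with ((Cmod k + 1) * (eps / (Cmod k + 1)))%R by (field; lra).
    apply Rmult_lt_compat_l; lra.
Qed.

(** The coefficient of tau comes first, so that fixing the first index selects a row of the
    lattice. *)
Definition lat (tau : C) (p : Z * Z) : C := IZC (snd p) + IZC (fst p) * tau.

Lemma Im_lat tau p : Im (lat tau p) = (IZR (fst p) * Im tau)%R.
Proof. unfold lat, IZC. destruct tau; cbn. ring. Qed.

Lemma lat_inj tau p p' : UHP tau -> lat tau p = lat tau p' -> p = p'.
Proof.
  unfold UHP. intros Ht E. pose proof (f_equal Im E) as EI. rewrite !Im_lat in EI.
  assert (E1 : fst p = fst p') by (apply eq_IZR; nra).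
  unfold lat in E. rewrite E1 in E.
  assert (E2 : IZC (snd p) = IZC (snd p')).
  { replace (IZC (snd p)) with (IZC (snd p) + IZC (fst p') * tau - IZC (fst p') * tau) by ring.
    rewrite E. ring. }
  apply IZC_inj in E2. destruct p, p'; cbn in *; congruence.
Qed.

Lemma lat_0 tau : lat tau (0%Z, 0%Z) = 0.
Proof. unfold lat, IZC. cbn [fst snd]. ring. Qed.

(** The imaginary part bounds the coefficient of tau by |w| / Im tau; removing that multiple of tau
    from w then bounds the other coordinate, which explains the constant. *)
Lemma lat_bound tau : UHP tau -> exists A, (0 < A)%R /\ forall p,
  (Rabs (IZR (fst p)) <= A * Cmod (lat tau p))%R /\
  (Rabs (IZR (snd p)) <= A * Cmod (lat tau p))%R.
Proof.
  unfold UHP. intros Ht. pose proof (Cmod_ge_0 tau) as Hm.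
  assert (Hi : (0 < / Im tau)%R) by now apply Rinv_0_lt_compat.
  assert (Hmi : (0 <= Cmod tau * / Im tau)%R) by (apply Rmult_le_pos; lra).
  exists (/ Im tau + 1 + Cmod tau * / Im tau)%R. split; [lra|]. intros p.
  pose proof (Cmod_ge_0 (lat tau p)) as Hw.
  assert (H1 : (Rabs (IZR (fst p)) <= / Im tau * Cmod (lat tau p))%R).
  { apply Rmult_le_reg_r with (Im tau); [exact Ht|].
    replace (/ Im tau * Cmod (lat tau p) * Im tau)%R with (Cmod (lat tau p)) by (field; lra).
    rewrite <- (Rabs_pos_eq (Im tau)) by lra. rewrite <- Rabs_mult, <- Im_lat.
    eapply Rle_trans; [|apply Rmax_Cmod]. apply Rmax_r. }
  split; [nra|].
  assert (E : IZC (snd p) = lat tau p + - (IZC (fst p) * tau)) by (unfold lat; ring).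
  rewrite <- Cmod_R. fold (IZC (snd p)). rewrite E.
  eapply Rle_trans; [apply Cmod_triangle|].
  rewrite Cmod_opp, Cmod_mult. unfold IZC at 1. rewrite Cmod_R.
  assert (Rabs (IZR (fst p)) * Cmod tau <= / Im tau * Cmod (lat tau p) * Cmod tau)%R by
    (apply Rmult_le_compat_r; lra).
  assert (0 <= / Im tau * Cmod (lat tau p))%R by (apply Rmult_le_pos; lra).
  replace ((/ Im tau + 1 + Cmod tau * / Im tau) * Cmod (lat tau p))%R with
    (Cmod (lat tau p) + / Im tau * Cmod (lat tau p)
      + / Im tau * Cmod (lat tau p) * Cmod tau)%R by ring.
  lra.
Qed.

(** Giving the origin the term 0, instead of excluding it, keeps the index set a product, as
    summation by rows requires. *)
Definition lat_term (tau z : C) (p : Z * Z) : C :=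
  if edec p (0%Z, 0%Z) then 0 else / (z - lat tau p) ^ 2 - / lat tau p ^ 2.

Definition boxZ (N : nat) : list Z := map (fun k => Z.of_nat k - Z.of_nat N)%Z (seq 0 (2 * N + 1)).

Lemma in_boxZ N n : (Z.abs n <= Z.of_nat N)%Z -> In n (boxZ N).
Proof.
  intros H. apply in_map_iff. exists (Z.to_nat (n + Z.of_nat N)). split; [lia|].
  apply in_seq. lia.
Qed.

Lemma wtZ_lower n X : (Rabs (IZR n) + 2 <= X)%R -> (/ (X * sqrt X) <= wtZ n)%R.
Proof.
  intros H. pose proof (Rabs_pos (IZR n)). unfold wtZ, wt.
  assert (E : (INR (Z.abs_nat n) = Rabs (IZR n))%R).
  { rewrite INR_IZR_INZ, Zabs2Nat.id_abs, abs_IZR. reflexivity. }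
  rewrite E. apply Rinv_le_contravar.
  - apply Rmult_lt_0_compat; [lra|]. apply sqrt_lt_R0; lra.
  - apply Rmult_le_compat; try lra; [apply sqrt_pos|]. apply sqrt_le_1; lra.
Qed.

(** Once |w| >= 2 |z|, a term is at most 10 |z| / |w|^3; as both coordinates of w are O(|w|), a
    product of two weights dominates it. *)
Lemma rbdd_lat_term tau z : UHP tau -> rbdd (fun p => Cmod (lat_term tau z p)).
Proof.
  intros Ht. destruct (lat_bound tau Ht) as (A & HA & HAp).
  pose proof (Cmod_ge_0 z) as Hz.
  (* A point with |w| < 2 |z| has both coordinates at most 2 A |z| <= N, hence lies in the finite
     box that is set aside. *)
  destruct (INR_unbounded (A * (2 * Cmod z))) as [N HN].
  apply rbdd_le_off with (fun p => (10 * Cmod z * (27 * (A * A * A))) * (wtZ (fst p) * wtZ (snd p)))%R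
    (list_prod (boxZ N) (boxZ N)).
  - intros p. repeat apply Rmult_le_pos; try lra; left; apply wtZ_pos.
  - intros p Hp. unfold lat_term. destruct (edec p (0%Z, 0%Z)) as [->|Hp0].
    { rewrite Cmod_0. repeat apply Rmult_le_pos; try lra; left; apply wtZ_pos. }
    destruct (HAp p) as [H1 H2].
    assert (Hw2 : (2 * Cmod z <= Cmod (lat tau p))%R).
    { apply Rnot_lt_le. intros Hlt. apply Hp. destruct p as [n m]. cbn in H1, H2.
      assert (Hb : (A * Cmod (lat tau (n, m)) <= INR N)%R).
      { apply Rle_trans with (A * (2 * Cmod z))%R; [apply Rmult_le_compat_l; lra|lra]. }
      rewrite INR_IZR_INZ in Hb.
      apply in_prod; apply in_boxZ; apply le_IZR; rewrite abs_IZR; lra. }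
    assert (Hone : (1 <= A * Cmod (lat tau p))%R).
    { destruct p as [n m]. cbn in H1, H2. destruct (Z.eq_dec n 0) as [->|Hn].
      - assert (Hm : (1 <= Z.abs m)%Z).
        { destruct (Z.eq_dec m 0) as [->|]; [now elim Hp0|lia]. }
        apply IZR_le in Hm. rewrite abs_IZR in Hm. lra.
      - assert (Hm : (1 <= Z.abs n)%Z) by lia. apply IZR_le in Hm. rewrite abs_IZR in Hm. lra. }
    set (w := lat tau p) in *.
    assert (Hw : (0 < Cmod w)%R) by nra.
    assert (Hw0 : w <> 0) by now apply Cmod_gt_0.
    assert (Hzw : (Cmod w / 2 <= Cmod (z - w))%R).
    { pose proof (Cmod_triangle (w - z) z) as Htr. replace (w - z + z) with w in Htr by ring.
      rewrite (Cmod_minus_sym w z) in Htr. lra. }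
    assert (Hzw0 : z - w <> 0) by (apply Cmod_gt_0; lra).
    assert (Hterm : (Cmod (/ (z - w) ^ 2 - / w ^ 2) <= 10 * Cmod z * / (Cmod w * Cmod w * Cmod w))%R).
    { replace (/ (z - w) ^ 2 - / w ^ 2) with
        (z * (2 * w - z) * (/ ((z - w) * (z - w)) * / (w * w))) by (field; auto).
      rewrite !Cmod_mult, !Cmod_inv, !Cmod_mult by now apply Cmult_neq_0.
      assert (B1 : (Cmod (2 * w - z) <= 5 / 2 * Cmod w)%R).
      { unfold Cminus. eapply Rle_trans; [apply Cmod_triangle|].
        rewrite Cmod_opp, Cmod_mult, Cmod_R, Rabs_pos_eq by lra. lra. }
      assert (B2 : (/ (Cmod (z - w) * Cmod (z - w)) <= 4 * / (Cmod w * Cmod w))%R).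
      { replace (4 * / (Cmod w * Cmod w))%R with (/ (Cmod w / 2 * (Cmod w / 2)))%R by (field; lra).
        apply Rinv_le_contravar; [apply Rmult_lt_0_compat; lra|].
        apply Rmult_le_compat; lra. }
      assert (B3 : (0 < / (Cmod w * Cmod w))%R) by
        (apply Rinv_0_lt_compat, Rmult_lt_0_compat; lra).
      assert (B4 : (0 < / (Cmod (z - w) * Cmod (z - w)))%R) by
        (apply Rinv_0_lt_compat, Rmult_lt_0_compat; lra).
      apply Rle_trans with (Cmod z * (5 / 2 * Cmod w) *
        (4 * / (Cmod w * Cmod w) * / (Cmod w * Cmod w)))%R.
      - apply Rmult_le_compat.
        + apply Rmult_le_pos; [lra|apply Cmod_ge_0].
        + apply Rmult_le_pos; lra.
        + apply Rmult_le_compat_l; lra.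
        + apply Rmult_le_compat_r; lra.
      - right. field. lra. }
    eapply Rle_trans; [exact Hterm|].
    replace (10 * Cmod z * (27 * (A * A * A)) * (wtZ (fst p) * wtZ (snd p)))%R with
      (10 * Cmod z * (27 * (A * A * A) * (wtZ (fst p) * wtZ (snd p))))%R by ring.
    apply Rmult_le_compat_l; [lra|].
    (* Since A |w| >= 1, both coordinates increased by 2 are at most 3 A |w|; the product of the two
       weights is then at least X^(-3), whence the constant 27 A^3. *)
    set (X := (3 * (A * Cmod w))%R). assert (HX : (0 < X)%R) by (unfold X; lra).
    pose proof (wtZ_lower (fst p) X ltac:(unfold X; lra)) as W1.
    pose proof (wtZ_lower (snd p) X ltac:(unfold X; lra)) as W2.
    assert (HsX : (0 < sqrt X)%R) by now apply sqrt_lt_R0.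
    assert (EsX : (sqrt X * sqrt X = X)%R) by (apply sqrt_sqrt; lra).
    assert (HXi : (0 < / (X * sqrt X))%R) by (apply Rinv_0_lt_compat, Rmult_lt_0_compat; lra).
    apply Rle_trans with (27 * (A * A * A) * (/ (X * sqrt X) * / (X * sqrt X)))%R.
    + right. rewrite <- Rinv_mult.
      replace (X * sqrt X * (X * sqrt X))%R with (X * X * (sqrt X * sqrt X))%R by ring.
      rewrite EsX. unfold X. field. lra.
    + apply Rmult_le_compat_l; [repeat apply Rmult_le_pos; lra|].
      apply Rmult_le_compat; lra.
  - apply rbdd_scal; [repeat apply Rmult_le_pos; lra|].
    apply rbdd_prod; try (intros; left; apply wtZ_pos); apply rbdd_wtZ.
Qed.

Lemma is_set_sum_lattice tau z l : UHP tau -> usum (lat_term tau z) l ->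
  is_set_sum (fun w => lattice tau w /\ w <> 0) (fun w => / (z - w) ^ 2 - / w ^ 2) l.
Proof.
  intros Ht H eps He. destruct (H eps He) as [F0 HF0].
  exists (map (lat tau) (filter (fun p => if edec p (0%Z, 0%Z) then false else true) F0)).
  split.
  - apply Forall_forall. intros x Hx. apply in_map_iff in Hx. destruct Hx as (p & <- & Hp).
    apply filter_In in Hp. destruct Hp as [_ Hp].
    destruct (edec p (0%Z, 0%Z)) as [|Hp0]; [discriminate|]. split.
    + exists (snd p), (fst p). reflexivity.
    + intros E. apply Hp0. apply (lat_inj tau); [exact Ht|]. now rewrite lat_0.
  - intros F HN HF Hi. rewrite Forall_forall in HF.
    destruct (preimage_list (lat tau) F (fun p p' => lat_inj tau p p' Ht) HN)
      as (F' & HN' & HF').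
    assert (Hp0 : ~ In (0%Z, 0%Z) F').
    { intros Hin. apply HF' in Hin. rewrite lat_0 in Hin. now apply HF in Hin. }
    assert (E : finite_sum (fun w => / (z - w) ^ 2 - / w ^ 2) F
      = lsum (lat_term tau z) ((0%Z, 0%Z) :: F')).
    { rewrite lsum_cons. unfold lat_term at 1. destruct (edec (0%Z, 0%Z) (0%Z, 0%Z)) as [_|Hn];
        [|now elim Hn]. rewrite Cplus_0_l.
      change (lsum (fun w => / (z - w) ^ 2 - / w ^ 2) F = lsum (lat_term tau z) F').
      rewrite (lsum_incl_zero _ (map (lat tau) F') F).
      - rewrite lsum_map. apply lsum_ext. intros p Hp. unfold lat_term.
        destruct (edec p (0%Z, 0%Z)) as [->|]; [contradiction|reflexivity].
      - apply FinFun.Injective_map_NoDup; [|exact HN']. intros p p'. now apply lat_inj.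
      - exact HN.
      - intros x Hx. apply in_map_iff in Hx. destruct Hx as (p & <- & Hp). now apply HF'.
      - intros x Hx Hnx. exfalso. apply Hnx. destruct (HF x Hx) as [(m & n & Ex) _].
        apply in_map_iff. exists (n, m). split; [now rewrite Ex|]. apply HF'.
        unfold lat. cbn [fst snd]. now rewrite <- Ex. }
    rewrite E. apply HF0.
    + now constructor.
    + intros p Hp. destruct (edec p (0%Z, 0%Z)) as [->|Hne]; [now left|right].
      apply HF', Hi, in_map, filter_In. split; [exact Hp|].
      now destruct (edec p (0%Z, 0%Z)).
Qed.

Lemma wp_tsum tau z : UHP tau ->
  wp (lattice tau) z = / z ^ 2 + tsum (lat_term tau z).
Proof.
  intros Ht. unfold wp. f_equal. apply set_sum_eq, is_set_sum_lattice; [exact Ht|].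
  apply asum_exists. now apply rbdd_lat_term.
Qed.

(** * Modular transformation *)

Lemma jfac_nz g tau : UHP tau -> jfac g tau <> 0.
Proof.
  unfold UHP. intros Ht E. pose proof (SL2Z_det g) as Hd. unfold jfac in E.
  pose proof (f_equal Im E) as EI. pose proof (f_equal Re E) as ER.
  destruct tau as [x y]. unfold IZC in *. cbn in *.
  assert (Hc : IZR (mc g) = 0%R) by nra. rewrite Hc in ER.
  assert (Hdd : IZR (md g) = 0%R) by lra.
  apply eq_IZR in Hc, Hdd. rewrite Hc, Hdd in Hd. lia.
Qed.

Lemma UHP_act g tau : UHP tau -> UHP (act g tau).
Proof.
  intros Ht. pose proof (jfac_nz g tau Ht) as Hj. unfold UHP in *.
  pose proof (SL2Z_det g) as Hd. apply (f_equal IZR) in Hd.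
  rewrite minus_IZR, !mult_IZR in Hd. unfold act.
  set (j := jfac g tau) in *.
  assert (Hm : (0 < Re j * Re j + Im j * Im j)%R).
  { apply Rnot_le_lt. intros Hle. apply Hj. destruct j as [u v]. cbn in Hle.
    apply injective_projections; cbn; nra. }
  assert (E : (Im ((IZC (ma g) * tau + IZC (mb g)) / j) =
    Im tau / (Re j * Re j + Im j * Im j))%R).
  { assert (EI : forall N d : C, (0 < Re d * Re d + Im d * Im d)%R ->
      (Im (N / d) = (Im N * Re d - Re N * Im d) / (Re d * Re d + Im d * Im d))%R).
    { intros [u v] [u' v'] Hd'. cbn in *. field. nra. }
    rewrite EI by exact Hm. f_equal. unfold j, jfac, IZC. destruct tau as [x y]. cbn.
    transitivity (y * (IZR (ma g) * IZR (md g) - IZR (mb g) * IZR (mc g)))%R; [ring|].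
    rewrite Hd. ring. }
  rewrite E. apply Rdiv_lt_0_compat; lra.
Qed.

Lemma lattice_act g tau w : UHP tau -> lattice (act g tau) w <-> lattice tau (jfac g tau * w).
Proof.
  intros Ht. pose proof (jfac_nz g tau Ht) as Hj.
  pose proof (SL2Z_det g) as Hd. apply (f_equal IZC) in Hd.
  unfold Z.sub in Hd. rewrite IZC_plus, IZC_opp, !IZC_mult in Hd.
  change (IZC 1) with (RtoC 1) in Hd. unfold act. split.
  - intros (m & n & ->). exists (m * md g + n * mb g)%Z, (m * mc g + n * ma g)%Z.
    rewrite !IZC_plus, !IZC_mult. unfold jfac in *. field. exact Hj.
  - intros (m & n & E).
    exists (m * ma g - n * mb g)%Z, (n * md g - m * mc g)%Z.
    unfold Z.sub. rewrite !IZC_plus, !IZC_opp, !IZC_mult.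
    replace w with (jfac g tau * w / jfac g tau) by (field; auto). rewrite E.
    unfold jfac in *.
    transitivity ((IZC (ma g) * IZC (md g) + - (IZC (mb g) * IZC (mc g))) *
      (IZC m + IZC n * tau) / (IZC (mc g) * tau + IZC (md g))).
    + rewrite Hd. field. auto.
    + field. auto.
Qed.

(** Homogeneity: w -> j w maps the lattice of gamma tau onto that of tau, and every term scales by
    j^2. *)
Lemma wp_act g tau (z : C) : UHP tau -> z <> 0 ->
  wp (lattice (act g tau)) z = jfac g tau ^ 2 * wp (lattice tau) (jfac g tau * z).
Proof.
  intros Ht Hz. pose proof (jfac_nz g tau Ht) as Hj. set (j := jfac g tau) in *.
  pose proof (asum_exists _ (rbdd_lat_term tau (j * z) Ht)) as [_ HU].
  apply is_set_sum_lattice in HU; [|exact Ht].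
  rewrite (wp_tsum tau) by exact Ht. unfold wp.
  rewrite (set_sum_eq _ _ (j ^ 2 * tsum (lat_term tau (j * z)))).
  - field. auto.
  - eapply is_set_sum_scale; [exact Hj| | |exact HU].
    + intros w. cbv beta. rewrite (lattice_act g tau w Ht). fold j. split.
      * intros [H1 H2]. split; [exact H1|]. now apply Cmult_neq_0.
      * intros [H1 H2]. split; [exact H1|]. intros ->. apply H2. ring.
    + intros w [_ Hw0]. cbv beta.
      (* z may itself be a lattice point. In the term with w = z the inverse of 0 is 0 on both
         sides, so the scaling persists. *)
      destruct (edec (z - w) 0) as [E|E].
      * apply Ceq_minus in E. subst w. replace (z - z) with (RtoC 0) by ring.
        replace (j * z - j * z) with (RtoC 0) by ring.
        assert (H0 : / RtoC 0 ^ 2 = 0).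
        { unfold Cinv, RtoC. apply injective_projections; cbn; unfold Rdiv; ring. }
        rewrite H0. field. auto.
      * replace (j * z - j * w) with (j * (z - w)) by ring. field. auto.
Qed.

(** * The row-summed form of the Weierstrass function *)

Definition Wsum (tau z : C) : C := tsum (fun n : Z => csc2 (z + IZC n * tau)).

(** The index (n, m) stands for row n + 1 and exponent m + 1 in w/(1 - w)^2 = sum of m w^m, with w =
    exp(2 pi i (n tau + z)) for the rows n >= 1. *)
Definition Uterm (tau z : C) (p : nat * nat) : C :=
  RtoC (INR (S (snd p))) *
  Cexp (RtoC (INR (S (snd p))) * (tpi * (RtoC (INR (S (fst p))) * tau + z))).

Definition Usum (tau z : C) : C := tsum (Uterm tau z).

Lemma Re_tpi z : Re (tpi * z) = (- (2 * PI * Im z))%R.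
Proof. unfold tpi, Ci, RtoC, Cmult, Re, Im. cbn. ring. Qed.

Lemma Re_scal_l (x : R) z : Re (RtoC x * z) = (x * Re z)%R.
Proof. destruct z; cbn; ring. Qed.

Lemma Im_scal_l (x : R) z : Im (RtoC x * z) = (x * Im z)%R.
Proof. destruct z; cbn; ring. Qed.

Lemma Im_plus z w : Im (z + w) = (Im z + Im w)%R.
Proof. reflexivity. Qed.

Lemma exp_neg_lt_1 x : (0 < x)%R -> (0 < exp (- x) < 1)%R.
Proof.
  intros Hx. split; [apply exp_pos|]. rewrite <- exp_0. apply exp_increasing. lra.
Qed.

Lemma exp_INR n x : (exp (INR n * x) = exp x ^ n)%R.
Proof.
  induction n as [|n IH]; [cbn; rewrite Rmult_0_l; apply exp_0|].
  rewrite S_INR, Rmult_plus_distr_r, Rmult_1_l, exp_plus, IH. cbn. ring.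
Qed.

(** With Q = exp(-y1) and r = exp(-(y1 + y2)) the exponential is Q^(n(m+1)) r^(m+1), and Q^(n(m+1))
    <= Q^n separates the two indices. *)
Lemma rbdd_Uterm_gen (j : nat) y1 y2 : (0 < y1)%R -> (0 < y1 + y2)%R ->
  rbdd (fun p : nat * nat => INR (S (snd p)) ^ j *
    exp (INR (S (snd p)) * - (INR (S (fst p)) * y1 + y2)))%R.
Proof.
  intros H1 H2.
  pose proof (exp_neg_lt_1 y1 H1) as HQ. pose proof (exp_neg_lt_1 _ H2) as Hr.
  set (Q := exp (- y1)) in *. set (r := exp (- (y1 + y2))) in *.
  assert (HG : rbdd (fun n => Q ^ n)%R) by (apply rbdd_geom; lra).
  assert (HM : rbdd (fun m => INR (S m) ^ j * r ^ S m)%R).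
  { apply (rbdd_comp S (fun m => INR m ^ j * r ^ m)%R); [intros; congruence|].
    apply rbdd_nat_pow_geom; lra. }
  assert (Hm0 : forall m, (0 <= INR (S m) ^ j * r ^ S m)%R).
  { intros m. apply Rmult_le_pos; [apply pow_le, pos_INR|apply pow_le; lra]. }
  eapply rbdd_le; [|apply (rbdd_prod _ _ (fun n => pow_le Q n ltac:(lra)) Hm0 HG HM)].
  intros [n m]. cbn [fst snd]. rewrite exp_INR.
  assert (E : (exp (- (INR (S n) * y1 + y2)) = Q ^ n * r)%R).
  { unfold Q, r. rewrite <- exp_INR, <- exp_plus. f_equal. rewrite S_INR. ring. }
  rewrite E, Rpow_mult_distr.
  assert (Hp : ((Q ^ n) ^ S m <= Q ^ n)%R).
  { rewrite <- tech_pow_Rmult. assert (0 <= Q ^ n)%R by (apply pow_le; lra).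
    assert ((Q ^ n) ^ m <= 1)%R.
    { rewrite <- (pow1 m). apply pow_incr. split; [lra|]. rewrite <- (pow1 n).
      apply pow_incr; lra. }
    apply Rle_trans with (Q ^ n * 1)%R; [apply Rmult_le_compat_l|]; lra. }
  replace (INR (S m) ^ j * ((Q ^ n) ^ S m * r ^ S m))%R with
    ((Q ^ n) ^ S m * (INR (S m) ^ j * r ^ S m))%R by ring.
  apply Rmult_le_compat_r; [apply Hm0|exact Hp].
Qed.

Lemma Cmod_Uterm tau z p : Cmod (Uterm tau z p) =
  (INR (S (snd p)) ^ 1 *
   exp (INR (S (snd p)) * - (INR (S (fst p)) * (2 * PI * Im tau) + 2 * PI * Im z)))%R.
Proof.
  unfold Uterm. rewrite Cmod_mult, Cmod_R, Rabs_pos_eq by apply pos_INR.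
  rewrite pow_1, Cmod_Cexp, Re_scal_l, Re_tpi, Im_plus, Im_scal_l. do 3 f_equal. ring.
Qed.

Lemma rbdd_Uterm tau z : UHP tau -> (0 < Im (tau + z))%R ->
  rbdd (fun p => Cmod (Uterm tau z p)).
Proof.
  unfold UHP. intros Ht Hz. rewrite Im_plus in Hz. pose proof PI_RGT_0.
  eapply rbdd_ext; [|apply (rbdd_Uterm_gen 1 (2 * PI * Im tau) (2 * PI * Im z))].
  - intros p. now rewrite Cmod_Uterm.
  - apply Rmult_lt_0_compat; lra.
  - replace (2 * PI * Im tau + 2 * PI * Im z)%R with (2 * PI * (Im tau + Im z))%R by ring.
    apply Rmult_lt_0_compat; lra.
Qed.

(** The Cauchy square of the geometric series, multiplied by w. *)
Lemma asum_deriv_geom (w : C) : (Cmod w < 1)%R ->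
  asum (fun m => RtoC (INR (S m)) * w ^ S m) (w / ((1 - w) * (1 - w))).
Proof.
  intros Hw.
  assert (HG : has_ps (fun h => / (1 - h)) (fun _ => 1) 1).
  { split; [lra|]. intros h Hh. eapply asum_ext; [|apply asum_geom, Hh].
    intros k; cbn beta; ring. }
  pose proof (has_ps_mult _ _ _ _ _ HG HG) as [_ H]. specialize (H w Hw).
  apply (asum_scal w) in H.
  assert (Hn : 1 - w <> 0).
  { intros E. apply Ceq_minus in E. rewrite <- E, Cmod_1 in Hw. lra. }
  replace (w / ((1 - w) * (1 - w))) with (w * (/ (1 - w) * / (1 - w))) by (field; auto).
  eapply asum_ext; [|exact H]. intros m; cbn beta.
  assert (cauchy (fun _ => 1) (fun _ => 1) m = RtoC (INR (S m))) as ->; [|rewrite Cpow_S; ring].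
  unfold cauchy. generalize (S m) as k. clear. intros k. generalize 0%nat as s.
  induction k as [|k IH]; intros s; [reflexivity|].
  cbn [seq]. rewrite lsum_cons, IH, S_INR, RtoC_plus. ring.
Qed.

Lemma Cmod_Cexp_tpi_lt z : (0 < Im z)%R -> (Cmod (Cexp (tpi * z)) < 1)%R.
Proof.
  intros Hz. rewrite Cmod_Cexp, Re_tpi. pose proof PI_RGT_0.
  apply exp_neg_lt_1. apply Rmult_lt_0_compat; lra.
Qed.

Lemma asum_csc2_exp z : (0 < Im z)%R ->
  asum (fun m => RtoC (INR (S m)) * Cexp (RtoC (INR (S m)) * (tpi * z))) (csc2 z / (tpi * tpi)).
Proof.
  intros Hz. pose proof (asum_deriv_geom _ (Cmod_Cexp_tpi_lt z Hz)) as H.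
  assert (Hn : 1 - Cexp (tpi * z) <> 0).
  { apply csc2_den_nz. intros [n ->]. cbn in Hz. lra. }
  replace (csc2 z / (tpi * tpi)) with
    (Cexp (tpi * z) / ((1 - Cexp (tpi * z)) * (1 - Cexp (tpi * z)))).
  - eapply asum_ext; [|exact H]. intros m; cbn beta. now rewrite Cexp_pow.
  - unfold csc2. pose proof tpi_nz. field. auto.
Qed.

Lemma asum_csc2_rows tau z : UHP tau -> (0 < Im (tau + z))%R ->
  asum (fun n => csc2 (RtoC (INR (S n)) * tau + z)) (tpi * tpi * Usum tau z).
Proof.
  intros Ht Hz. pose proof (asum_exists _ (rbdd_Uterm tau z Ht Hz)) as H.
  fold (Usum tau z) in H.
  apply (asum_fubini _ (fun n => csc2 (RtoC (INR (S n)) * tau + z) / (tpi * tpi))) in H.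
  - apply (asum_scal (tpi * tpi)) in H. eapply asum_ext; [|exact H].
    intros n; cbn beta. field. apply tpi_nz.
  - intros n.
    assert (Hn : (0 < Im (RtoC (INR (S n)) * tau + z))%R).
    { unfold UHP in Ht. rewrite Im_plus in *. rewrite Im_scal_l, S_INR.
      pose proof (pos_INR n). nra. }
    destruct (asum_csc2_exp _ Hn) as [_ HU]. exact HU.
Qed.

Lemma isZ_Im z : isZ z -> Im z = 0%R.
Proof. now intros [n ->]. Qed.

Lemma IZC_of_nat n : IZC (Z.of_nat n) = RtoC (INR n).
Proof. unfold IZC. now rewrite INR_IZR_INZ. Qed.

Lemma Im_opp z : Im (- z) = (- Im z)%R.
Proof. reflexivity. Qed.

(** Rows n >= 1 expand directly; rows n <= -1 become, by evenness of [csc2], the rows n >= 1 at -z.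
    The condition on Im z makes both expansions converge. *)
Lemma asum_Wsum_strip tau z : UHP tau -> (Rabs (Im z) < Im tau)%R ->
  asum (fun n : Z => csc2 (z + IZC n * tau))
    (csc2 z + tpi * tpi * (Usum tau z + Usum tau (- z))).
Proof.
  intros Ht Hz. apply Rabs_def2 in Hz.
  replace (csc2 z + tpi * tpi * (Usum tau z + Usum tau (- z))) with
    (csc2 (z + IZC 0 * tau) + tpi * tpi * Usum tau z + tpi * tpi * Usum tau (- z)).
  - apply (asum_Z_split (fun n : Z => csc2 (z + IZC n * tau))).
    + eapply asum_ext; [|apply asum_csc2_rows; [exact Ht|rewrite Im_plus; lra]].
      intros n; cbn beta. rewrite IZC_of_nat. f_equal; ring.
    + eapply asum_ext; [|apply asum_csc2_rows; [exact Ht|rewrite Im_plus, Im_opp; lra]].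
      intros n; cbn beta. rewrite IZC_opp, IZC_of_nat.
      rewrite <- csc2_even; [f_equal; ring|]. intros H. apply isZ_Im in H.
      rewrite Im_plus, Im_scal_l, Im_opp, S_INR in H. pose proof (pos_INR n).
      unfold UHP in Ht. nra.
  - replace (z + IZC 0 * tau) with z by (unfold IZC; ring). ring.
Qed.

Lemma asum_Wsum tau z : UHP tau -> asum (fun n : Z => csc2 (z + IZC n * tau)) (Wsum tau z).
Proof.
  intros Ht. destruct (exists_round (Im z / Im tau)) as [m Hm].
  assert (Hs : (Rabs (Im (z + IZC m * tau)) < Im tau)%R).
  { unfold UHP in Ht. rewrite Im_plus. unfold IZC. rewrite Im_scal_l.
    replace (Im z + IZR m * Im tau)%R with ((Im z / Im tau + IZR m) * Im tau)%R by (field; lra).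
    rewrite Rabs_mult, (Rabs_pos_eq (Im tau)) by lra. nra. }
  pose proof (asum_Wsum_strip tau _ Ht Hs) as H.
  set (l := csc2 _ + _) in H.
  enough (HU : asum (fun n : Z => csc2 (z + IZC n * tau)) l).
  { unfold Wsum. rewrite (tsum_eq _ _ (proj2 HU)). exact HU. }
  pose proof (asum_bij (fun n => n - m)%Z (fun n => n + m)%Z _ _
    ltac:(intros; cbv beta; lia) ltac:(intros; cbv beta; lia) H) as H'.
  eapply asum_ext; [|exact H']. intros n; cbn beta.
  unfold Z.sub. rewrite IZC_plus, IZC_opp. f_equal; ring.
Qed.

Lemma Wsum_strip tau z : UHP tau -> (Rabs (Im z) < Im tau)%R ->
  Wsum tau z = csc2 z + tpi * tpi * (Usum tau z + Usum tau (- z)).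
Proof. intros Ht Hz. apply tsum_eq. now apply asum_Wsum_strip. Qed.

Lemma Wsum_per tau z w : UHP tau -> lattice tau w -> Wsum tau (z + w) = Wsum tau z.
Proof.
  intros Ht (m & k & ->).
  eapply asum_unique; [apply asum_Wsum, Ht|].
  pose proof (asum_bij (fun n => n + k)%Z (fun n => n - k)%Z _ _
    ltac:(intros; cbv beta; lia) ltac:(intros; cbv beta; lia) (asum_Wsum tau z Ht)) as H'.
  eapply asum_ext; [|exact H']. intros n; cbn beta.
  rewrite IZC_plus.
  replace (z + (IZC m + IZC k * tau) + IZC n * tau) with
    (z + (IZC n + IZC k) * tau + IZC m) by ring.
  now rewrite csc2_per.
Qed.

Lemma lattice_plus tau z w : lattice tau z -> lattice tau w -> lattice tau (z + w).
Proof.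
  intros (m & n & ->) (m' & n' & ->). exists (m + m')%Z, (n + n')%Z.
  rewrite !IZC_plus. ring.
Qed.

Lemma lattice_opp tau z : lattice tau z -> lattice tau (- z).
Proof.
  intros (m & n & ->). exists (- m)%Z, (- n)%Z. rewrite !IZC_opp. ring.
Qed.

Lemma isZ_row tau z n : isZ (z + IZC n * tau) -> lattice tau z.
Proof.
  intros [m E]. exists m, (- n)%Z. rewrite IZC_opp, <- E. ring.
Qed.

Lemma Wsum_even tau z : UHP tau -> ~ lattice tau z -> Wsum tau (- z) = Wsum tau z.
Proof.
  intros Ht Hz. eapply asum_unique; [apply asum_Wsum, Ht|].
  pose proof (asum_bij (fun n => - n)%Z (fun n => - n)%Z _ _
    ltac:(intros; cbv beta; lia) ltac:(intros; cbv beta; lia) (asum_Wsum tau z Ht)) as H'.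
  eapply asum_ext; [|exact H']. intros n; cbn beta.
  rewrite <- csc2_even.
  - f_equal. rewrite IZC_opp. ring.
  - intros H. apply Hz, (isZ_row tau z (- n)), H.
Qed.

(** By partial fractions, row n of the Weierstrass series is csc2(z - n tau) - csc2(n tau). In row 0
    the origin carries no term, so 1/z^2 has to be taken off, and the subtracted part is Z0, the sum
    of 1/m^2 over m <> 0. *)
Lemma lat_term_rows tau : UHP tau -> exists Z0 : C,
  forall z, ~ lattice tau z -> forall n : Z,
  usum (fun m => lat_term tau z (n, m))
    (csc2 (z + IZC (- n) * tau) - if Z.eq_dec n 0 then / z ^ 2 + Z0 else csc2 (IZC n * tau)).
Proof.
  intros Ht.
  set (zt := fun m : Z => if Z.eq_dec m 0 then RtoC 0 else / ((0 + IZC m) * (0 + IZC m))).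
  assert (HZ : asum zt (tsum zt)).
  { apply asum_exists. eapply rbdd_le; [|apply (rbdd_row 0)]. intros m. unfold zt.
    destruct (Z.eq_dec m 0); [rewrite Cmod_0; apply Cmod_ge_0|lra]. }
  exists (tsum zt). intros z Hz n.
  assert (Hrow : asum (fun m => / ((- (z + IZC (- n) * tau) + IZC m) * (- (z + IZC (- n) * tau) + IZC m)))
     (csc2 (z + IZC (- n) * tau))).
  { assert (Hnz : ~ isZ (z + IZC (- n) * tau)) by (intros H; now apply Hz, (isZ_row tau z (- n))).
    rewrite <- csc2_even by exact Hnz. apply lipschitz. now rewrite isZ_opp. }
  assert (Hsub : forall m, / ((- (z + IZC (- n) * tau) + IZC m) * (- (z + IZC (- n) * tau) + IZC m))
    = / (z - lat tau (n, m)) ^ 2).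
  { intros m. f_equal. unfold lat. cbn [fst snd Cpow]. rewrite IZC_opp. ring. }
  destruct (Z.eq_dec n 0) as [->|Hn].
  - pose proof (asum_single (fun m => if Z.eq_dec m 0 then / z ^ 2 else 0) 0%Z) as H0.
    cbv beta in H0. destruct (Z.eq_dec 0 0) as [_|]; [|congruence].
    assert (H0' : asum (fun m => if Z.eq_dec m 0 then / z ^ 2 else 0) (/ z ^ 2)).
    { apply H0. intros m Hm. now destruct (Z.eq_dec m 0). }
    pose proof (asum_plus _ _ _ _ Hrow (asum_scal (- (1)) _ _ (asum_plus _ _ _ _ H0' HZ))) as HS.
    replace (csc2 (z + IZC (- 0) * tau) - (/ z ^ 2 + tsum zt)) with
      (csc2 (z + IZC (- 0) * tau) + - (1) * (/ z ^ 2 + tsum zt)) by ring.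
    eapply usum_ext; [|apply HS]. intros m; cbn beta. rewrite Hsub.
    unfold lat_term, zt. destruct (edec (0%Z, m) (0%Z, 0%Z)) as [E|E].
    + injection E as ->. destruct (Z.eq_dec 0 0) as [_|]; [|congruence].
      rewrite lat_0. replace (z - 0) with z by ring. ring.
    + destruct (Z.eq_dec m 0) as [->|]; [congruence|].
      assert (lat tau (0%Z, m) ^ 2 = (0 + IZC m) * (0 + IZC m)) as ->.
      { unfold lat. cbn [fst snd Cpow]. unfold IZC. ring. }
      ring.
  - assert (Hrow2 : asum (fun m => / ((IZC n * tau + IZC m) * (IZC n * tau + IZC m)))
      (csc2 (IZC n * tau))).
    { apply lipschitz. intros H. apply isZ_Im in H. unfold IZC in H. rewrite Im_scal_l in H.
      unfold UHP in Ht. apply Rmult_integral in H. destruct H as [H|H]; [|lra].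
      apply eq_IZR in H. congruence. }
    pose proof (asum_plus _ _ _ _ Hrow (asum_scal (- (1)) _ _ Hrow2)) as HS.
    replace (csc2 (z + IZC (- n) * tau) - csc2 (IZC n * tau)) with
      (csc2 (z + IZC (- n) * tau) + - (1) * csc2 (IZC n * tau)) by ring.
    eapply usum_ext; [|apply HS]. intros m; cbn beta. rewrite Hsub.
    unfold lat_term. destruct (edec (n, m) (0%Z, 0%Z)) as [E|E]; [congruence|].
    assert (lat tau (n, m) ^ 2 = (IZC n * tau + IZC m) * (IZC n * tau + IZC m)) as ->.
    { unfold lat. cbn [fst snd Cpow]. ring. }
    ring.
Qed.

Lemma wp_Wsum tau : UHP tau -> exists K : C,
  forall z, ~ lattice tau z -> wp (lattice tau) z = Wsum tau z - K.
Proof.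
  intros Ht. destruct (lat_term_rows tau Ht) as [Z0 HZ0].
  set (k := fun n : Z => if Z.eq_dec n 0 then Z0 else csc2 (IZC n * tau)).
  exists (tsum k). intros z Hz. rewrite wp_tsum by exact Ht.
  pose proof (asum_exists _ (rbdd_lat_term tau z Ht)) as HA.
  apply (asum_fubini _ _ _ (HZ0 z Hz)) in HA.
  pose proof (asum_bij (fun n => - n)%Z (fun n => - n)%Z _ _
    ltac:(intros; cbv beta; lia) ltac:(intros; cbv beta; lia) (asum_Wsum tau z Ht)) as HW.
  pose proof (asum_single (fun m => if Z.eq_dec m 0 then / z ^ 2 else 0) 0%Z) as H0.
  cbv beta in H0. destruct (Z.eq_dec 0 0) as [_|]; [|congruence].
  assert (H0' : asum (fun m => if Z.eq_dec m 0 then / z ^ 2 else 0) (/ z ^ 2)).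
  { apply H0. intros m Hm. now destruct (Z.eq_dec m 0). }
  pose proof (asum_plus _ _ _ _ HW (asum_scal (- (1)) _ _ (asum_plus _ _ _ _ H0' HA))) as HS.
  (* The constant is defined without z; for each z its convergence and value are read off from three
     sums already known. *)
  assert (E : tsum k = Wsum tau z + - (1) * (/ z ^ 2 + tsum (lat_term tau z))).
  { apply tsum_eq. eapply usum_ext; [|apply HS]. intros n; cbn beta. unfold k.
    destruct (Z.eq_dec n 0) as [->|Hn]; ring. }
  rewrite E. ring.
Qed.

(** * Maximum principle, identity theorem and Liouville's theorem *)

Lemma has_ps_shift_n n phi (c : nat -> C) r :
  has_ps phi c r -> (forall k, (k < n)%nat -> c k = 0) ->
  exists psi, has_ps psi (fun k => c (n + k)%nat) r /\
    forall h, (Cmod h < r)%R -> phi h = h ^ n * psi h.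
Proof.
  revert phi c. induction n as [|n IH]; intros phi c HP Hc.
  - exists phi. split; [exact HP|]. intros h _. cbn; ring.
  - destruct (has_ps_shift _ _ _ HP) as (phi1 & H1 & E1).
    destruct (IH phi1 _ H1) as (psi & H2 & E2).
    { intros k Hk. apply Hc. lia. }
    exists psi. split; [exact H2|]. intros h Hh.
    rewrite E1, E2, (Hc 0%nat) by (auto; lia). rewrite Cpow_S. ring.
Qed.

Lemma unit_root (m : nat) (w : C) : (0 < m)%nat ->
  exists u, Cmod u = 1%R /\ u ^ m * w = RtoC (Cmod w).
Proof.
  intros Hm. destruct (polar w) as [t Ht].
  exists (Cexp (- (Ci * RtoC (t / INR m)))). split.
  - rewrite Cmod_Cexp. replace (Re (- (Ci * RtoC (t / INR m)))) with 0%R by (cbn; ring).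
    apply exp_0.
  - rewrite Ht at 1. rewrite Cexp_pow.
    replace (RtoC (INR m) * - (Ci * RtoC (t / INR m))) with (- (Ci * RtoC t)).
    + rewrite Cexp_inv. field. apply Cexp_nz.
    + assert (INR m <> 0%R) by (apply not_0_INR; lia).
      rewrite RtoC_div by assumption. field. now apply RtoC_nz.
Qed.

(* If [c m] is the first nonzero coefficient with [m > 0], moving in a direction [u]
   such that [u ^ m * c m] is a positive multiple of [c 0] increases the modulus. *)
Lemma max_principle phi (c : nat -> C) r s : has_ps phi c r -> (0 < s)%R ->
  (forall h, (Cmod h < s)%R -> (Cmod (phi h) <= Cmod (phi 0))%R) ->
  forall h, (Cmod h < r)%R -> phi h = phi 0.
Proof.
  intros HP Hs Hmax. pose proof (has_ps_at0 _ _ _ HP) as E0.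
  assert (Hc : forall m, (0 < m)%nat -> c m = 0).
  { destruct (edec (c 0%nat) 0) as [Hc0|Hc0].
    { intros m _. apply (has_ps_zero _ _ _ HP). intros e He.
      exists (RtoC (Rmin e s / 2)). rmins.
      assert (0 < Rmin e s)%R by (apply Rmin_glb_lt; lra).
      rewrite Cmod_R, Rabs_pos_eq by lra. split; [lra|].
      apply Cmod_eq_0, Rle_antisym; [|apply Cmod_ge_0].
      specialize (Hmax (RtoC (Rmin e s / 2))). rewrite E0, Hc0, Cmod_0 in Hmax.
      apply Hmax. rewrite Cmod_R, Rabs_pos_eq; lra. }
    intros m. induction m as [m IH] using lt_wf_ind. intros Hm.
    destruct (edec (c m) 0) as [|Hcm]; [assumption|exfalso].
    destruct (has_ps_shift _ _ _ HP) as (phi1 & H1 & E1).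
    destruct (has_ps_shift_n (m - 1) _ _ _ H1) as (psi & H2 & E2).
    { intros k Hk. apply IH; lia. }
    pose proof (has_ps_at0 _ _ _ H2) as Epsi. cbv beta in Epsi.
    replace (S (m - 1 + 0)) with m in Epsi by lia.
    assert (Hpsi : an psi) by (eexists _, _; exact H2).
    destruct (an_continuous _ Hpsi (Cmod (c m))) as (d & Hd & Hcont).
    { now apply Cmod_gt_0. }
    destruct (unit_root m (c m / c 0%nat) Hm) as (u & Hu & Eu).
    set (t := (Rmin (Rmin r s) d / 2)%R).
    assert (Ht : (0 < t /\ t < r /\ t < s /\ t < d)%R).
    { unfold t. rmins. pose proof (proj1 HP).
      assert (0 < Rmin (Rmin r s) d)%R by (repeat apply Rmin_glb_lt; lra). lra. }
    set (h := RtoC t * u).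
    assert (Hh : Cmod h = t).
    { unfold h. rewrite Cmod_mult, Hu, Cmod_R, Rabs_pos_eq; lra. }
    specialize (Hmax h ltac:(lra)). rewrite E0 in Hmax.
    specialize (Hcont h ltac:(lra)). rewrite Epsi in Hcont.
    rewrite E1, E2 in Hmax by lra.
    set (a := (t ^ m)%R). assert (Ha : (0 < a)%R) by (apply pow_lt; lra).
    assert (Ehm : h * (h ^ (m - 1) * psi h) = h ^ m * psi h).
    { replace m with (S (m - 1)) at 2 by lia. rewrite Cpow_S. ring. }
    rewrite Ehm in Hmax.
    assert (Ehc : h ^ m * c m = RtoC (a * (Cmod (c m) / Cmod (c 0%nat))) * c 0%nat).
    { unfold h. rewrite Cpow_mult_l, <- RtoC_pow. fold a.
      replace (c m) with (c m / c 0%nat * c 0%nat) at 1 by (field; auto).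
      replace (RtoC a * u ^ m * (c m / c 0%nat * c 0%nat)) with
        (RtoC a * (u ^ m * (c m / c 0%nat)) * c 0%nat) by ring.
      rewrite Eu, Cmod_div by auto. rewrite RtoC_mult. ring. }
    pose proof (proj1 (Cmod_gt_0 _) Hc0) as Hc0'.
    assert (Hbig : Cmod (c 0%nat + h ^ m * c m) = (Cmod (c 0%nat) + a * Cmod (c m))%R).
    { rewrite Ehc.
      replace (c 0%nat + RtoC (a * (Cmod (c m) / Cmod (c 0%nat))) * c 0%nat) with
        (RtoC (1 + a * (Cmod (c m) / Cmod (c 0%nat))) * c 0%nat) by (rewrite RtoC_plus; ring).
      assert (0 <= Cmod (c m) / Cmod (c 0%nat))%R by
        (apply Rdiv_le_0_compat; [apply Cmod_ge_0|lra]).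
      rewrite Cmod_mult, Cmod_R, Rabs_pos_eq by nra. field. lra. }
    assert (Hsm : (Cmod (h ^ m * (psi h - c m)) < a * Cmod (c m))%R).
    { rewrite Cmod_mult, Cmod_pow, Hh. fold a. now apply Rmult_lt_compat_l. }
    pose proof (Cmod_triangle (c 0%nat + h ^ m * psi h) (- (h ^ m * (psi h - c m)))) as Htri.
    rewrite Cmod_opp in Htri.
    replace (c 0%nat + h ^ m * psi h + - (h ^ m * (psi h - c m))) with
      (c 0%nat + h ^ m * c m) in Htri by ring.
    lra. }
  intros h Hh. rewrite E0. eapply asum_unique; [apply HP, Hh|].
  eapply asum_ext; [|apply (has_ps_const (c 0%nat) _ (proj1 HP)), Hh].
  intros [|k]; cbn beta iota; [reflexivity|]. rewrite (Hc (S k)) by lia. reflexivity.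
Qed.

(* The set of parameters up to which [F] is locally constant is open and closed. *)
Lemma const_along F p d A :
  (forall t, (0 <= t <= 1)%R -> an (fun h => F (p + RtoC t * d + h))) ->
  (exists r, (0 < r)%R /\ forall h, (Cmod h < r)%R -> F (p + h) = A) ->
  F (p + d) = A.
Proof.
  intros Han H0.
  destruct (edec d 0) as [->|Hd].
  { destruct H0 as (r & Hr & H0). apply H0. now rewrite Cmod_0. }
  assert (Hd' : (0 < Cmod d)%R) by now apply Cmod_gt_0.
  set (P := fun t => exists r, (0 < r)%R /\
    forall h, (Cmod h < r)%R -> F (p + RtoC t * d + h) = A).
  assert (P0 : P 0%R).
  { destruct H0 as (r & Hr & H0). exists r. split; [exact Hr|]. intros h Hh.
    rewrite Cmult_0_l, Cplus_0_r. now apply H0. }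
  set (E := fun t => (0 <= t <= 1)%R /\ forall s, (0 <= s <= t)%R -> P s).
  destruct (completeness E) as [T [Hub Hlub]].
  { exists 1%R. intros t [Ht _]. lra. }
  { exists 0%R. split; [lra|]. intros s Hs. now replace s with 0%R by lra. }
  assert (HE0 : E 0%R).
  { split; [lra|]. intros s Hs. now replace s with 0%R by lra. }
  assert (HT : (0 <= T <= 1)%R).
  { split; [now apply Hub|]. apply Hlub. intros t [Ht _]. lra. }
  assert (Hbelow : forall s, (0 <= s < T)%R -> P s).
  { intros s Hs. destruct (excluded_middle_informative (exists t, E t /\ (s < t)%R))
      as [(t & [Ht HEt] & Hst)|Hno].
    - apply HEt. lra.
    - exfalso. assert (T <= s)%R; [|lra]. apply Hlub. intros t Ht. apply Rnot_lt_le.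
      intros Hlt. apply Hno. now exists t. }
  assert (PT : P T).
  { destruct (Req_dec T 0) as [->|HT0]; [exact P0|].
    assert (Hphi : an (fun h => F (p + RtoC T * d + h) - A)).
    { apply an_minus; [apply Han, HT|apply an_const]. }
    destruct (an_zero _ Hphi) as (r & Hr & Hz).
    { intros e He. set (dl := Rmin (T / 2) (e / (2 * Cmod d))).
      assert (Hdl : (0 < dl)%R).
      { apply Rmin_glb_lt; [lra|]. apply Rdiv_lt_0_compat; lra. }
      pose proof (Rmin_l (T / 2) (e / (2 * Cmod d))) as M1.
      pose proof (Rmin_r (T / 2) (e / (2 * Cmod d))) as M2. fold dl in M1, M2.
      exists (RtoC (- dl) * d). rewrite Cmod_mult, Cmod_R, Rabs_Ropp, Rabs_pos_eq by lra.
      split; [split|].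
      - now apply Rmult_lt_0_compat.
      - apply Rle_lt_trans with (e / (2 * Cmod d) * Cmod d)%R.
        + apply Rmult_le_compat_r; lra.
        + replace (e / (2 * Cmod d) * Cmod d)%R with (e / 2)%R by (field; lra). lra.
      - destruct (Hbelow (T - dl)%R ltac:(lra)) as (r & Hr & Hs).
        specialize (Hs 0). rewrite Cmod_0 in Hs. specialize (Hs Hr).
        replace (p + RtoC T * d + RtoC (- dl) * d) with (p + RtoC (T - dl) * d + 0).
        + rewrite Hs. ring.
        + rewrite RtoC_minus, RtoC_opp. ring. }
    exists r. split; [exact Hr|]. intros h Hh. specialize (Hz h Hh). cbv beta in Hz.
    now apply Ceq_minus. }
  destruct (Req_dec T 1) as [->|HT1].
  { destruct PT as (r & Hr & Hz). specialize (Hz 0). rewrite Cmod_0 in Hz.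
    specialize (Hz Hr). now rewrite Cmult_1_l, Cplus_0_r in Hz. }
  exfalso. destruct PT as (r & Hr & Hz).
  set (dl := Rmin ((1 - T) / 2) (r / (4 * Cmod d))).
  assert (Hdl : (0 < dl)%R).
  { apply Rmin_glb_lt; [lra|]. apply Rdiv_lt_0_compat; lra. }
  pose proof (Rmin_l ((1 - T) / 2) (r / (4 * Cmod d))) as M1.
  pose proof (Rmin_r ((1 - T) / 2) (r / (4 * Cmod d))) as M2. fold dl in M1, M2.
  assert (HEdl : E (T + dl)%R); [|specialize (Hub _ HEdl); lra].
  split; [lra|]. intros s Hs. destruct (Rlt_le_dec s T) as [Hlt|Hge]; [apply Hbelow; lra|].
  exists (r / 2)%R. split; [lra|]. intros h Hh.
  replace (p + RtoC s * d + h) with (p + RtoC T * d + (RtoC (s - T) * d + h)) by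
    (rewrite RtoC_minus; ring).
  apply Hz. eapply Rle_lt_trans; [apply Cmod_triangle|].
  rewrite Cmod_mult, Cmod_R, Rabs_pos_eq by lra.
  assert ((s - T) * Cmod d <= r / (4 * Cmod d) * Cmod d)%R.
  { apply Rmult_le_compat_r; lra. }
  replace (r / (4 * Cmod d) * Cmod d)%R with (r / 4)%R in H by (field; lra). lra.
Qed.

(** All values occur on a compact rectangle, so |G| has a finite supremum M. If M is attained, G is
    locally constant there by the maximum principle, and constant by continuation along segments.
    Otherwise 1/(M - |G|) is bounded on the rectangle by some K, and |G| <= M - 1/K everywhere
    contradicts the choice of M. *)
Lemma liouville G a b a' b' :
  (forall p, an (fun h => G (p + h))) ->
  (forall p, exists p', (a <= Re p' <= b)%R /\ (a' <= Im p' <= b')%R /\ G p' = G p) ->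
  forall z w, G z = G w.
Proof.
  intros Han Hred.
  destruct (box_bounded (fun _ => True) (fun z => Cmod (G z)) a b a' b') as [B HB].
  { intros p _ _. destruct (an_locally_bounded _ (Han p)) as (r & M & Hr & HM).
    exists r, M. split; [exact Hr|]. intros z _ Hz. specialize (HM _ Hz). cbv beta in HM.
    now replace (p + (z - p)) with z in HM by ring. }
  destruct (completeness (fun x => exists z, x = Cmod (G z))) as [M [Hub Hlub]].
  { exists B. intros x [z ->]. destruct (Hred z) as (p' & H1 & H2 & <-). now apply HB. }
  { now exists (Cmod (G 0)), 0. }
  assert (HM : forall z, (Cmod (G z) <= M)%R) by (intros z; apply Hub; now exists z).
  destruct (excluded_middle_informative (exists p, Cmod (G p) = M)) as [[p Hp]|Hno].
  - assert (Hc : forall z, G z = G p).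
    { intros z. replace z with (p + (z - p)) by ring. apply const_along.
      - intros t _. apply Han.
      - destruct (Han p) as (c & r & HP). exists r. split; [apply HP|]. intros h Hh.
        rewrite <- (Cplus_0_r p) at 2.
        apply (max_principle _ _ _ r HP (proj1 HP)); [|exact Hh].
        intros h' _. rewrite Cplus_0_r, Hp. apply HM. }
    intros z w. now rewrite (Hc z), (Hc w).
  - exfalso.
    assert (Hlt : forall z, (Cmod (G z) < M)%R).
    { intros z. destruct (Rle_lt_or_eq_dec _ _ (HM z)) as [|E]; [assumption|].
      elim Hno. now exists z. }
    destruct (box_bounded (fun _ => True) (fun z => / (M - Cmod (G z)))%R a b a' b') as [K HK].
    { intros p _ _. specialize (Hlt p).
      destruct (an_continuous _ (Han p) ((M - Cmod (G p)) / 2)%R) as (d & Hd & Hc); [lra|].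
      exists d, (/ ((M - Cmod (G p)) / 2))%R. split; [exact Hd|]. intros z _ Hz.
      specialize (Hc _ Hz). cbv beta in Hc.
      replace (p + (z - p)) with z in Hc by ring. rewrite Cplus_0_r in Hc.
      pose proof (Cmod_triangle (G z - G p) (G p)) as Ht.
      replace (G z - G p + G p) with (G z) in Ht by ring.
      apply Rinv_le_contravar; lra. }
    assert (HKp : (0 < K)%R).
    { destruct (Hred 0) as (p' & H1 & H2 & _). specialize (HK p' H1 H2 Logic.I).
      specialize (Hlt p'). assert (0 < / (M - Cmod (G p')))%R by (apply Rinv_0_lt_compat; lra).
      lra. }
    assert (M <= M - / K)%R.
    { apply Hlub. intros x [z ->]. destruct (Hred z) as (p' & H1 & H2 & <-).
      specialize (HK p' H1 H2 Logic.I). specialize (Hlt p').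
      assert (Hi : (/ K <= M - Cmod (G p'))%R); [|lra].
      rewrite <- (Rinv_inv (M - Cmod (G p'))).
      apply Rinv_le_contravar; [apply Rinv_0_lt_compat; lra|exact HK]. }
    assert (0 < / K)%R by now apply Rinv_0_lt_compat. lra.
Qed.

(** Germs form an integral domain: either the zeros of [phi] accumulate at 0, or [psi] vanishes at
    points arbitrarily close to 0. *)
Lemma an_mult_zero phi psi : an phi -> an psi ->
  (exists r, (0 < r)%R /\ forall h, (0 < Cmod h < r)%R -> phi h * psi h = 0) ->
  (exists r, (0 < r)%R /\ forall h, (Cmod h < r)%R -> phi h = 0) \/
  (exists r, (0 < r)%R /\ forall h, (Cmod h < r)%R -> psi h = 0).
Proof.
  intros H1 H2 (r & Hr & Hz).
  destruct (excluded_middle_informative (forall e, (0 < e)%R ->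
    exists h, (0 < Cmod h < e)%R /\ phi h = 0)) as [Ha|Hna].
  - left. now apply an_zero.
  - right. apply an_zero; [exact H2|]. intros e He.
    destruct (excluded_middle_informative (exists h, (0 < Cmod h < e)%R /\ psi h = 0)) as [|Hno];
      [assumption|].
    exfalso. apply Hna. intros e' He'.
    set (t := (Rmin (Rmin e e') r / 2)%R).
    assert (Ht : (0 < t /\ t < e /\ t < e' /\ t < r)%R).
    { unfold t. rmins.
      assert (0 < Rmin (Rmin e e') r)%R by (repeat apply Rmin_glb_lt; lra). lra. }
    assert (Hmt : Cmod (RtoC t) = t) by (rewrite Cmod_R, Rabs_pos_eq; lra).
    exists (RtoC t). rewrite Hmt. split; [lra|].
    specialize (Hz (RtoC t)). rewrite Hmt in Hz. specialize (Hz ltac:(lra)).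
    destruct (edec (phi (RtoC t)) 0) as [|Hp]; [assumption|].
    exfalso. apply Hno. exists (RtoC t). rewrite Hmt. split; [lra|].
    replace (psi (RtoC t)) with (phi (RtoC t) * psi (RtoC t) / phi (RtoC t)) by (field; auto).
    rewrite Hz. field. auto.
Qed.

(** * Analyticity of the row-summed function in z *)

Definition Umu (p : nat * nat) : C := RtoC (INR (S (snd p))) * tpi.

Lemma Cmod_tpi : Cmod tpi = (2 * PI)%R.
Proof.
  unfold tpi. rewrite !Cmod_mult, Cmod_Ci, !Cmod_R, !Rabs_pos_eq; try lra.
  left; apply PI_RGT_0.
Qed.

(** Moving p by h multiplies each term by exp(Umu h). With radius Im (tau + p) / 2 this costs at
    most half of the decay rate 2 pi Im (tau + p) of the slowest row. *)
Lemma has_ps_Usum tau p : UHP tau -> (0 < Im (tau + p))%R ->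
  has_ps (fun h => Usum tau (p + h))
    (fun k => ecoef k * tsum (fun i => Uterm tau p i * Umu i ^ k)) (Im (tau + p) / 2).
Proof.
  unfold UHP. intros Ht Hp. rewrite Im_plus in *. pose proof PI_RGT_0.
  destruct (has_ps_exp_sum (Uterm tau p) Umu ((Im tau + Im p) / 2)) as [HP _].
  - lra.
  - eapply rbdd_ext; [|apply (rbdd_Uterm_gen 1 (2 * PI * Im tau)
      (2 * PI * Im p - 2 * PI * ((Im tau + Im p) / 2)))].
    + intros i. cbv beta. rewrite Cmod_Uterm. symmetry.
      rewrite (Rmult_assoc _ (exp _) (exp _)), <- exp_plus. do 2 f_equal. unfold Umu. rewrite Cmod_mult, Cmod_tpi, Cmod_R, Rabs_pos_eq by apply pos_INR. ring.
    + apply Rmult_lt_0_compat; lra.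
    + replace (2 * PI * Im tau + (2 * PI * Im p - 2 * PI * ((Im tau + Im p) / 2)))%R with
        (PI * (Im tau + Im p))%R by field. apply Rmult_lt_0_compat; lra.
  - eapply has_ps_ext; [|exact HP]. intros h Hh. unfold Usum. f_equal.
    apply functional_extensionality. intros i. unfold Uterm, Umu.
    rewrite <- Cmult_assoc, <- Cexp_plus. do 2 f_equal. ring.
Qed.

Lemma an_Usum tau p : UHP tau -> (0 < Im (tau + p))%R -> an (fun h => Usum tau (p + h)).
Proof. intros Ht Hp. eexists _, _. now apply has_ps_Usum. Qed.

Lemma shift_into_strip tau z : UHP tau -> exists m : Z, (Rabs (Im (z + IZC m * tau)) <= Im tau / 2)%R.
Proof.
  unfold UHP. intros Ht. destruct (exists_round (Im z / Im tau)) as [m Hm]. exists m.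
  rewrite Im_plus. unfold IZC. rewrite Im_scal_l.
  replace (Im z + IZR m * Im tau)%R with ((Im z / Im tau + IZR m) * Im tau)%R by (field; lra).
  rewrite Rabs_mult, (Rabs_pos_eq (Im tau)) by lra. nra.
Qed.

Lemma Im_le_Cmod z : (Rabs (Im z) <= Cmod z)%R.
Proof. eapply Rle_trans; [|apply Rmax_Cmod]. apply Rmax_r. Qed.

Lemma isZ_lattice tau z : isZ z -> lattice tau z.
Proof. intros [n ->]. exists n, 0%Z. unfold IZC. ring. Qed.

(** Periodicity moves p to |Im p| <= Im tau / 2, where the strip formula holds on a disc of radius
    Im tau / 2. *)
Lemma an_Wsum tau p : UHP tau -> ~ lattice tau p -> an (fun h => Wsum tau (p + h)).
Proof.
  intros Ht Hp. destruct (shift_into_strip tau p Ht) as [m Hm].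
  assert (HL : lattice tau (IZC m * tau)).
  { exists 0%Z, m. unfold IZC. ring. }
  set (p' := p + IZC m * tau) in *.
  assert (Hp' : ~ isZ p').
  { intros H. apply Hp. replace p with (p' + - (IZC m * tau)) by (unfold p'; ring).
    apply lattice_plus; [now apply isZ_lattice|now apply lattice_opp]. }
  pose proof Ht as Ht'. unfold UHP in Ht'. apply Rabs_le_between in Hm.
  apply (an_ext (fun h => csc2 (p' + h) +
    tpi * tpi * (Usum tau (p' + h) + Usum tau (- p' + - h))) _ (Im tau / 2)); [lra| |].
  - intros h Hh. rewrite <- (Wsum_per tau (p + h) (IZC m * tau) Ht HL).
    replace (p + h + IZC m * tau) with (p' + h) by (unfold p'; ring).
    rewrite Wsum_strip; [now replace (- (p' + h)) with (- p' + - h) by ring|exact Ht|].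
    rewrite Im_plus. pose proof (Im_le_Cmod h) as Hi.
    assert (Hi' : (Rabs (Im h) < Im tau / 2)%R) by lra. apply Rabs_def2 in Hi'.
    apply Rabs_def1; lra.
  - apply an_plus; [now apply an_csc2|]. apply an_scal, an_plus.
    + apply an_Usum; [exact Ht|]. rewrite Im_plus. lra.
    + apply (an_arg_opp (fun h => Usum tau (- p' + h))). apply an_Usum; [exact Ht|].
      rewrite Im_plus, Im_opp. lra.
Qed.

Lemma lattice_strip tau z : UHP tau -> lattice tau z -> (Rabs (Im z) < Im tau)%R -> isZ z.
Proof.
  unfold UHP. intros Ht (m & n & ->) Hz. rewrite Im_plus in Hz. unfold IZC in Hz.
  rewrite Im_scal_l in Hz. cbn in Hz. rewrite Rplus_0_l, Rabs_mult, (Rabs_pos_eq (Im tau)) in Hz by lra.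
  rewrite <- abs_IZR in Hz.
  assert (Hn : (IZR (Z.abs n) < 1)%R) by nra. apply (lt_IZR _ 1) in Hn.
  assert (n = 0%Z) as -> by lia. exists m. unfold IZC. ring.
Qed.

Lemma Wsum_local tau : UHP tau -> exists kap r, an kap /\ (0 < r)%R /\
  forall z, (0 < Cmod z < r)%R -> ~ lattice tau z /\ Wsum tau z = / (z * z) + kap z.
Proof.
  intros Ht. pose proof Ht as Ht'. unfold UHP in Ht'.
  destruct csc2_local as (kap & r & Hk & Hr & E).
  exists (fun z => kap z + tpi * tpi * (Usum tau (0 + z) + Usum tau (0 + - z))), (Rmin r (Im tau)).
  split; [|split].
  - apply an_plus; [exact Hk|]. apply an_scal, an_plus.
    + apply an_Usum; [exact Ht|]. rewrite Im_plus. cbn. lra.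
    + apply (an_arg_opp (fun h => Usum tau (0 + h))). apply an_Usum; [exact Ht|].
      rewrite Im_plus. cbn. lra.
  - now apply Rmin_glb_lt.
  - intros z Hz. rmins.
    destruct (E z) as [HZ Ez]; [lra|].
    assert (Hi : (Rabs (Im z) < Im tau)%R) by (pose proof (Im_le_Cmod z); lra).
    split.
    + intros HL. apply HZ. now apply (lattice_strip tau).
    + rewrite Wsum_strip, Ez, !Cplus_0_l by assumption. ring.
Qed.

(** * The values at 1/4 and tau/4 are distinct *)

Definition quarter (k : Z) : C := IZC k * / 4.

(** The lattice Z/4 + Z tau: it consists of periods of the product over the four shifts and contains
    all poles of the factors. *)
Definition qlat (tau z : C) : Prop := exists m n : Z, z = quarter m + IZC n * tau.

Lemma quarter_plus m n : quarter (m + n) = quarter m + quarter n.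
Proof. unfold quarter. rewrite IZC_plus. ring. Qed.

Lemma quarter_opp m : quarter (- m) = - quarter m.
Proof. unfold quarter. rewrite IZC_opp. ring. Qed.

Lemma quarter_4 m : quarter (4 * m) = IZC m.
Proof.
  unfold quarter. rewrite IZC_mult. change (IZC 4) with (RtoC 4). field.
Qed.

Lemma qlat_plus tau z w : qlat tau z -> qlat tau w -> qlat tau (z + w).
Proof.
  intros (m & n & ->) (m' & n' & ->). exists (m + m')%Z, (n + n')%Z.
  rewrite quarter_plus, IZC_plus. ring.
Qed.

Lemma qlat_opp tau z : qlat tau z -> qlat tau (- z).
Proof.
  intros (m & n & ->). exists (- m)%Z, (- n)%Z. rewrite quarter_opp, IZC_opp. ring.
Qed.

Lemma lattice_qlat tau z : lattice tau z -> qlat tau z.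
Proof. intros (m & n & ->). exists (4 * m)%Z, n. now rewrite quarter_4. Qed.

Lemma quarter_qlat tau k : qlat tau (quarter k).
Proof. exists k, 0%Z. unfold IZC. ring. Qed.

Lemma Re_quarter k : Re (quarter k) = (IZR k / 4)%R.
Proof. unfold quarter, IZC. rewrite <- RtoC_inv, <- RtoC_mult by lra. reflexivity. Qed.

Lemma Im_quarter k : Im (quarter k) = 0%R.
Proof. unfold quarter, IZC. rewrite <- RtoC_inv, <- RtoC_mult by lra. reflexivity. Qed.

Lemma qlat_small tau z : UHP tau -> qlat tau z ->
  (Rabs (Re z) < / 4)%R -> (Rabs (Im z) < Im tau)%R -> z = 0.
Proof.
  unfold UHP. intros Ht (m & n & ->) HR HI.
  rewrite Im_plus, Im_quarter, Rplus_0_l in HI. unfold IZC in HI. rewrite Im_scal_l in HI.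
  rewrite Rabs_mult, (Rabs_pos_eq (Im tau)), <- abs_IZR in HI by lra.
  assert (Hn : (IZR (Z.abs n) < 1)%R) by nra. apply (lt_IZR _ 1) in Hn.
  assert (n = 0%Z) as -> by lia.
  replace (quarter m + IZC 0 * tau) with (quarter m) in * by (unfold IZC; ring).
  rewrite Re_quarter in HR. unfold Rdiv in HR.
  rewrite Rabs_mult, (Rabs_pos_eq (/ 4)), <- abs_IZR in HR by lra.
  assert (Hm : (IZR (Z.abs m) < 1)%R) by lra. apply (lt_IZR _ 1) in Hm.
  assert (m = 0%Z) as -> by lia. unfold quarter, IZC. ring.
Qed.

Lemma qlat_reduce tau p : UHP tau -> exists q, qlat tau q /\
  (Rabs (Re (p + q)) <= / 8)%R /\ (Rabs (Im (p + q)) <= Im tau / 2)%R.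
Proof.
  intros Ht. destruct (shift_into_strip tau p Ht) as [n Hn].
  destruct (exists_round (4 * Re (p + IZC n * tau))) as [m Hm].
  exists (quarter m + IZC n * tau). split; [now exists m, n|].
  replace (p + (quarter m + IZC n * tau)) with (p + IZC n * tau + quarter m) by ring.
  split.
  - replace (Re (p + IZC n * tau + quarter m)) with (Re (p + IZC n * tau) + Re (quarter m))%R
      by reflexivity.
    rewrite Re_quarter.
    replace (Re (p + IZC n * tau) + IZR m / 4)%R with
      (/ 4 * (4 * Re (p + IZC n * tau) + IZR m))%R by field.
    rewrite Rabs_mult, (Rabs_pos_eq (/ 4)) by lra. lra.
  - rewrite Im_plus, Im_quarter, Rplus_0_r. exact Hn.
Qed.

Lemma quarter_not_lattice tau k : UHP tau -> ~ (4 | k)%Z -> ~ lattice tau (quarter k).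
Proof.
  intros Ht Hk HL. apply lattice_strip in HL; [|exact Ht|].
  - destruct HL as [n E]. apply Hk. exists n. apply IZC_inj.
    rewrite IZC_mult, <- E. unfold quarter. change (IZC 4) with (RtoC 4). field.
  - rewrite Im_quarter, Rabs_R0. exact Ht.
Qed.

(* If the two values were equal to [A], the product over the shifts by multiples of 1/4
   of [Wsum - A] would be an elliptic function whose double poles are cancelled by the
   zeros at 1/4 and -1/4, and it would vanish at tau/4, hence everywhere. *)
Section Distinct.

Variables (tau : C) (Ht : UHP tau).

Let A := Wsum tau (quarter 1).
Let Y z := Wsum tau z - A.
Let g z := Y z * Y (z + quarter 1) * Y (z + quarter 2) * Y (z + quarter (-1)).

Lemma Y_per z w : lattice tau w -> Y (z + w) = Y z.
Proof. intros Hw. unfold Y. now rewrite Wsum_per. Qed.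

Lemma quarter_product_per_tau z n : g (z + IZC n * tau) = g z.
Proof.
  assert (HL : lattice tau (IZC n * tau)).
  { exists 0%Z, n. unfold IZC. ring. }
  unfold g.
  replace (z + IZC n * tau + quarter 1) with (z + quarter 1 + IZC n * tau) by ring.
  replace (z + IZC n * tau + quarter 2) with (z + quarter 2 + IZC n * tau) by ring.
  replace (z + IZC n * tau + quarter (-1)) with (z + quarter (-1) + IZC n * tau) by ring.
  now rewrite !(fun u => Y_per u _ HL).
Qed.

(** The shift permutes the four factors cyclically, up to the period 1 of [Y]. *)
Lemma quarter_product_per_quarter z : g (z + quarter 1) = g z.
Proof.
  assert (HL : lattice tau 1).
  { exists 1%Z, 0%Z. unfold IZC. ring. }
  unfold g.
  replace (z + quarter 1 + quarter 1) with (z + quarter 2) by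
    (rewrite <- Cplus_assoc, <- quarter_plus; reflexivity).
  replace (z + quarter 1 + quarter (-1)) with z.
  2: { rewrite <- Cplus_assoc, <- quarter_plus. unfold quarter, IZC. cbn [Z.add Z.pos_sub]. ring. }
  replace (z + quarter 1 + quarter 2) with (z + quarter (-1) + 1).
  - rewrite (Y_per _ _ HL). ring.
  - rewrite <- !Cplus_assoc, <- quarter_plus. f_equal.
    change (RtoC 1) with (IZC 1). rewrite <- quarter_4, <- quarter_plus. reflexivity.
Qed.

Lemma quarter_product_per z w : qlat tau w -> g (z + w) = g z.
Proof.
  intros (m & n & ->). rewrite Cplus_assoc, quarter_product_per_tau.
  assert (H : forall k z, g (z + quarter (Z.of_nat k)) = g z).
  { intros k. induction k as [|k IH]; intros u.
    - f_equal. unfold quarter, IZC. cbn [Z.of_nat]. ring.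
    - rewrite Nat2Z.inj_succ, <- Z.add_1_r, quarter_plus, Cplus_assoc, quarter_product_per_quarter. apply IH. }
  destruct (Z_le_gt_dec 0 m) as [Hm|Hm].
  - rewrite <- (Z2Nat.id m) by exact Hm. apply H.
  - rewrite <- (H (Z.to_nat (- m)) (z + quarter m)), <- Cplus_assoc, <- quarter_plus,
      Z2Nat.id by lia.
    replace (m + - m)%Z with 0%Z by lia. f_equal. unfold quarter, IZC. ring.
Qed.

Lemma an_Y p : ~ lattice tau p -> an (fun h => Y (p + h)).
Proof. intros Hp. apply an_minus; [now apply an_Wsum|apply an_const]. Qed.

(** Evenness supplies the second zero that cancels the double pole. *)
Lemma Y_quarter_m1 : Y (quarter (-1)) = 0.
Proof.
  unfold Y. replace (quarter (-1)) with (- quarter 1) by now rewrite <- quarter_opp.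
  rewrite Wsum_even; [|exact Ht|].
  - fold A. ring.
  - apply quarter_not_lattice; [exact Ht|]. intros [k Hk]. lia.
Qed.

Lemma Y_quarter_1 : Y (quarter 1) = 0.
Proof. unfold Y. fold A. ring. Qed.

(** Near 0 the double pole of [Y] meets one zero from each of the factors shifted by 1/4 and -1/4.
    The germ alpha = h^2 Y has the value 1 at 0. *)
Lemma quarter_product_local : exists alpha u1 u2 r, an alpha /\ an u1 /\ an u2 /\ (0 < r)%R /\
  alpha 0 <> 0 /\
  (forall h, (0 < Cmod h < r)%R ->
    h * h * Y h = alpha h /\ Y (quarter 1 + h) = h * u1 h /\
    Y (quarter (-1) + h) = h * u2 h).
Proof.
  destruct (Wsum_local tau Ht) as (kap & r & Hk & Hr & E).
  assert (N1 : ~ lattice tau (quarter 1)).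
  { apply quarter_not_lattice; [exact Ht|]. intros [k Hk']. lia. }
  assert (N2 : ~ lattice tau (quarter (-1))).
  { apply quarter_not_lattice; [exact Ht|]. intros [k Hk']. lia. }
  destruct (an_factor _ (an_Y _ N1)) as (u1 & r1 & Hu1 & Hr1 & E1).
  destruct (an_factor _ (an_Y _ N2)) as (u2 & r2 & Hu2 & Hr2 & E2).
  rewrite Cplus_0_r, Y_quarter_1 in E1. rewrite Cplus_0_r, Y_quarter_m1 in E2.
  exists (fun h => 1 + h * h * (kap h - A)), u1, u2, (Rmin r (Rmin r1 r2)).
  split; [|split; [exact Hu1|split; [exact Hu2|split; [|split]]]].
  - apply an_plus; [apply an_const|]. apply an_mult; [apply an_mult; apply an_id|].
    apply an_minus; [exact Hk|apply an_const].
  - repeat apply Rmin_glb_lt; assumption.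
  - rewrite !Cmult_0_l, Cplus_0_r. exact C1_nz.
  - intros h Hh. rmins.
    rewrite E1, E2 by lra. split; [|split; ring].
    destruct (E h) as [_ Eh]; [lra|]. unfold Y. rewrite Eh. field. apply Cmod_gt_0. lra.
Qed.

(** The singularities lie in [qlat] and are removable; the value inserted there is that of the
    regularised germ [gam] at 0. Periodicity leaves a rectangle around 0 to be examined, small
    enough to meet [qlat] in 0 alone. *)
Lemma quarter_product_entire : exists G, (forall z, ~ qlat tau z -> G z = g z) /\
  (forall z w, qlat tau w -> G (z + w) = G z) /\ forall p, an (fun h => G (p + h)).
Proof.
  destruct quarter_product_local as (alpha & u1 & u2 & r & Ha & Hu1 & Hu2 & Hr & Ha0 & E).
  set (gam := fun h => alpha h * u1 h * u2 h * Y (quarter 2 + h)).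
  assert (Hgam : an gam).
  { repeat apply an_mult; auto. apply an_Y, quarter_not_lattice; [exact Ht|].
    intros [k Hk]. lia. }
  set (G := fun z => if excluded_middle_informative (qlat tau z) then gam 0 else g z).
  assert (Gg : forall z, ~ qlat tau z -> G z = g z).
  { intros z Hz. unfold G. now destruct (excluded_middle_informative (qlat tau z)). }
  assert (Gper : forall z w, qlat tau w -> G (z + w) = G z).
  { intros z w Hw. unfold G.
    destruct (excluded_middle_informative (qlat tau (z + w))) as [H1|H1],
      (excluded_middle_informative (qlat tau z)) as [H2|H2].
    - reflexivity.
    - elim H2. replace z with (z + w + - w) by ring. apply qlat_plus; [exact H1|now apply qlat_opp].
    - elim H1. now apply qlat_plus.
    - now apply quarter_product_per. }
  assert (Han : forall p, (Rabs (Re p) <= / 8)%R -> (Rabs (Im p) <= Im tau / 2)%R ->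
    an (fun h => G (p + h))).
  { intros p HR HI. pose proof Ht as Ht'. unfold UHP in Ht'.
    assert (Hsm : forall h, (Cmod h < Rmin (/ 8) (Im tau / 2))%R -> qlat tau (p + h) -> p + h = 0).
    { intros h Hh Hq. rmins.
      pose proof (re_le_Cmod h). pose proof (Im_le_Cmod h).
      apply (qlat_small tau _ Ht Hq).
      - replace (Re (p + h)) with (Re p + Re h)%R by reflexivity.
        eapply Rle_lt_trans; [apply Rabs_triang|]. lra.
      - rewrite Im_plus. eapply Rle_lt_trans; [apply Rabs_triang|]. lra. }
    assert (Hm : (0 < Rmin (/ 8) (Im tau / 2))%R) by (apply Rmin_glb_lt; lra).
    destruct (edec p 0) as [->|Hp].
    - apply (an_ext gam _ (Rmin r (Rmin (/ 8) (Im tau / 2)))); [now apply Rmin_glb_lt| |exact Hgam].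
      intros h Hh. rmins.
      destruct (edec h 0) as [->|Hh0].
      + rewrite Cplus_0_r. unfold G. destruct (excluded_middle_informative (qlat tau 0)) as [|Hq];
          [reflexivity|]. elim Hq. exists 0%Z, 0%Z. unfold quarter, IZC. ring.
      + apply Cmod_gt_0 in Hh0.
        assert (Hq : ~ qlat tau (0 + h)).
        { intros Hq. apply Hsm in Hq; [|lra]. rewrite Cplus_0_l in Hq. subst h.
          rewrite Cmod_0 in Hh0. lra. }
        rewrite Gg by exact Hq. rewrite Cplus_0_l. destruct (E h) as (E1 & E2 & E3); [lra|].
        unfold gam, g. rewrite <- E1.
        replace (h + quarter 1) with (quarter 1 + h) by ring.
        replace (h + quarter 2) with (quarter 2 + h) by ring.
        replace (h + quarter (-1)) with (quarter (-1) + h) by ring.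
        rewrite E2, E3. ring.
    - assert (Hp' : (0 < Cmod p)%R) by now apply Cmod_gt_0.
      assert (Hnq : forall h, (Cmod h < Rmin (Cmod p) (Rmin (/ 8) (Im tau / 2)))%R ->
        ~ qlat tau (p + h)).
      { intros h Hh Hq. rmins.
        apply Hsm in Hq; [|lra].
        assert (Ep : p = - h) by (replace p with (p + h + - h) by ring; rewrite Hq; ring).
        assert (Cmod p = Cmod h) by (rewrite Ep; apply Cmod_opp). lra. }
      assert (Hmm : (0 < Rmin (Cmod p) (Rmin (/ 8) (Im tau / 2)))%R) by now apply Rmin_glb_lt.
      apply (an_ext (fun h => g (p + h)) _ (Rmin (Cmod p) (Rmin (/ 8) (Im tau / 2)))).
      + exact Hmm.
      + intros h Hh. now rewrite Gg by now apply Hnq.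
      + assert (Hpq : ~ qlat tau p).
        { specialize (Hnq 0). rewrite Cmod_0, Cplus_0_r in Hnq. now apply Hnq. }
        assert (Hk : forall k, an (fun h => Y (p + h + quarter k))).
        { intros k. apply (an_ext (fun h => Y (p + quarter k + h)) _ 1%R); [lra| |].
          - intros h _. f_equal. ring.
          - apply an_Y. intros HL. apply Hpq.
            replace p with (p + quarter k + quarter (- k)) by (rewrite quarter_opp; ring).
            apply qlat_plus; [now apply lattice_qlat|apply quarter_qlat]. }
        unfold g.
        assert (HY : an (fun h => Y (p + h))).
        { apply an_Y. intros HL. now apply Hpq, lattice_qlat. }
        exact (an_mult _ _ (an_mult _ _ (an_mult _ _ HY (Hk 1%Z)) (Hk 2%Z)) (Hk (-1)%Z)). }
  exists G. split; [exact Gg|]. split; [exact Gper|].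
  intros p. destruct (qlat_reduce tau p Ht) as (q & Hq & HR & HI).
  apply (an_ext (fun h => G (p + q + h)) _ 1%R); [lra| |now apply Han].
  intros h _. replace (p + q + h) with (p + h + q) by ring. now apply Gper.
Qed.

(** Vanishing near k/4 would propagate along the real axis towards the pole at 0, near which h^2 Y
    is nonzero. *)
Lemma Y_not_const k : (k = 1 \/ k = 2 \/ k = -1)%Z ->
  ~ exists r, (0 < r)%R /\ forall h, (Cmod h < r)%R -> Y (quarter k + h) = 0.
Proof.
  intros Hk H0. destruct quarter_product_local as (alpha & u1 & u2 & r & Ha & _ & _ & Hr & Ha0 & E).
  destruct (an_nonzero _ Ha Ha0) as (d & Hd & Hnz).
  set (e := (Rmin (Rmin r d) 1 / 2)%R).
  assert (He : (0 < e /\ e < r /\ e < d /\ e < 1)%R).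
  { unfold e. rmins.
    assert (0 < Rmin (Rmin r d) 1)%R by (repeat apply Rmin_glb_lt; lra). lra. }
  assert (Hmod : Cmod (quarter k) = (Rabs (IZR k) / 4)%R).
  { unfold quarter, IZC. rewrite <- RtoC_inv, <- RtoC_mult, Cmod_R, Rabs_mult, (Rabs_pos_eq (/ 4))
      by lra. reflexivity. }
  assert (Hk1 : (1 <= Rabs (IZR k) <= 2)%R).
  { rewrite <- abs_IZR. split; [apply (IZR_le 1)|apply (IZR_le _ 2)]; lia. }
  (* The segment runs from k/4 to e k/4; its points are real with 0 < |x| <= 1/2, hence outside the
     lattice. *)
  assert (Hconst : Y (quarter k + RtoC (e - 1) * quarter k) = 0).
  { apply const_along; [|exact H0]. intros t Ht'.
    apply (an_ext (fun h => Y (RtoC (1 + t * (e - 1)) * quarter k + h)) _ 1%R); [lra| |].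
    - intros h _. f_equal. rewrite RtoC_plus, !RtoC_mult. ring.
    - apply an_Y. intros HL. set (s := (1 + t * (e - 1))%R) in *.
      assert (Hs : (0 < s <= 1)%R) by (unfold s; nra).
      apply lattice_strip in HL; [|exact Ht|].
      + destruct HL as [n En]. apply (f_equal Re) in En. rewrite Re_scal_l, Re_quarter in En.
        cbn in En. assert (Hn : (IZR (Z.abs n) < 1)%R).
        { rewrite abs_IZR, <- En. rewrite Rabs_mult, (Rabs_pos_eq s) by lra.
          unfold Rdiv. rewrite Rabs_mult, (Rabs_pos_eq (/ 4)) by lra. nra. }
        apply (lt_IZR _ 1) in Hn. assert (n = 0%Z) as -> by lia.
        assert (IZR k = 0%R) as Hk0 by nra. rewrite Hk0, Rabs_R0 in Hk1. lra.
      + rewrite Im_scal_l, Im_quarter, Rmult_0_r, Rabs_R0. exact Ht. }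
  replace (quarter k + RtoC (e - 1) * quarter k) with (RtoC e * quarter k) in Hconst by
    (rewrite RtoC_minus; ring).
  assert (Hm : Cmod (RtoC e * quarter k) = (e * (Rabs (IZR k) / 4))%R).
  { rewrite Cmod_mult, Hmod, Cmod_R, Rabs_pos_eq by lra. reflexivity. }
  destruct (E (RtoC e * quarter k)) as (E1 & _ & _); [rewrite Hm; nra|].
  rewrite Hconst, Cmult_0_r in E1. apply (Hnz (RtoC e * quarter k)); [rewrite Hm; nra|].
  now symmetry.
Qed.

Lemma Wsum_quarter_neq : Wsum tau (tau * / 4) <> Wsum tau (quarter 1).
Proof.
  intros Heq. pose proof Ht as Ht'. unfold UHP in Ht'.
  destruct quarter_product_entire as (G & Gg & Gper & Gan).
  assert (Him : Im (tau * / 4) = (Im tau / 4)%R).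
  { rewrite <- RtoC_inv by lra. destruct tau; cbn. field. }
  assert (Hnq : ~ qlat tau (tau * / 4)).
  { intros (m & n & E). apply (f_equal Im) in E. rewrite Him, Im_plus, Im_quarter in E.
    unfold IZC in E. rewrite Im_scal_l in E.
    assert (E' : (IZR (4 * n) = 1)%R) by (rewrite mult_IZR; nra).
    apply eq_IZR in E'. lia. }
  (* By Liouville the product is constant, and its first factor vanishes at tau/4 under the assumed
     equality. *)
  assert (G0 : forall z, G z = 0).
  { intros z. rewrite (liouville G (- / 8) (/ 8) (- (Im tau / 2)) (Im tau / 2) Gan) with (w := tau * / 4).
    - rewrite Gg by exact Hnq. unfold g, Y at 1. rewrite Heq. fold A. ring.
    - intros p. destruct (qlat_reduce tau p Ht) as (q & Hq & HR & HI).
      apply Rabs_le_between in HR, HI. exists (p + q). split; [exact HR|]. split; [exact HI|].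
      now apply Gper. }
  destruct quarter_product_local as (alpha & u1 & u2 & r & Ha & Hu1 & Hu2 & Hr & Ha0 & E).
  destruct (an_nonzero _ Ha Ha0) as (d & Hd & Hnz).
  assert (N : forall k, (k = 1 \/ k = 2 \/ k = -1)%Z -> an (fun h => Y (quarter k + h))).
  { intros k Hk. apply an_Y, quarter_not_lattice; [exact Ht|]. intros [j Hj]. lia. }
  (* Near 0 the factor [Y h] is nonzero because of its pole, so the product of the other three germs
     is zero and one of them vanishes identically. *)
  assert (Hz : exists s, (0 < s)%R /\ forall h, (0 < Cmod h < s)%R ->
    Y (quarter 1 + h) * (Y (quarter 2 + h) * Y (quarter (-1) + h)) = 0).
  { set (s := Rmin (Rmin r d) (Rmin (/ 4) (Im tau))).
    assert (Hs : (0 < s /\ s <= r /\ s <= d /\ s <= / 4 /\ s <= Im tau)%R).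
    { unfold s. rmins.
      split; [repeat apply Rmin_glb_lt; lra|lra]. }
    exists s. split; [lra|]. intros h Hh.
    assert (Hh0 : h <> 0) by (apply Cmod_gt_0; lra).
    assert (Hq : ~ qlat tau h).
    { intros Hq. apply Hh0, (qlat_small tau h Ht Hq).
      - pose proof (re_le_Cmod h). lra.
      - pose proof (Im_le_Cmod h). lra. }
    specialize (G0 h). rewrite Gg in G0 by exact Hq. unfold g in G0.
    replace (h + quarter 1) with (quarter 1 + h) in G0 by ring.
    replace (h + quarter 2) with (quarter 2 + h) in G0 by ring.
    replace (h + quarter (-1)) with (quarter (-1) + h) in G0 by ring.
    destruct (E h) as (E1 & _ & _); [lra|]. specialize (Hnz h ltac:(lra)).
    assert (HY : Y h <> 0) by (intros H0; apply Hnz; rewrite <- E1, H0; ring).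
    set (y1 := Y (quarter 1 + h)) in *. set (y2 := Y (quarter 2 + h)) in *.
    set (y3 := Y (quarter (-1) + h)) in *.
    replace (y1 * (y2 * y3)) with (Y h * y1 * y2 * y3 / Y h) by (field; auto).
    rewrite G0. field. auto. }
  apply an_mult_zero in Hz; [|apply N; auto|apply an_mult; apply N; auto].
  destruct Hz as [Hz|Hz]; [now apply (Y_not_const 1); auto|].
  destruct Hz as (s & Hs & Hz).
  destruct (an_mult_zero _ _ (N 2%Z ltac:(auto)) (N (-1)%Z ltac:(auto))) as [Hz'|Hz'].
  - exists s. split; [exact Hs|]. intros h Hh. apply Hz. lra.
  - apply (Y_not_const 2); auto.
  - apply (Y_not_const (-1)); auto.
Qed.

End Distinct.

(** * Relation with [power_series_at_0] *)

Lemma is_pseries_C (c : nat -> C) (z l : C) :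
  is_pseries (K := C_AbsRing) (V := C_NormedModule) c z l <->
  is_series (K := C_AbsRing) (V := C_NormedModule) (fun k => c k * z ^ k) l.
Proof.
  unfold is_pseries.
  split; apply is_series_ext; intros k.
  - exact (Cmult_comm (z ^ k) (c k)).
  - exact (Cmult_comm (c k) (z ^ k)).
Qed.

(** From left to right the radius is halved: convergence at the point r/2 bounds the terms, which
    gives absolute convergence inside, and uniqueness of limits identifies the value. *)
Lemma power_series_at_0_iff g (c : nat -> C) : power_series_at_0 g c <->
  exists r, (0 < r)%R /\ forall z, (0 < Cmod z < r)%R -> asum (fun k => c k * z ^ k) (g z).
Proof.
  split; intros (r & Hr & H).
  - exists (r / 2)%R. split; [lra|]. intros z Hz.
    assert (Hm : Cmod (RtoC (r / 2)) = (r / 2)%R) by (rewrite Cmod_R, Rabs_pos_eq; lra).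
    assert (Hr2 : (0 < Cmod (RtoC (r / 2)) < r)%R) by (rewrite Hm; lra).
    pose proof (proj1 (is_pseries_C _ _ _) (H _ Hr2)) as HS.
    destruct (is_series_terms_bounded _ _ HS) as [M HM].
    assert (HP : has_ps (fun h => tsum (fun k => c k * h ^ k)) c (r / 2)).
    { apply has_ps_of_bound with M; [lra|]. intros k. specialize (HM k).
      now rewrite Cmod_mult, Cmod_pow, Hm in HM. }
    destruct HP as [_ HP]. specialize (HP z (proj2 Hz)).
    assert (Hz' : (0 < Cmod z < r)%R) by lra.
    pose proof (proj1 (is_pseries_C _ _ _) (H _ Hz')) as HSz.
    pose proof (is_series_C_unique _ _ _ HSz (asum_is_series _ _ HP)) as E.
    rewrite E. exact HP.
  - exists r. split; [exact Hr|]. intros z Hz. apply is_pseries_C, asum_is_series, H, Hz.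
Qed.

Lemma power_series_at_0_unique g (c d : nat -> C) :
  power_series_at_0 g c -> power_series_at_0 g d -> c = d.
Proof.
  intros Hc Hd. apply power_series_at_0_iff in Hc, Hd.
  destruct Hc as (r & Hr & Hc). destruct Hd as (s & Hs & Hd).
  set (t := Rmin r s). assert (Ht : (0 < t)%R) by now apply Rmin_glb_lt.
  pose proof (Rmin_l r s) as Hl. pose proof (Rmin_r r s) as Hr'. fold t in Hl, Hr'.
  (* The expansions say nothing at 0, so the difference is given there the value that the constant
     terms impose. *)
  assert (HP : has_ps (fun h => if edec h 0 then c 0%nat + - (1) * d 0%nat else 0)
    (fun k => c k + - (1) * d k) t).
  { split; [exact Ht|]. intros h Hh. destruct (edec h 0) as [->|Hh0].
    - apply (asum_single_eq _ 0%nat); [cbn; ring|]. intros [|k] Hk; [congruence|].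
      rewrite Cpow_S. ring.
    - apply Cmod_gt_0 in Hh0.
      pose proof (asum_plus _ _ _ _ (Hc h ltac:(lra)) (asum_scal (- (1)) _ _ (Hd h ltac:(lra)))) as HS.
      replace (g h + - (1) * g h) with (RtoC 0) in HS by ring.
      eapply asum_ext; [|exact HS]. intros k; cbn beta; ring. }
  apply functional_extensionality. intros k. apply Ceq_minus.
  replace (c k - d k) with (c k + - (1) * d k) by ring.
  apply (has_ps_zero _ _ _ HP). intros e He. exists (RtoC (e / 2)).
  assert (Hm : Cmod (RtoC (e / 2)) = (e / 2)%R) by (rewrite Cmod_R, Rabs_pos_eq; lra).
  rewrite Hm. split; [lra|]. destruct (edec (RtoC (e / 2)) 0) as [E|]; [|reflexivity].
  apply RtoC_inj in E. lra.
Qed.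

Lemma power_series_at_0_ext g g' (c : nat -> C) r : (0 < r)%R ->
  (forall z, (0 < Cmod z < r)%R -> g z = g' z) ->
  power_series_at_0 g c -> power_series_at_0 g' c.
Proof.
  intros Hr E (s & Hs & H). exists (Rmin r s). split; [now apply Rmin_glb_lt|].
  intros z Hz. rmins.
  rewrite <- E by lra. apply H. lra.
Qed.

Lemma power_series_at_0_arg_scal g (c : nat -> C) (j : C) : j <> 0 ->
  power_series_at_0 g c -> power_series_at_0 (fun z => g (j * z)) (fun k => c k * j ^ k).
Proof.
  intros Hj H. apply power_series_at_0_iff in H. apply power_series_at_0_iff.
  destruct H as (r & Hr & H). apply Cmod_gt_0 in Hj.
  exists (r / Cmod j)%R. split; [now apply Rdiv_lt_0_compat|]. intros z Hz.
  assert (Hjz : (0 < Cmod (j * z) < r)%R).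
  { rewrite Cmod_mult. split; [apply Rmult_lt_0_compat; lra|].
    replace r with (Cmod j * (r / Cmod j))%R by (field; lra). apply Rmult_lt_compat_l; lra. }
  eapply asum_ext; [|apply (H _ Hjz)]. intros k; cbn beta. rewrite Cpow_mult_l. ring.
Qed.

Lemma power_series_at_0_scal a g (c : nat -> C) :
  power_series_at_0 g c -> power_series_at_0 (fun z => a * g z) (fun k => a * c k).
Proof.
  intros H. apply power_series_at_0_iff in H. apply power_series_at_0_iff.
  destruct H as (r & Hr & H). exists r. split; [exact Hr|]. intros z Hz.
  eapply asum_ext; [|apply (asum_scal a), (H z Hz)]. intros k; cbn beta. ring.
Qed.

(** * Functions analytic on the unit disc *)

(** The radius is 1 because the nome of every point of the upper half plane has modulus below 1: one
    such function describes a quantity on the whole half plane and at the cusp q = 0. *)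
Definition disc_an (phi : C -> C) : Prop := exists c, has_ps phi c 1.

Lemma disc_an_ext phi psi : (forall q, (Cmod q < 1)%R -> phi q = psi q) -> disc_an phi -> disc_an psi.
Proof. intros E [c H]. exists c. now apply has_ps_ext with phi. Qed.

Lemma disc_an_plus phi psi : disc_an phi -> disc_an psi -> disc_an (fun q => phi q + psi q).
Proof. intros [c H] [d H']. eexists. apply has_ps_plus; eassumption. Qed.

Lemma disc_an_mult phi psi : disc_an phi -> disc_an psi -> disc_an (fun q => phi q * psi q).
Proof. intros [c H] [d H']. eexists. apply has_ps_mult; eassumption. Qed.

Lemma disc_an_const a : disc_an (fun _ => a).
Proof. eexists. apply has_ps_const. lra. Qed.

Lemma disc_an_scal a phi : disc_an phi -> disc_an (fun q => a * phi q).
Proof. intros H. apply disc_an_mult; [apply disc_an_const|exact H]. Qed.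

Lemma disc_an_minus phi psi : disc_an phi -> disc_an psi -> disc_an (fun q => phi q - psi q).
Proof.
  intros H H'. apply (disc_an_ext (fun q => phi q + - (1) * psi q)).
  - intros; ring.
  - apply disc_an_plus; [exact H|now apply disc_an_scal].
Qed.

Lemma disc_an_lsum {J} (phi : J -> C -> C) L : (forall j, In j L -> disc_an (phi j)) ->
  disc_an (fun q => lsum (fun j => phi j q) L).
Proof.
  intros H. induction L as [|j L IH]; [apply (disc_an_const 0)|].
  apply (disc_an_plus (phi j)); [apply H; now left|]. apply IH. intros; apply H; now right.
Qed.

Lemma disc_an_cauchy (a b : C -> nat -> C) n :
  (forall k, disc_an (fun q => a q k)) -> (forall k, disc_an (fun q => b q k)) ->
  disc_an (fun q => cauchy (a q) (b q) n).
Proof.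
  intros Ha Hb. unfold cauchy.
  apply (disc_an_lsum (fun k q => a q k * b q (n - k)%nat)).
  intros k _. now apply (disc_an_mult (fun q => a q k)).
Qed.

(** With constant term 1 the recursion for the reciprocal is polynomial in the coefficients, so no
    division by a function of q occurs. *)
Lemma disc_an_ps_inv (d : C -> nat -> C) n :
  (forall q, d q 0%nat = 1) -> (forall k, disc_an (fun q => d q k)) ->
  disc_an (fun q => ps_inv (d q) n).
Proof.
  intros H0 Hd. induction n as [n IH] using lt_wf_ind. destruct n as [|n].
  - apply (disc_an_ext (fun _ => 1)); [|apply disc_an_const]. intros q _.
    unfold ps_inv. cbn [ps_inv_list nth]. rewrite H0. field.
  - apply (disc_an_ext (fun q => - (1) *
      lsum (fun k => d q (S k) * ps_inv (d q) (n - k)%nat) (seq 0 (S n)))).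
    + intros q _. rewrite ps_inv_S, H0. field.
    + apply disc_an_scal, (disc_an_lsum (fun k q => d q (S k) * ps_inv (d q) (n - k)%nat)).
      intros k Hk. apply in_seq in Hk. apply (disc_an_mult (fun q => d q (S k))); [apply Hd|].
      apply IH. lia.
Qed.

(** A nonzero value of [psi] forces a nonzero coefficient. If the first one has index N, then psi =
    q^N psi1 with psi1 invertible at 0, and q^N clears the pole. *)
Lemma meromorphic_quotient phi psi q1 : disc_an phi -> disc_an psi ->
  (Cmod q1 < 1)%R -> psi q1 <> 0 -> meromorphic_at_0 (fun q => phi q / psi q).
Proof.
  intros [c Hc] [d Hd] Hq1 Hnz.
  assert (Hex : exists n, d n <> 0 /\ forall k, (k < n)%nat -> d k = 0).
  { destruct (excluded_middle_informative (exists n, d n <> 0)) as [[n Hn]|Hno].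
    - induction n as [n IH] using lt_wf_ind.
      destruct (excluded_middle_informative (exists k, (k < n)%nat /\ d k <> 0)) as [(k & Hk & Hdk)|Hno].
      + now apply (IH k).
      + exists n. split; [exact Hn|]. intros k Hk. destruct (edec (d k) 0) as [|Hdk]; [assumption|].
        elim Hno. now exists k.
    - exfalso. apply Hnz. eapply asum_unique; [apply Hd, Hq1|].
      eapply asum_ext; [|apply asum_zero]. intros k; cbn beta.
      destruct (edec (d k) 0) as [->|Hk]; [ring|]. elim Hno. now exists k. }
  destruct Hex as (N & HN & Hlt).
  destruct (has_ps_shift_n N _ _ _ Hd Hlt) as (psi1 & H1 & E1).
  destruct (has_ps_inv _ _ _ H1) as (s & Hs & H2 & Hn); [cbv beta; now rewrite Nat.add_0_r|].
  pose proof (proj1 H2) as Hs0.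
  exists N, (cauchy c (ps_inv (fun k => d (N + k)%nat))).
  apply power_series_at_0_iff. exists s. split; [exact Hs0|]. intros q Hq.
  pose proof (has_ps_mult _ _ _ _ _ (has_ps_le _ _ _ s (conj Hs0 Hs) Hc) H2) as [_ HM].
  specialize (HM q (proj2 Hq)).
  replace (q ^ N * (phi q / psi q)) with (phi q * / psi1 q); [exact HM|].
  rewrite E1 by lra. specialize (Hn q (proj2 Hq)).
  assert (q ^ N <> 0) by (apply Cpow_nz, Cmod_gt_0; lra). field. auto.
Qed.

(** This yields holomorphy in tau, as moving tau by h multiplies the nome by exp(2 pi i h/4). The
    composite is the exponential sum with coefficients c_n q0^n and frequencies n k. *)
Lemma disc_an_exp phi (q0 k : C) : disc_an phi -> (Cmod q0 < 1)%R ->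
  an (fun h => phi (q0 * Cexp (k * h))).
Proof.
  intros [c Hc] Hq0. pose proof (Cmod_ge_0 q0) as H0. pose proof (Cmod_ge_0 k) as Hk.
  destruct (edec q0 0) as [->|Hq].
  { apply (an_ext (fun _ => phi 0) _ 1%R); [lra| |apply an_const].
    intros h _. now rewrite Cmult_0_l. }
  apply Cmod_gt_0 in Hq.
  (* The choice ensures |q0| exp(|k| r) <= sqrt |q0| < 1. *)
  set (r := (- ln (Cmod q0) / (2 * (Cmod k + 1)))%R).
  assert (Hln : (ln (Cmod q0) < 0)%R) by (rewrite <- ln_1; apply ln_increasing; lra).
  assert (Hr : (0 < r)%R) by (apply Rdiv_lt_0_compat; lra).
  assert (Hlt : (Cmod q0 * exp (Cmod k * r) < 1)%R).
  { rewrite <- (exp_ln (Cmod q0)) at 1 by lra. rewrite <- exp_plus, <- exp_0.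
    apply exp_increasing.
    assert (Cmod k * r <= - ln (Cmod q0) / 2)%R; [|lra].
    apply Rle_trans with ((Cmod k + 1) * r)%R; [nra|]. right. unfold r. field. lra. }
  assert (Hpos : (0 < exp (Cmod k * r))%R) by apply exp_pos.
  destruct (has_ps_exp_sum (fun n => c n * q0 ^ n) (fun n => RtoC (INR n) * k) r Hr) as [HP _].
  - destruct (proj2 Hc (RtoC (Cmod q0 * exp (Cmod k * r)))) as [HB _].
    { rewrite Cmod_R, Rabs_pos_eq; [lra|]. apply Rmult_le_pos; lra. }
    eapply rbdd_ext; [|exact HB]. intros n; cbv beta.
    rewrite !Cmod_mult, !Cmod_pow, !Cmod_R, Rabs_pos_eq by (apply Rmult_le_pos; lra).
    rewrite Rabs_pos_eq by apply pos_INR.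
    rewrite Rpow_mult_distr, <- exp_INR, (Rmult_assoc (Cmod (c n))).
    replace (INR n * (Cmod k * r))%R with (INR n * Cmod k * r)%R by ring. reflexivity.
  - eexists _, r. eapply has_ps_ext; [|exact HP]. intros h Hh. apply tsum_eq.
    assert (Hd : (Cmod (q0 * Cexp (k * h)) < 1)%R).
    { rewrite Cmod_mult. eapply Rle_lt_trans; [|exact Hlt].
      apply Rmult_le_compat_l; [lra|]. eapply Rle_trans; [apply Cmod_Cexp_le|].
      rewrite Cmod_mult. pose proof (Cmod_ge_0 h).
      destruct (Rle_lt_or_eq_dec (Cmod k * Cmod h) (Cmod k * r)) as [Hl|<-]; [|left|lra].
      - apply Rmult_le_compat_l; lra.
      - now apply exp_increasing. }
    eapply usum_ext; [|apply (proj2 Hc _ Hd)]. intros n; cbn beta.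
    rewrite Cpow_mult_l, Cexp_pow.
    replace (RtoC (INR n) * (k * h)) with (RtoC (INR n) * k * h) by ring. ring.
Qed.

(** * q-expansions *)

Definition nome (tau : C) : C := Cexp (2 * RtoC PI * Ci * tau / 4).

Lemma nome_tpi tau : nome tau = Cexp (tpi * (tau / 4)).
Proof. unfold nome, tpi. f_equal. field. Qed.

Lemma Im_div4 z : Im (z / 4) = (Im z / 4)%R.
Proof.
  unfold Cdiv. rewrite <- RtoC_inv by lra. rewrite Cmult_comm, Im_scal_l. field.
Qed.

Lemma Cmod_nome_lt tau : UHP tau -> (Cmod (nome tau) < 1)%R.
Proof.
  unfold UHP. intros Ht. rewrite nome_tpi. apply Cmod_Cexp_tpi_lt. rewrite Im_div4. lra.
Qed.

(** A Lambert series: the sum of m^j zeta^m q^((4n + e) m) over n >= 0 and m >= 1. The 4 reflects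
    exp(2 pi i tau) = q^4; [e] encodes the tau-coordinate of a 4-torsion point, [zeta] its other
    coordinate, and [j] rises with the order of the Taylor coefficient. *)
Definition lambert (e j : nat) (zeta q : C) : C :=
  tsum (fun p : nat * nat => RtoC (INR (S (snd p)) ^ j) * zeta ^ S (snd p) *
    q ^ ((4 * fst p + e) * S (snd p))).

Lemma asum_lambert e j zeta q : (0 < e)%nat -> (Cmod zeta <= 1)%R -> (Cmod q < 1)%R ->
  asum (fun p : nat * nat => RtoC (INR (S (snd p)) ^ j) * zeta ^ S (snd p) *
    q ^ ((4 * fst p + e) * S (snd p))) (lambert e j zeta q).
Proof.
  intros He Hz Hq. apply asum_exists. pose proof (Cmod_ge_0 q) as Hq0. set (r := Cmod q) in *.
  assert (HG : rbdd (fun n => r ^ n)%R) by (apply rbdd_geom; lra).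
  assert (HM : rbdd (fun m => INR (S m) ^ j * r ^ S m)%R).
  { apply (rbdd_comp S (fun m => INR m ^ j * r ^ m)%R); [intros; congruence|].
    apply rbdd_nat_pow_geom; lra. }
  assert (Hm0 : forall m, (0 <= INR (S m) ^ j * r ^ S m)%R).
  { intros m. apply Rmult_le_pos; [apply pow_le, pos_INR|apply pow_le; lra]. }
  eapply rbdd_le; [|apply (rbdd_prod _ _ (fun n => pow_le r n ltac:(lra)) Hm0 HG HM)].
  intros [n m]. cbn [fst snd].
  rewrite !Cmod_mult, !Cmod_pow, Cmod_R, Rabs_pos_eq by apply pow_le, pos_INR. fold r.
  assert (H1 : (Cmod zeta ^ S m <= 1)%R).
  { rewrite <- (pow1 (S m)). apply pow_incr. split; [apply Cmod_ge_0|exact Hz]. }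
  assert (H2 : (r ^ ((4 * n + e) * S m) <= r ^ (n + S m))%R).
  (* Positivity of [e] gives this bound on the exponent, which separates the two indices. *)
  { assert (Hle : (n + S m <= (4 * n + e) * S m)%nat) by nia.
    replace ((4 * n + e) * S m)%nat with ((n + S m) + ((4 * n + e) * S m - (n + S m)))%nat by lia.
    rewrite (pow_add r (n + S m)).
    assert (0 <= r ^ (n + S m))%R by (apply pow_le; lra).
    assert (r ^ ((4 * n + e) * S m - (n + S m)) <= 1)%R.
    { rewrite <- (pow1 ((4 * n + e) * S m - (n + S m))). apply pow_incr; lra. }
    apply Rle_trans with (r ^ (n + S m) * 1)%R; [apply Rmult_le_compat_l|]; lra. }
  rewrite pow_add in H2.
  assert (H3 : (0 <= INR (S m) ^ j)%R) by (apply pow_le, pos_INR).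
  assert (H4 : (0 <= Cmod zeta ^ S m)%R) by (apply pow_le, Cmod_ge_0).
  assert (H5 : (0 <= r ^ ((4 * n + e) * S m))%R) by (apply pow_le; lra).
  replace (r ^ n * (INR (S m) ^ j * r ^ S m))%R with
    (INR (S m) ^ j * 1 * (r ^ n * r ^ S m))%R by ring.
  apply Rmult_le_compat; [now apply Rmult_le_pos|exact H5| |exact H2].
  now apply Rmult_le_compat_l.
Qed.

Lemma disc_an_lambert e j zeta : (0 < e)%nat -> (Cmod zeta <= 1)%R ->
  disc_an (lambert e j zeta).
Proof.
  intros He Hz. eexists. apply (has_ps_regroup
    (fun p : nat * nat => RtoC (INR (S (snd p)) ^ j) * zeta ^ S (snd p))
    (fun p => ((4 * fst p + e) * S (snd p))%nat)); [lra|].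
  intros q Hq. now apply asum_lambert.
Qed.

(** * Values at 4-torsion points *)

Definition tors (tau : C) (al be : Z) : C := (IZC al * tau + IZC be) / 4.

Lemma Cmod_root (be : Z) : Cmod (Cexp (tpi * (IZC be / 4))) = 1%R.
Proof.
  rewrite Cmod_Cexp, Re_tpi, Im_div4. cbn. rewrite <- exp_0. f_equal. field.
Qed.

(** Row n + 1 at the point (e tau + be)/4 contributes the exponent 4(n + 1) + e = 4n + (e + 4); for
    e >= -4 this is a natural number. *)
Lemma Uterm_tors tau e be p : (0 <= e + 4)%Z ->
  Uterm tau (tors tau e be) p =
  RtoC (INR (S (snd p)) ^ 1) * Cexp (tpi * (IZC be / 4)) ^ S (snd p) *
    nome tau ^ ((4 * fst p + Z.to_nat (e + 4)) * S (snd p)).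
Proof.
  intros He. unfold Uterm. rewrite pow_1, <- Cmult_assoc. f_equal.
  rewrite nome_tpi, Cpow_mult_r, <- Cpow_mult_l, !Cexp_pow, <- Cexp_plus, Cexp_pow.
  f_equal. f_equal.
  assert (E : RtoC (INR (4 * fst p + Z.to_nat (e + 4))) = 4 * RtoC (INR (fst p)) + IZC e + 4).
  { rewrite <- IZC_of_nat, Nat2Z.inj_add, Nat2Z.inj_mul, Z2Nat.id by exact He.
    rewrite !IZC_plus, IZC_mult, !IZC_of_nat. change (IZC 4) with (RtoC 4).
    replace (INR 4) with 4%R by (cbn; ring). ring. }
  rewrite E. rewrite S_INR, RtoC_plus. unfold tors. field.
Qed.

Lemma Usum_tors tau e be : (0 <= e + 4)%Z ->
  Usum tau (tors tau e be) =
  lambert (Z.to_nat (e + 4)) 1 (Cexp (tpi * (IZC be / 4))) (nome tau).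
Proof.
  intros He. unfold Usum, lambert. f_equal. apply functional_extensionality.
  intros p. now apply Uterm_tors.
Qed.

(** For Im z > 0 the row [csc2 z] expands as well and becomes the first row at z - tau. Torsion
    points off the real axis need this form, since there [csc2 z] varies with tau. *)
Lemma Wsum_shifted tau z : UHP tau -> (0 < Im z < Im tau)%R ->
  Wsum tau z = tpi * tpi * (Usum tau (z - tau) + Usum tau (- z)).
Proof.
  intros Ht Hz. rewrite Wsum_strip by (try apply Rabs_def1; lra || exact Ht).
  enough (E : csc2 z + tpi * tpi * Usum tau z = tpi * tpi * Usum tau (z - tau)).
  { transitivity (tpi * tpi * Usum tau (z - tau) + tpi * tpi * Usum tau (- z));
      [rewrite <- E|]; ring. }
  assert (H1 : asum (fun n => csc2 (RtoC (INR (S n)) * tau + z)) (tpi * tpi * Usum tau z)).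
  { apply asum_csc2_rows; [exact Ht|]. unfold UHP in Ht. rewrite Im_plus. lra. }
  assert (H2 : asum (fun n => csc2 (RtoC (INR (S n)) * tau + (z - tau))) (tpi * tpi * Usum tau (z - tau))).
  { apply asum_csc2_rows; [exact Ht|]. replace (tau + (z - tau)) with z by ring. lra. }
  pose proof (asum_nat_shift (fun n => csc2 (RtoC (INR n) * tau + z)) _ H1) as H3.
  cbv beta in H3. cbn [INR] in H3.
  replace (0 * tau + z) with z in H3 by ring.
  eapply asum_unique; [exact H3|]. eapply asum_ext; [|exact H2].
  intros n; cbn beta. f_equal. rewrite S_INR, RtoC_plus. ring.
Qed.

Lemma Im_tors tau al be : Im (tors tau al be) = (IZR al * Im tau / 4)%R.
Proof.
  unfold tors. rewrite Im_div4, Im_plus. unfold IZC. rewrite Im_scal_l. cbn. lra.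
Qed.

Lemma tors_shift tau al be k l : tors tau (al + 4 * k) (be + 4 * l) =
  tors tau al be + (IZC l + IZC k * tau).
Proof.
  unfold tors. rewrite !IZC_plus, !IZC_mult. change (IZC 4) with (RtoC 4). field.
Qed.

Lemma Wsum_tors_shift tau al be k l : UHP tau ->
  Wsum tau (tors tau (al + 4 * k) (be + 4 * l)) = Wsum tau (tors tau al be).
Proof.
  intros Ht. rewrite tors_shift. apply Wsum_per; [exact Ht|]. now exists l, k.
Qed.

Lemma tors_opp tau al be : - tors tau al be = tors tau (- al) (- be).
Proof. unfold tors. rewrite !IZC_opp. field. Qed.

(** [al] is reduced modulo 4. On the real axis [csc2] contributes a constant; otherwise the offsets
    a and 4 - a lie between 1 and 3, so both Lambert series have positive exponents. *)
Lemma Wsum_tors_disc_an al be : exists psi, disc_an psi /\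
  forall tau, UHP tau -> Wsum tau (tors tau al be) = psi (nome tau).
Proof.
  set (k := (al / 4)%Z). set (a := (al mod 4)%Z).
  assert (Ha : (0 <= a < 4)%Z) by (apply Z.mod_pos_bound; lia).
  assert (E : al = (a + 4 * k)%Z) by (unfold a, k; pose proof (Z.div_mod al 4); lia).
  assert (Hred : forall tau, UHP tau -> Wsum tau (tors tau al be) = Wsum tau (tors tau a be)).
  { intros tau Ht. rewrite E. replace be with (be + 4 * 0)%Z at 1 by lia.
    now apply Wsum_tors_shift. }
  pose proof (fun b => Req_le _ _ (Cmod_root b)) as Hroot.
  destruct (Z.eq_dec a 0) as [Ha0|Ha0].
  - exists (fun q => csc2 (IZC be / 4) + tpi * tpi *
      (lambert 4 1 (Cexp (tpi * (IZC be / 4))) q + lambert 4 1 (Cexp (tpi * (IZC (- be) / 4))) q)).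
    split.
    + apply disc_an_plus; [apply disc_an_const|]. apply disc_an_scal, disc_an_plus;
        apply disc_an_lambert; auto; lia.
    + intros tau Ht. rewrite Hred, Ha0 by exact Ht. rewrite Wsum_strip; [|exact Ht|].
      * rewrite tors_opp, !Usum_tors by lia. do 2 f_equal. unfold tors, IZC. field.
      * rewrite Im_tors, !Rmult_0_l, Rdiv_0_l, Rabs_R0. exact Ht.
  - exists (fun q => tpi * tpi * (lambert (Z.to_nat (a - 4 + 4)) 1 (Cexp (tpi * (IZC be / 4))) q
      + lambert (Z.to_nat (- a + 4)) 1 (Cexp (tpi * (IZC (- be) / 4))) q)).
    split.
    + apply disc_an_scal, disc_an_plus; apply disc_an_lambert; auto; lia.
    + intros tau Ht. rewrite Hred by exact Ht. rewrite Wsum_shifted; [|exact Ht|].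
      * replace (tors tau a be - tau) with (tors tau (a - 4) be).
        -- now rewrite tors_opp, !Usum_tors by lia.
        -- unfold tors, Z.sub. rewrite IZC_plus, IZC_opp. change (IZC 4) with (RtoC 4). field.
      * rewrite Im_tors. unfold UHP in Ht.
        assert (H1 : (1 <= IZR a)%R) by (apply (IZR_le 1); lia).
        assert (H3 : (IZR a <= 3)%R) by (apply (IZR_le _ 3); lia). nra.
Qed.

(** * Taylor coefficients in z as functions of q *)

Lemma has_ps_arg_scal k phi (c : nat -> C) r r' : (0 < Cmod k)%R -> (0 < r')%R ->
  (Cmod k * r' <= r)%R -> has_ps phi c r ->
  has_ps (fun h => phi (k * h)) (fun n => k ^ n * c n) r'.
Proof.
  intros Hk Hr' Hle [_ H]. split; [exact Hr'|]. intros h Hh.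
  eapply asum_ext; [|apply (H (k * h))].
  - intros n; cbn beta. rewrite Cpow_mult_l. ring.
  - rewrite Cmod_mult. eapply Rlt_le_trans; [|exact Hle]. now apply Rmult_lt_compat_l.
Qed.

(* [Wsum tau z = csc2 z + Hreg tau z] on the strip; [Hreg] is the part regular at 0. *)
Definition Hreg (tau z : C) : C := tpi * tpi * (Usum tau z + Usum tau (- z)).

(** Taylor coefficients of Hreg(z/2). The two powers of 1/2 come from the arguments z/2 and -z/2;
    each derivative brings down 2 pi i m, hence the index [S k]. Offset 4 and root of unity 1 belong
    to the point 0. *)
Definition hcoef (q : C) (k : nat) : C :=
  tpi * tpi * ((/ 2) ^ k + (- / 2) ^ k) *
  (ecoef k * (tpi ^ k * lambert 4 (S k) (Cexp (tpi * (IZC 0 / 4))) q)).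

Lemma disc_an_hcoef k : disc_an (fun q => hcoef q k).
Proof.
  unfold hcoef. apply disc_an_scal, disc_an_scal, disc_an_scal, disc_an_lambert; [lia|].
  rewrite Cmod_root. lra.
Qed.

Lemma tsum_Uterm_0 tau k : UHP tau ->
  tsum (fun i => Uterm tau 0 i * Umu i ^ k) =
  tpi ^ k * lambert 4 (S k) (Cexp (tpi * (IZC 0 / 4))) (nome tau).
Proof.
  intros Ht. apply tsum_eq.
  pose proof (asum_lambert 4 (S k) (Cexp (tpi * (IZC 0 / 4))) (nome tau)) as HL.
  rewrite Cmod_root in HL.
  specialize (HL ltac:(lia) (Rle_refl _) (Cmod_nome_lt tau Ht)).
  apply (asum_scal (tpi ^ k)) in HL. eapply usum_ext; [|apply HL].
  intros p; cbn beta.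
  assert (tors tau 0 0 = 0) as E0 by (unfold tors, IZC; field).
  rewrite <- E0. rewrite Uterm_tors by lia. unfold Umu. rewrite Cpow_mult_l, <- RtoC_pow.
  rewrite <- (tech_pow_Rmult _ k), pow_1, RtoC_mult.
  change (Z.to_nat (0 + 4)) with 4%nat. ring.
Qed.

Lemma has_ps_Hreg tau : UHP tau ->
  has_ps (fun z => Hreg tau (z / 2)) (hcoef (nome tau)) (Im tau).
Proof.
  intros Ht. pose proof Ht as Ht'. unfold UHP in Ht'.
  assert (Hm2 : Cmod (/ 2) = (/ 2)%R).
  { rewrite <- RtoC_inv, Cmod_R, Rabs_pos_eq; lra. }
  assert (HU : has_ps (fun h => Usum tau (0 + h))
    (fun k => ecoef k * (tpi ^ k * lambert 4 (S k) (Cexp (tpi * (IZC 0 / 4))) (nome tau)))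
    (Im tau / 2)).
  { apply (has_ps_coef_ext _ (fun k => ecoef k * tsum (fun i => Uterm tau 0 i * Umu i ^ k)));
      [intros k; now rewrite tsum_Uterm_0|].
    replace (Im tau) with (Im (tau + 0)) by (rewrite Im_plus; cbn; ring).
    apply has_ps_Usum; [exact Ht|]. rewrite Im_plus. cbn. lra. }
  assert (HU1 := fun H1 H2 H3 => has_ps_arg_scal (/ 2) _ _ _ (Im tau) H1 H2 H3 HU).
  assert (HU2 := fun H1 H2 H3 => has_ps_arg_scal (- / 2) _ _ _ (Im tau) H1 H2 H3 HU).
  rewrite Cmod_opp, Hm2 in HU2. rewrite Hm2 in HU1.
  specialize (HU1 ltac:(lra) Ht' ltac:(lra)). specialize (HU2 ltac:(lra) Ht' ltac:(lra)).
  pose proof (has_ps_scal (tpi * tpi) _ _ _ (has_ps_plus _ _ _ _ _ HU1 HU2)) as HP.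
  eapply has_ps_ext; [|eapply has_ps_coef_ext; [|exact HP]].
  - intros h _. unfold Hreg. rewrite !Cplus_0_l.
    replace (/ 2 * h) with (h / 2) by field. replace (- / 2 * h) with (- (h / 2)) by field.
    reflexivity.
  - intros k. unfold hcoef. ring.
Qed.

Lemma csc2_inv_0 : csc2_inv 0 = 0.
Proof.
  unfold csc2_inv. rewrite !Cmult_0_r, Cexp_0. field. apply tpi_nz.
Qed.

(** After the double pole is cleared, numerator and denominator are series in z with constant term
    1, because [csc2_inv] vanishes at 0. The coefficients [b] of the quotient are therefore
    polynomial in functions analytic on the disc, and are fixed before tau. *)
Lemma ratio_expansion (e2 e3 : C -> C) : disc_an e2 -> disc_an e3 ->
  exists b : C -> nat -> C, (forall k, disc_an (fun q => b q k)) /\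
  forall tau, UHP tau -> exists r, (0 < r)%R /\ forall z, (0 < Cmod z < r)%R ->
    ~ lattice tau (z / 2) /\ Wsum tau (z / 2) - e3 (nome tau) <> 0 /\
    asum (fun k => b (nome tau) k * z ^ k)
      ((Wsum tau (z / 2) - e2 (nome tau)) / (Wsum tau (z / 2) - e3 (nome tau))).
Proof.
  intros He2 He3.
  destruct (an_arg_scal (/ 2) _ an_csc2_inv) as (sg & r0 & Hsg).
  assert (Hsg0 : sg 0%nat = 0).
  { rewrite <- (has_ps_at0 _ _ _ Hsg), Cmult_0_r. apply csc2_inv_0. }
  set (del := fun (e : C) (k : nat) => match k with O => e | S _ => RtoC 0 end).
  set (n := fun (e : C -> C) q k => del 1 k + cauchy sg (fun i => hcoef q i + del (- e q) i) k).
  assert (Hdel : forall e, disc_an e -> forall k, disc_an (fun q => del (e q) k)).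
  { intros e He [|k]; [exact He|exact (disc_an_const 0)]. }
  assert (Hn : forall e, disc_an e -> forall k, disc_an (fun q => n e q k)).
  { intros e He k. unfold n. apply disc_an_plus; [exact (disc_an_const (del 1 k))|].
    apply (disc_an_cauchy (fun _ => sg)); intros i; [exact (disc_an_const (sg i))|].
    apply disc_an_plus; [apply disc_an_hcoef|]. apply (Hdel (fun q => - e q)).
    apply (disc_an_ext (fun q => - (1) * e q)); [intros; ring|now apply disc_an_scal]. }
  assert (Hn0 : forall e q, n e q 0%nat = 1).
  { intros e q. unfold n, cauchy. cbn [seq]. rewrite lsum_cons, lsum_nil, Hsg0.
    unfold del at 1. ring. }
  exists (fun q => cauchy (n e2 q) (ps_inv (n e3 q))). split.
  { intros k. apply disc_an_cauchy; [now apply Hn|].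
    intros i. apply disc_an_ps_inv; [apply Hn0|now apply Hn]. }
  intros tau Ht. pose proof Ht as Ht'. unfold UHP in Ht'. set (q := nome tau).
  destruct (Wsum_local tau Ht) as (kap & r1 & _ & Hr1 & Hloc).
  set (r := Rmin r0 (Rmin r1 (Im tau))). pose proof (proj1 Hsg) as Hr0.
  assert (Hr : (0 < r)%R) by (repeat apply Rmin_glb_lt; assumption).
  pose proof (Rmin_l r0 (Rmin r1 (Im tau))) as L1.
  pose proof (Rmin_r r0 (Rmin r1 (Im tau))) as L2.
  pose proof (Rmin_l r1 (Im tau)) as L3. pose proof (Rmin_r r1 (Im tau)) as L4.
  fold r in L1, L2.
  assert (HN : forall e, has_ps (fun z => 1 + csc2_inv (/ 2 * z) * (Hreg tau (z / 2) + - e q))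
    (n e q) r).
  { intros e. apply has_ps_plus; [now apply has_ps_const|].
    apply (has_ps_mult (fun z => csc2_inv (/ 2 * z))).
    - apply has_ps_le with r0; [lra|exact Hsg].
    - apply has_ps_plus; [|now apply has_ps_const].
      apply has_ps_le with (Im tau); [lra|now apply has_ps_Hreg]. }
  destruct (has_ps_inv _ _ _ (HN e3)) as (s & Hs & HI & Hnz).
  { rewrite Hn0. exact C1_nz. }
  pose proof (proj1 HI) as Hs0.
  pose proof (has_ps_mult _ _ _ _ _ (has_ps_le _ _ _ s (conj Hs0 Hs) (HN e2)) HI) as [_ HM].
  exists s. split; [exact Hs0|]. intros z Hz.
  assert (Hm2 : Cmod (z / 2) = (Cmod z / 2)%R).
  { rewrite Cmod_div, Cmod_R, Rabs_pos_eq; try lra. exact C2_nz. }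
  destruct (Hloc (z / 2)) as [HL _]; [rewrite Hm2; lra|].
  assert (HnZ : ~ isZ (z / 2)) by (intros H; now apply HL, isZ_lattice).
  destruct (csc2_inv_spec _ HnZ) as [Ec Hc].
  assert (HW : Wsum tau (z / 2) = / csc2_inv (z / 2) + Hreg tau (z / 2)).
  { rewrite <- Ec. apply Wsum_strip; [exact Ht|].
    eapply Rle_lt_trans; [apply Im_le_Cmod|]. rewrite Hm2. lra. }
  specialize (Hnz z (proj2 Hz)). specialize (HM z (proj2 Hz)). cbv beta in Hnz, HM.
  replace (/ 2 * z) with (z / 2) in Hnz, HM by field.
  set (cv := csc2_inv (z / 2)) in *. set (Hv := Hreg tau (z / 2)) in *.
  assert (E : forall e : C, Wsum tau (z / 2) - e = (1 + cv * (Hv + - e)) / cv).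
  { intros e. rewrite HW. field. exact Hc. }
  split; [exact HL|]. split.
  - rewrite E. intros E0. apply Hnz.
    replace (1 + cv * (Hv + - e3 q)) with ((1 + cv * (Hv + - e3 q)) / cv * cv) by (field; auto).
    rewrite E0. ring.
  - rewrite !E.
    replace ((1 + cv * (Hv + - e2 q)) / cv / ((1 + cv * (Hv + - e3 q)) / cv)) with
      ((1 + cv * (Hv + - e2 q)) * / (1 + cv * (Hv + - e3 q))) by (field; auto).
    exact HM.
Qed.

(** * The developing map in terms of [Wsum] *)

Lemma tors_not_lattice tau al be : UHP tau -> ~ ((4 | al)%Z /\ (4 | be)%Z) ->
  ~ lattice tau (tors tau al be).
Proof.
  intros Ht Hn (m & k & E).
  assert (E' : lat tau (al, be) = lat tau ((4 * k)%Z, (4 * m)%Z)).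
  { unfold lat. cbn [fst snd]. rewrite !IZC_mult. change (IZC 4) with (RtoC 4).
    transitivity (4 * tors tau al be); [unfold tors; field|rewrite E; ring]. }
  apply lat_inj in E'; [|exact Ht]. pose proof (f_equal fst E') as E1.
  pose proof (f_equal snd E') as E2. cbn [fst snd] in E1, E2.
  apply Hn. split; [exists k|exists m]; lia.
Qed.

Definition fW (tau v1 v2 v3 w : C) : C :=
  (Wsum tau v1 - Wsum tau v3) / (Wsum tau v1 - Wsum tau v2) *
  ((Wsum tau (w / 2) - Wsum tau v2) / (Wsum tau (w / 2) - Wsum tau v3)).

(** The images of tau/4, 1/4 and 1/4 + tau/2, formed at gamma tau, under multiplication by c tau +
    d. Their coordinates are the rows of gamma, the third being row 2 plus twice row 1. *)
Definition tv1 (g : SL2Z) tau := tors tau (ma g) (mb g).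
Definition tv2 (g : SL2Z) tau := tors tau (mc g) (md g).
Definition tv3 (g : SL2Z) tau := tors tau (mc g + 2 * ma g) (md g + 2 * mb g).

(** A row of a matrix of determinant 1 is not divisible by 4. *)
Lemma tv1_nl g tau : UHP tau -> ~ lattice tau (tv1 g tau).
Proof.
  intros Ht. apply tors_not_lattice; [exact Ht|]. intros [[x Hx] [y Hy]].
  pose proof (SL2Z_det g) as Hd. rewrite Hx, Hy in Hd. nia.
Qed.

Lemma tv2_nl g tau : UHP tau -> ~ lattice tau (tv2 g tau).
Proof.
  intros Ht. apply tors_not_lattice; [exact Ht|]. intros [[x Hx] [y Hy]].
  pose proof (SL2Z_det g) as Hd. rewrite Hx, Hy in Hd. nia.
Qed.

(** Row 1 together with row 2 plus twice row 1 still has determinant 1. *)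
Lemma tv3_nl g tau : UHP tau -> ~ lattice tau (tv3 g tau).
Proof.
  intros Ht. apply tors_not_lattice; [exact Ht|]. intros [[x Hx] [y Hy]].
  pose proof (SL2Z_det g) as Hd.
  assert (E : (ma g * (md g + 2 * mb g) - mb g * (mc g + 2 * ma g) = 1)%Z) by lia.
  rewrite Hx, Hy in E. nia.
Qed.

Lemma wp_act_Wsum g tau : UHP tau -> exists K : C, forall u v : C, u <> 0 ->
  jfac g tau * u = v -> ~ lattice tau v ->
  wp (lattice (act g tau)) u = jfac g tau ^ 2 * (Wsum tau v - K).
Proof.
  intros Ht. destruct (wp_Wsum tau Ht) as [K HK]. exists K. intros u v Hu Huv Hv.
  rewrite wp_act by assumption. rewrite Huv. now rewrite HK.
Qed.

Lemma jfac_tors g tau : UHP tau ->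
  jfac g tau * (act g tau / 4) = tv1 g tau /\ jfac g tau * (1 / 4) = tv2 g tau /\
  jfac g tau * (1 / 4 + act g tau / 2) = tv3 g tau.
Proof.
  intros Ht. pose proof (jfac_nz g tau Ht) as Hj. unfold act, tv1, tv2, tv3, tors.
  rewrite !IZC_plus, !IZC_mult. change (IZC 2) with (RtoC 2).
  split; [|split].
  - field. exact Hj.
  - unfold jfac. field.
  - transitivity (jfac g tau / 4 + (IZC (ma g) * tau + IZC (mb g)) / 2);
      [field; exact Hj|unfold jfac; field].
Qed.

Lemma UHP_nz tau : UHP tau -> tau <> 0.
Proof. unfold UHP. intros Ht ->. cbn in Ht. lra. Qed.

Lemma Cdiv_scal (k x y : C) : k <> 0 -> y <> 0 -> (k * x) / (k * y) = x / y.
Proof. intros Hk Hy. field. auto. Qed.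

(** The inequality for tau/4 and 1/4 is applied at gamma tau and pulled back by homogeneity of wp;
    in differences both additive constants cancel. *)
Lemma tv_neq g tau : UHP tau -> Wsum tau (tv1 g tau) - Wsum tau (tv2 g tau) <> 0.
Proof.
  intros Ht E. pose proof (UHP_act g tau Ht) as Ht2. pose proof (jfac_nz g tau Ht) as Hj.
  destruct (wp_act_Wsum g tau Ht) as [K HK].
  destruct (wp_Wsum _ Ht2) as [K' HK'].
  destruct (jfac_tors g tau Ht) as (E1 & E2 & _).
  assert (N1 : act g tau / 4 <> 0).
  { intros E0. apply (UHP_nz _ Ht2). transitivity (4 * (act g tau / 4)); [field|].
    rewrite E0. ring. }
  assert (N2 : RtoC 1 / 4 <> 0).
  { rewrite <- RtoC_div by lra. apply RtoC_nz. lra. }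
  pose proof (HK _ _ N1 E1 (tv1_nl g tau Ht)) as W1.
  pose proof (HK _ _ N2 E2 (tv2_nl g tau Ht)) as W2.
  assert (L1 : ~ lattice (act g tau) (act g tau / 4)).
  { rewrite (lattice_act g tau) by exact Ht. rewrite E1. now apply tv1_nl. }
  assert (L2 : ~ lattice (act g tau) (1 / 4)).
  { rewrite (lattice_act g tau) by exact Ht. rewrite E2. now apply tv2_nl. }
  rewrite HK' in W1 by exact L1. rewrite HK' in W2 by exact L2.
  apply (Wsum_quarter_neq _ Ht2). unfold quarter. change (IZC 1) with (RtoC 1).
  change (act g tau * / 4) with (act g tau / 4). change (1 * / 4) with (1 / 4).
  apply Ceq_minus.
  replace (Wsum (act g tau) (act g tau / 4) - Wsum (act g tau) (1 / 4)) with
    ((Wsum (act g tau) (act g tau / 4) - K') - (Wsum (act g tau) (1 / 4) - K')) by ring.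
  rewrite W1, W2.
  replace (jfac g tau ^ 2 * (Wsum tau (tv1 g tau) - K) - jfac g tau ^ 2 * (Wsum tau (tv2 g tau) - K))
    with (jfac g tau ^ 2 * (Wsum tau (tv1 g tau) - Wsum tau (tv2 g tau))) by ring.
  rewrite E. ring.
Qed.

(** Only quotients of differences of wp occur, so the factor j^2 and the constant [K] cancel. *)
Lemma f_act g tau (z : C) : UHP tau -> z <> RtoC 0 -> ~ lattice tau (jfac g tau * z / 2) ->
  Wsum tau (jfac g tau * z / 2) - Wsum tau (tv3 g tau) <> 0 ->
  f z (act g tau) = fW tau (tv1 g tau) (tv2 g tau) (tv3 g tau) (jfac g tau * z).
Proof.
  intros Ht Hz HL Hnz. pose proof (UHP_act g tau Ht) as Ht2. pose proof (jfac_nz g tau Ht) as Hj.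
  destruct (wp_act_Wsum g tau Ht) as [K HK].
  destruct (jfac_tors g tau Ht) as (E1 & E2 & E3).
  assert (N1 : act g tau / 4 <> 0).
  { intros E0. apply (UHP_nz _ Ht2). transitivity (4 * (act g tau / 4)); [field|].
    rewrite E0. ring. }
  assert (N2 : RtoC 1 / 4 <> 0).
  { rewrite <- RtoC_div by lra. apply RtoC_nz. lra. }
  assert (N3 : 1 / 4 + act g tau / 2 <> 0).
  { intros E0. rewrite E0, Cmult_0_r in E3. apply (tv3_nl g tau Ht). rewrite <- E3.
    exists 0%Z, 0%Z. unfold IZC. ring. }
  assert (N4 : z / 2 <> 0).
  { intros E0. apply Hz. transitivity (2 * (z / 2)); [field|]. rewrite E0. ring. }
  assert (E4 : jfac g tau * (z / 2) = jfac g tau * z / 2) by field.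
  unfold f. cbv zeta.
  rewrite (HK _ _ N1 E1 (tv1_nl g tau Ht)), (HK _ _ N2 E2 (tv2_nl g tau Ht)),
    (HK _ _ N3 E3 (tv3_nl g tau Ht)), (HK _ _ N4 E4 HL).
  unfold fW.
  assert (Hd : forall x y : C, jfac g tau ^ 2 * (x - K) - jfac g tau ^ 2 * (y - K) =
    jfac g tau ^ 2 * (x - y)) by (intros; ring).
  rewrite !Hd, !Cdiv_scal; auto using tv_neq, Cpow_nz.
Qed.

Lemma SL2Z_1_det : (1 * 1 - 0 * 0 = 1)%Z.
Proof. reflexivity. Qed.

Definition SL2Z_1 : SL2Z := mkSL2Z 1 0 0 1 SL2Z_1_det.

Lemma jfac_1 tau : jfac SL2Z_1 tau = 1.
Proof. unfold jfac, IZC. cbn [mc md SL2Z_1]. ring. Qed.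

Lemma act_1 tau : act SL2Z_1 tau = tau.
Proof. unfold act. rewrite jfac_1. unfold IZC. cbn [ma mb SL2Z_1]. field. Qed.

(** [den] and [num] depend on gamma and not on tau. The identity matrix gives the coefficients
    themselves, a general gamma their expansion at the cusp gamma(oo); the power of j, from
    rescaling z to j z, is the one that [slash] divides out. *)
Lemma f_expansion g : exists (den : C -> C) (num : C -> nat -> C),
  disc_an den /\ (forall k, disc_an (fun q => num q k)) /\
  forall tau, UHP tau -> den (nome tau) <> 0 /\
    power_series_at_0 (fun z => f z (act g tau))
      (fun k => num (nome tau) k / den (nome tau) * jfac g tau ^ k).
Proof.
  destruct (Wsum_tors_disc_an (ma g) (mb g)) as (e1 & D1 & W1).
  destruct (Wsum_tors_disc_an (mc g) (md g)) as (e2 & D2 & W2).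
  destruct (Wsum_tors_disc_an (mc g + 2 * ma g) (md g + 2 * mb g)) as (e3 & D3 & W3).
  destruct (ratio_expansion e2 e3 D2 D3) as (b & Db & Hb).
  exists (fun q => e1 q - e2 q), (fun q k => (e1 q - e3 q) * b q k).
  split; [now apply disc_an_minus|]. split.
  { intros k. apply disc_an_mult; [now apply disc_an_minus|apply Db]. }
  intros tau Ht. specialize (W1 tau Ht). specialize (W2 tau Ht). specialize (W3 tau Ht).
  fold (tv1 g tau) in W1. fold (tv2 g tau) in W2. fold (tv3 g tau) in W3.
  pose proof (tv_neq g tau Ht) as Hnz. rewrite W1, W2 in Hnz.
  split; [exact Hnz|].
  destruct (Hb tau Ht) as (r & Hr & HB). set (q := nome tau) in *.
  pose proof (jfac_nz g tau Ht) as Hj. pose proof (proj1 (Cmod_gt_0 _) Hj) as Hj'.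
  assert (HP : power_series_at_0 (fun w => (e1 q - e3 q) / (e1 q - e2 q) *
     ((Wsum tau (w / 2) - e2 q) / (Wsum tau (w / 2) - e3 q)))
     (fun k => (e1 q - e3 q) / (e1 q - e2 q) * b q k)).
  { apply power_series_at_0_scal, power_series_at_0_iff. exists r. split; [exact Hr|].
    intros z Hz. now apply HB. }
  apply (power_series_at_0_arg_scal _ _ _ Hj) in HP.
  replace (fun k => (e1 q - e3 q) * b q k / (e1 q - e2 q) * jfac g tau ^ k) with
    (fun k => (e1 q - e3 q) / (e1 q - e2 q) * b q k * jfac g tau ^ k).
  2: { apply functional_extensionality. intros k. field. exact Hnz. }
  eapply (power_series_at_0_ext _ _ _ (r / Cmod (jfac g tau))); [| |exact HP].
  - now apply Rdiv_lt_0_compat.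
  - intros z Hz. cbv beta.
    assert (Hjz : (0 < Cmod (jfac g tau * z) < r)%R).
    { rewrite Cmod_mult. split; [apply Rmult_lt_0_compat; lra|].
      replace r with (Cmod (jfac g tau) * (r / Cmod (jfac g tau)))%R by (field; lra).
      apply Rmult_lt_compat_l; lra. }
    destruct (HB _ Hjz) as (HL & HD & _).
    rewrite f_act; [|exact Ht| |exact HL|].
    + unfold fW. now rewrite W1, W2, W3.
    + apply Cmod_gt_0. lra.
    + now rewrite W3.
Qed.

Lemma tv_Gamma4 g tau : Gamma4 g -> UHP tau ->
  Wsum tau (tv1 g tau) = Wsum tau (tv1 SL2Z_1 tau) /\
  Wsum tau (tv2 g tau) = Wsum tau (tv2 SL2Z_1 tau) /\
  Wsum tau (tv3 g tau) = Wsum tau (tv3 SL2Z_1 tau).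
Proof.
  intros ([x Hx] & [y Hy] & [u Hu] & [v Hv]) Ht. unfold tv1, tv2, tv3.
  cbn [ma mb mc md SL2Z_1].
  replace (ma g) with (1 + 4 * x)%Z by lia. replace (mb g) with (0 + 4 * y)%Z by lia.
  replace (mc g) with (0 + 4 * u)%Z by lia. replace (md g) with (1 + 4 * v)%Z by lia.
  split; [|split].
  - now apply Wsum_tors_shift.
  - now apply Wsum_tors_shift.
  - replace (0 + 4 * u + 2 * (1 + 4 * x))%Z with (0 + 2 * 1 + 4 * (u + 2 * x))%Z by lia.
    replace (1 + 4 * v + 2 * (0 + 4 * y))%Z with (1 + 2 * 0 + 4 * (v + 2 * y))%Z by lia.
    now apply Wsum_tors_shift.
Qed.

(** A punctured disc suffices for comparing expansions at 0, and on it both sides are given by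
    genuine values of wp. *)
Lemma f_Gamma4 g tau : Gamma4 g -> UHP tau -> exists r, (0 < r)%R /\
  forall z, (0 < Cmod z < r)%R -> f z (act g tau) = f (jfac g tau * z) tau.
Proof.
  intros Hg Ht. pose proof (jfac_nz g tau Ht) as Hj.
  pose proof (proj1 (Cmod_gt_0 _) Hj) as Hj'.
  destruct (tv_Gamma4 g tau Hg Ht) as (W1 & W2 & W3).
  (* It supplies a radius below which z/2 avoids the lattice and the denominator of the ratio is
     nonzero; the value 0 for the numerator is a filler. *)
  destruct (ratio_expansion (fun _ => 0) (fun _ => Wsum tau (tv3 g tau)) (disc_an_const _)
    (disc_an_const _)) as (b & _ & Hb).
  destruct (Hb tau Ht) as (r & Hr & HB).
  exists (r / Cmod (jfac g tau))%R. split; [now apply Rdiv_lt_0_compat|].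
  intros z Hz.
  assert (Hjz : (0 < Cmod (jfac g tau * z) < r)%R).
  { rewrite Cmod_mult. split; [apply Rmult_lt_0_compat; lra|].
    replace r with (Cmod (jfac g tau) * (r / Cmod (jfac g tau)))%R by (field; lra).
    apply Rmult_lt_compat_l; lra. }
  destruct (HB _ Hjz) as (HL & HD & _).
  assert (Hz0 : z <> 0) by (apply Cmod_gt_0; lra).
  rewrite f_act by assumption.
  transitivity (f (jfac g tau * z) (act SL2Z_1 tau)); [|now rewrite act_1].
  rewrite f_act; rewrite ?jfac_1, ?Cmult_1_l; auto.
  - unfold fW. now rewrite W1, W2, W3.
  - now apply Cmult_neq_0.
  - now rewrite <- W3.
Qed.

Theorem corollary4p5 :
  (forall tau : C, UHP tau ->
     exists! c : nat -> C, power_series_at_0 (fun z => f z tau) c)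
  /\
  forall a : nat -> C -> C,
    (forall tau : C, UHP tau ->
       power_series_at_0 (fun z => f z tau) (fun k => a k tau)) ->
    forall k : nat,
      holomorphic_on_UHP (a k)
      /\ (forall g : SL2Z, Gamma4 g ->
          forall tau : C, UHP tau -> a k (act g tau) = jfac g tau ^ k * a k tau)
      /\ meromorphic_at_cusps_X4 k (a k).
Proof.
  destruct (f_expansion SL2Z_1) as (den & num & Hden & Hnum & Hf).
  assert (Hf1 : forall tau, UHP tau -> power_series_at_0 (fun z => f z tau)
    (fun k => num (nome tau) k / den (nome tau))).
  { intros tau Ht. destruct (Hf tau Ht) as [_ HP]. rewrite act_1 in HP.
    replace (fun k => num (nome tau) k / den (nome tau)) with
      (fun k => num (nome tau) k / den (nome tau) * jfac SL2Z_1 tau ^ k); [exact HP|].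
    apply functional_extensionality. intros k. rewrite jfac_1, Cpow_1_l. ring. }
  split.
  - intros tau Ht. exists (fun k => num (nome tau) k / den (nome tau)).
    split; [now apply Hf1|]. intros c Hc.
    eapply power_series_at_0_unique; [now apply Hf1|exact Hc].
  - intros a Ha k. split; [|split].
    + intros tau Ht. apply an_ex_derive.
      assert (HE : forall phi, disc_an phi -> an (fun h => phi (nome (tau + h)))).
      { intros phi Hphi.
        apply (an_ext (fun h => phi (nome tau * Cexp (tpi / 4 * h))) _ 1%R); [lra| |].
        - intros h _. f_equal. rewrite !nome_tpi, <- Cexp_plus. f_equal. field.
        - apply disc_an_exp; [exact Hphi|now apply Cmod_nome_lt]. }
      apply (an_ext (fun h => num (nome (tau + h)) k / den (nome (tau + h))) _ (Im tau));
        [exact Ht| |].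
      * intros h Hh.
        assert (Hth : UHP (tau + h)).
        { unfold UHP in *. rewrite Im_plus. pose proof (Im_le_Cmod h) as Hi.
          assert (Hi' : (Rabs (Im h) < Im tau)%R) by lra. apply Rabs_def2 in Hi'. lra. }
        (* The family [a] is known through its expansions; their uniqueness identifies it with the
           quotients in q. *)
        pose proof (power_series_at_0_unique _ _ _ (Hf1 _ Hth) (Ha _ Hth)) as E.
        exact (f_equal (fun c => c k) E).
      * apply an_div; [now apply (HE (fun q => num q k))|now apply HE|].
        rewrite Cplus_0_r. now apply Hf.
    + intros g Hg tau Ht. pose proof (jfac_nz g tau Ht) as Hj.
      destruct (f_Gamma4 g tau Hg Ht) as (r & Hr & E).
      (* Replacing z by j z multiplies the k-th coefficient by j^k, which is the source of the
         weight. *)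
      pose proof (power_series_at_0_arg_scal _ _ _ Hj (Ha tau Ht)) as HP.
      apply (power_series_at_0_ext _ (fun z => f z (act g tau)) _ r Hr) in HP.
      * pose proof (power_series_at_0_unique _ _ _ (Ha _ (UHP_act g tau Ht)) HP) as Ec.
        pose proof (f_equal (fun c => c k) Ec) as Ek. cbv beta in Ek. rewrite Ek. ring.
      * intros z Hz. now rewrite E.
    + intros g. destruct (f_expansion g) as (dg & ng & Hdg & Hng & Hfg).
      exists (fun q => ng q k / dg q). split.
      * assert (Hi : UHP Ci) by (unfold UHP, Ci; cbn; lra).
        apply (meromorphic_quotient (fun q => ng q k) dg (nome Ci)).
        -- apply Hng.
        -- exact Hdg.
        -- now apply Cmod_nome_lt.
        -- now apply Hfg.
      * intros tau Ht. change (Cexp (2 * RtoC PI * Ci * tau / 4)) with (nome tau).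
        destruct (Hfg tau Ht) as [Hd HP]. pose proof (jfac_nz g tau Ht) as Hj.
        pose proof (power_series_at_0_unique _ _ _ (Ha _ (UHP_act g tau Ht)) HP) as Ec.
        pose proof (f_equal (fun c => c k) Ec) as Ek. cbv beta in Ek.
        unfold slash. rewrite Ek. field. split; [exact Hd|now apply Cpow_nz].
Qed.
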